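(* Let $r\in\mathbb{N}$ and $\gamma_1,\ldots,\gamma_r\in\mathbb{C}$ with $\Re\gamma_j>0$ $(1\leqslant j\leqslant r)$. Then \begin{align*} \zeta^{\rm des}_r((s_j);(\gamma_j)) &=\prod_{k=1}^r\frac{1}{(e^{2\pi is_k}-1)\Gamma(s_k)}\int_{\mathcal{C}^r}\lim_{c\to1}\frac{(-1)^r}{(c-1)^r}\widetilde{\mathfrak{H}}_r((t_j);(\gamma_j);c)\prod_{k=1}^rt_k^{s_k-1}dt_k\\ &=\prod_{k=1}^r\frac{1}{(e^{2\pi is_k}-1)\Gamma(s_k)}\\ &\quad\times\int_{\mathcal{C}^r}\prod_{j=1}^r\lim_{c\to1}\frac{(-1)}{c-1}\left(\frac{1}{\exp\left(\gamma_j\sum_{k=j}^rt_k\right)-1}-\frac{c}{\exp\left(c\gamma_j\sum_{k=j}^rt_k\right)-1}\right)\prod_{k=1}^rt_k^{s_k-1}dt_k, \end{align*} and this function can be analytically continued to $\mathbb{C}^r$ as an entire function in $(s_j)=(s_1,\ldots,s_r)$.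
   Context: For $c\in\mathbb{R}$ put $$\widetilde{\mathfrak{H}}_r((t_j);(\gamma_j);c)=\prod_{j=1}^r\left(\frac{1}{\exp\left(\gamma_j\sum_{k=j}^rt_k\right)-1}-\frac{c}{\exp\left(c\gamma_j\sum_{k=j}^rt_k\right)-1}\right),$$ which is holomorphic in $(t_j)$ around the origin (removable singularities filled in). $\mathcal{C}$ is the Hankel contour: the path coming from $+\infty$ along the top side of the positive real axis, going once counterclockwise around the origin on a circle of sufficiently small radius $\varepsilon$ (depending on the $\gamma_j$), and returning to $+\infty$ along the bottom side of the positive real axis; $t^{s-1}=\exp((s-1)\log t)$ with $\arg t$ going from $0$ to $2\pi$ along $\mathcal{C}$. The desingularized multiple zeta-function is defined by $$\zeta^{\rm des}_r((s_j);(\gamma_j)):=\lim_{c\to1,\ c\in\mathbb{R}\setminus\{1\}}\frac{(-1)^r}{(c-1)^r}\prod_{k=1}^r\frac{1}{(e^{2\pi is_k}-1)\Gamma(s_k)}\int_{\mathcal{C}^r}\widetilde{\mathfrak{H}}_r((t_j);(\gamma_j);c)\prod_{k=1}^rt_k^{s_k-1}dt_k .$$ In these formulas the factor $1/((e^{2\pi is_k}-1)\Gamma(s_k))$ is a meromorphic function of $s_k$ (finite at $s_k\in\mathbb{Z}_{\leqslant0}$, with poles at positive integers); the formulas are read for $s_k\notin\{1,2,3,\dots\}$, and the value at points with some $s_k$ a positive integer is given by analytic continuation. *)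

(* Defs.v *)
From HB Require Import structures.
From mathcomp Require Import all_boot all_order all_algebra.
From mathcomp Require Import all_classical all_reals all_analysis.
From mathcomp Require Import complex.

Set Implicit Arguments.
Unset Strict Implicit.
Unset Printing Implicit Defensive.

Import Order.TTheory GRing.Theory Num.Theory.
Import numFieldNormedType.Exports.

Local Open Scope classical_set_scope.
Local Open Scope complex_scope.
Local Open Scope ring_scope.

(* The usual topology and norm on the complex numbers: those that R[i] has as
   a numFieldType. *)
HB.instance Definition _ (R : realType) := NormedModule.copy R[i] R[i]^o.

Section ComplexFunctions.
Context {R : realType}.
Implicit Types (s w z : R[i]) (f : R[i] -> R[i]).

Definition cexp z : R[i] :=
  (expR (complex.Re z) * cos (complex.Im z)) +i*
  (expR (complex.Re z) * sin (complex.Im z)).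

(* The value at z of a meromorphic function given by a formula f, removable
   singularities filled in: it is f z wherever f is continuous. *)
Definition fill_removable f z : R[i] := lim (f w @[w --> z^']).

(* Euler's limit n! n^s / (s (s + 1) ... (s + n)), which converges for every s
   other than 0, -1, -2, ...; at these poles the value is 0 by convention. *)
Definition cGamma s : R[i] :=
  lim ((n`!%:R * cexp (s * (ln n%:R)%:C) / \prod_(k < n.+1) (s + k%:R))
       @[n --> \oo]).

Definition entire n (F : 'rV[R[i]]_n -> R[i]) : Prop :=
  forall x : 'rV[R[i]]_n, differentiable F x.

Definition hankel_factor s : R[i] :=
  fill_removable
    (fun w => ((cexp ((2 * pi)%:C * 'i%C * w) - 1) * cGamma w)^-1) s.

End ComplexFunctions.

Section LebesgueIntegralOnTuples.
Context {R : realType}.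

Definition Cintegral (f : R -> R[i]) : R[i] :=
  (\int[lebesgue_measure]_u complex.Re (f u))%R +i*
  (\int[lebesgue_measure]_u complex.Im (f u))%R.

Fixpoint Cintegral_tuple r : (r.-tuple R -> R[i]) -> R[i] :=
  match r with
  | 0 => fun f => f [tuple]
  | r'.+1 => fun f =>
      Cintegral (fun u => Cintegral_tuple (fun v => f [tuple of u :: v]))
  end.

Fixpoint eintegral_tuple r : (r.-tuple R -> \bar R) -> \bar R :=
  match r with
  | 0 => fun f => f [tuple]
  | r'.+1 => fun f =>
      (\int[lebesgue_measure]_u eintegral_tuple (fun v => f [tuple of u :: v]))%E
  end.

(* By Tonelli, absolute integrability for the product Lebesgue measure. *)
Definition Cintegrable_tuple r (f : r.-tuple R -> R[i]) : Prop :=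
  [/\ measurable_fun setT (fun v => complex.Re (f v)),
      measurable_fun setT (fun v => complex.Im (f v)) &
      (eintegral_tuple (fun v => (complex.Re `|f v|)%:E) < +oo)%E].

End LebesgueIntegralOnTuples.

(* The Hankel contour of radius eps, parametrized by the real line: u <= 0 is
   the top side of [eps, +oo[ (coming from +oo), 0 <= u <= 2 pi is the circle,
   and 2 pi <= u is the bottom side.  Its points are given together with their
   logarithm, whose imaginary part goes from 0 to 2 pi. *)
Section HankelContour.
Context {R : realType}.
Variable eps : R.
Implicit Type u : R.

Definition hankel_arg u : R := Num.min (Num.max u 0) (2 * pi).

Definition hankel_modulus u : R :=
  eps + Num.max (- u) 0 + Num.max (u - 2 * pi) 0.

Definition hankel_log u : R[i] := ln (hankel_modulus u) +i* hankel_arg u.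

Definition hankel_point u : R[i] := cexp (hankel_log u).

(* The derivative of hankel_point in u, off the junctions u = 0, 2 pi. *)
Definition hankel_speed u : R[i] :=
  if u < 0 then -1 else if u <= 2 * pi then 'i%C * hankel_point u else 1.

Definition hankel_path r (v : r.-tuple R) : 'I_r -> R[i] :=
  fun k => hankel_point (tnth v k).

(* f (t_j) \prod_k t_k^{s_k - 1} dt_k, pulled back to the parameters *)
Definition hankel_integrand r (s : 'rV[R[i]]_r) (f : ('I_r -> R[i]) -> R[i])
    (v : r.-tuple R) : R[i] :=
  f (hankel_path v) *
  \prod_(k < r) (cexp ((s 0 k - 1) * hankel_log (tnth v k)) *
                 hankel_speed (tnth v k)).

Definition hankel_integrable r (s : 'rV[R[i]]_r) f : Prop :=
  Cintegrable_tuple (hankel_integrand s f).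

Definition hankel_integral r (s : 'rV[R[i]]_r) f : R[i] :=
  Cintegral_tuple (hankel_integrand s f).

End HankelContour.

Section DesingularizedZeta.
Context {R : realType}.
Variable r : nat.
Implicit Types (gamma t : 'I_r -> R[i]) (s : 'rV[R[i]]_r) (c : R).

Definition desing_factor (g : R[i]) c (z : R[i]) : R[i] :=
  fill_removable
    (fun w => (cexp (g * w) - 1)^-1 - c%:C / (cexp (c%:C * g * w) - 1)) z.

Definition tail_sum t (j : 'I_r) : R[i] := \sum_(k < r | (j <= k)%N) t k.

Definition desing_gen gamma c t : R[i] :=
  \prod_(j < r) desing_factor (gamma j) c (tail_sum t j).

Definition desing_zeta_approx (eps : R) gamma s c : R[i] :=
  (-1) ^+ r / (c%:C - 1) ^+ r * (\prod_(k < r) hankel_factor (s 0 k)) *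
  hankel_integral eps s (desing_gen gamma c).

Definition desing_zeta (eps : R) gamma s : R[i] :=
  lim (desing_zeta_approx eps gamma s c @[c --> (1 : R)^']).

End DesingularizedZeta.

(* Main.v *)
(* Proof idea.  The j-th factor of the generating function, divided by 1 - c,
   is a holomorphic quotient K_j(c, z) built from the remainders
   (e^z - \sum_(i < k) z^i / i!) / z^k.  On a narrow strip around the positive
   half-line K_j is bounded by a decaying exponential and is Lipschitz in c at
   c = 1, relative to the same exponential.  Hence the integrals converge
   absolutely, and the limit c -> 1 may be taken under the integral sign.

   For the continuation, let L be the logarithm of the point t of the contour.
   Off the positive integers, factor(s) t^{s-1} has a first order expansion in s
   with a quadratic remainder dominated by a power of t.  At a positive integer
   n the factor has a simple pole, but t^{n-1} is single-valued, so its integral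
   against a holomorphic decaying function vanishes; hence t^{s-1} can be
   replaced by t^{s-1} - t^{n-1}, whose quotient by s - n is
   t^{n-1} L (e^{(s-n)L} - 1) / ((s - n) L).  This replacement, as well as a
   change of eps, is made one variable at a time.  Cauchy's theorem is only
   needed for the change of radius, where it amounts to differentiating the
   circle integral with respect to the radius. *)

Require Import Defs.
From mathcomp Require Import all_boot all_order all_algebra.
From mathcomp Require Import all_classical all_reals all_analysis.
From mathcomp Require Import complex.
From mathcomp Require Import measurable_realfun.
From mathcomp Require Import ring lra.

Set Implicit Arguments.
Unset Strict Implicit.
Unset Printing Implicit Defensive.

Import Order.TTheory GRing.Theory Num.Theory.
Import numFieldNormedType.Exports.

Local Open Scope classical_set_scope.
Local Open Scope complex_scope.
Local Open Scope ring_scope.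

(** The obstacle is that [entire] asks for a Frechet differential in all the exponents at once,
    positive integers included, while the integrals are iterated Lebesgue integrals. Every integrand
    is therefore kept below a constant times a product of factors exp(-b |u_k|) in the parameters;
    this one majorant gives convergence, Fubini and linearity. The product of the weights is
    expanded to first order jointly in all exponents, with a quadratic error below such a product,
    and the expansion is integrated term by term. Removable quotients, derivatives and error terms
    are all expressed by the functions sum_i z^i / (i + k)!, which are linked by a recurrence and
    bounded by exp |z|. The strip must be narrow because 1 / (e^{c gamma w} - 1) has further poles
    at the nonzero multiples of 2 pi i / (c gamma); Re gamma > 0 keeps them away from the positive
    half-line. The arguments of the kernels are tail sums of at most r contour points, so these
    points are taken in a strip r times narrower. Decay in every variable comes from the factor j =
    0 alone, whose argument is the full sum. *)

Local Notation normc := ComplexField.Normc.normc.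
Local Notation mu := (@lebesgue_measure _).

(** * Complex analysis *)

Section ComplexNorm.
Context {R : realType}.
Implicit Types (x y z w : R[i]) (e : R).

Lemma normr_normc z : `|z| = (normc z)%:C.
Proof. by []. Qed.

Lemma normc_ge0 z : 0 <= normc z.
Proof. by case: z => a b; exact: sqrtr_ge0. Qed.

Lemma normc0 : normc (0 : R[i]) = 0.
Proof. exact: ComplexField.Normc.normc0. Qed.

Lemma normc1 : normc (1 : R[i]) = 1.
Proof. exact: ComplexField.Normc.normc1. Qed.

Lemma normcM x y : normc (x * y) = normc x * normc y.
Proof. exact: ComplexField.Normc.normcM. Qed.

Lemma normcV x : normc x^-1 = (normc x)^-1.
Proof. exact: ComplexField.Normc.normcV. Qed.

Lemma normc_eq0 z : (normc z == 0) = (z == 0).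
Proof.
apply/eqP/eqP => [/ComplexField.Normc.eq0_normc //|->]; exact: normc0.
Qed.

Lemma normc_gt0 z : (0 < normc z) = (z != 0).
Proof. by rewrite lt_def normc_ge0 andbT normc_eq0. Qed.

Lemma normcD x y : normc (x + y) <= normc x + normc y.
Proof. exact: le_normcD. Qed.

Lemma normcN x : normc (- x) = normc x.
Proof. exact: complex.normcN. Qed.

Lemma normcB x y : normc (x - y) <= normc x + normc y.
Proof. by rewrite -(normcN y); exact: normcD. Qed.

Lemma normc_distC x y : normc (x - y) = normc (y - x).
Proof. by rewrite -normcN opprB. Qed.

Lemma normcBl x y : normc x - normc y <= normc (x - y).
Proof. by rewrite lerBlDr (le_trans _ (normcD _ _))// subrK. Qed.

Lemma normcX x n : normc (x ^+ n) = normc x ^+ n.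
Proof.
by elim: n => [|n IH]; rewrite ?expr0 ?normc1// !exprS normcM IH.
Qed.

Lemma normc_real (e : R) : normc e%:C = `|e|.
Proof. by rewrite /= expr0n/= addr0 sqrtr_sqr. Qed.

Lemma normc_nat n : normc (n%:R : R[i]) = n%:R.
Proof. by rewrite -[n%:R](rmorph_nat (real_complex R)) normc_real normr_nat. Qed.

Lemma normc_i : normc ('i%C : R[i]) = 1.
Proof. by rewrite /= expr0n/= add0r expr1n sqrtr1. Qed.

Lemma normc_sum (I : Type) (s : seq I) (P : pred I) (F : I -> R[i]) :
  normc (\sum_(i <- s | P i) F i) <= \sum_(i <- s | P i) normc (F i).
Proof.
elim/big_ind2: _ => //; first by rewrite normc0.
by move=> x1 y1 x2 y2 h1 h2; rewrite (le_trans (normcD _ _))// lerD.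
Qed.

Lemma normc_prod (I : Type) (s : seq I) (P : pred I) (F : I -> R[i]) :
  normc (\prod_(i <- s | P i) F i) = \prod_(i <- s | P i) normc (F i).
Proof.
elim/big_ind2: _ => //; first by rewrite normc1.
by move=> x1 y1 x2 y2 <- <-; rewrite normcM.
Qed.

Lemma Re_le_normc z : `|complex.Re z| <= normc z.
Proof.
case: z => a b /=; rewrite -sqrtr_sqr ler_wsqrtr// lerDl; exact: sqr_ge0.
Qed.

Lemma Im_le_normc z : `|complex.Im z| <= normc z.
Proof.
case: z => a b /=; rewrite -sqrtr_sqr ler_wsqrtr// lerDr; exact: sqr_ge0.
Qed.

Lemma normc_le_ReIm z : normc z <= `|complex.Re z| + `|complex.Im z|.
Proof.
case: z => a b /=.
rewrite -(ger0_norm (addr_ge0 (normr_ge0 a) (normr_ge0 b))) -sqrtr_sqr.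
rewrite ler_wsqrtr// sqrrD -!normrX !(ger0_norm (sqr_ge0 _)).
by rewrite lerD2r lerDl mulrn_wge0// mulr_ge0.
Qed.

Lemma ReD z w : complex.Re (z + w) = complex.Re z + complex.Re w.
Proof. by case: z => a b; case: w. Qed.

Lemma ImD z w : complex.Im (z + w) = complex.Im z + complex.Im w.
Proof. by case: z => a b; case: w. Qed.

Lemma ReN z : complex.Re (- z) = - complex.Re z.
Proof. by case: z. Qed.

Lemma ImN z : complex.Im (- z) = - complex.Im z.
Proof. by case: z. Qed.

Lemma ReM z w : complex.Re (z * w) =
  complex.Re z * complex.Re w - complex.Im z * complex.Im w.
Proof. by case: z => a b; case: w. Qed.

Lemma ImM z w : complex.Im (z * w) =
  complex.Re z * complex.Im w + complex.Im z * complex.Re w.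
Proof. by case: z => a b; case: w. Qed.

Lemma eq_ReIm z w : complex.Re z = complex.Re w ->
  complex.Im z = complex.Im w -> z = w.
Proof. by case: z w => a b [c d] /= -> ->. Qed.

Lemma Re_sum (I : Type) (s : seq I) (P : pred I) (F : I -> R[i]) :
  complex.Re (\sum_(i <- s | P i) F i) = \sum_(i <- s | P i) complex.Re (F i).
Proof. by elim/big_ind2: _ => // x1 y1 x2 y2 <- <-; rewrite ReD. Qed.

Lemma Im_sum (I : Type) (s : seq I) (P : pred I) (F : I -> R[i]) :
  complex.Im (\sum_(i <- s | P i) F i) = \sum_(i <- s | P i) complex.Im (F i).
Proof. by elim/big_ind2: _ => // x1 y1 x2 y2 <- <-; rewrite ImD. Qed.

(** A positive element of [R[i]] is real, since the order compares only numbers with equal imaginary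
    parts. Complex epsilons may thus be replaced by real ones, and the later estimates live in
    [R]. *)
Lemma cvg_normcP (T : Type) (F : set_system T) (FF : Filter F)
    (f : T -> R[i]) (l : R[i]) :
  f x @[x --> F] --> l <->
  (forall e, 0 < e -> \forall x \near F, normc (l - f x) < e).
Proof.
split=> [/cvgrPdist_lt h e e0|h].
  have /h : 0 < e%:C :> R[i] by rewrite ltcR.
  by apply: filterS => x; rewrite normr_normc ltcR.
apply/cvgrPdist_lt => -[e e'] he.
have [-> e0] : e' = 0 /\ 0 < e by move: he; rewrite ltcE/= => /andP[/eqP].
by near=> x; rewrite normr_normc ltcR; near: x; exact: h.
Unshelve. all: by end_near. Qed.

Lemma near_normcP z (P : R[i] -> Prop) :
  (\forall w \near z, P w) <->
  (exists2 e, 0 < e & forall w, normc (w - z) < e -> P w).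
Proof.
split=> [/nbhs_normP[[e e'] /=]|[e e0 h]].
  rewrite ltcE/= => /andP[/eqP -> e0 h]; exists e => // w wz; apply: h.
  by rewrite /= normr_normc normc_distC ltcR.
apply/nbhs_normP; exists e%:C; first by rewrite /= ltcR.
by move=> w /=; rewrite normr_normc ltcR normc_distC; exact: h.
Qed.

Lemma cvg_normc_le (T : Type) (F : set_system T) (FF : Filter F)
    (f : T -> R[i]) (l : R[i]) (g : T -> R) :
  (\forall x \near F, normc (l - f x) <= g x) -> g x @[x --> F] --> 0 ->
  f x @[x --> F] --> l.
Proof.
move=> fg /cvgrPdist_lt g0; apply/cvg_normcP => e e0.
near=> x; apply: le_lt_trans (_ : g x < e); first by near: x.
apply: le_lt_trans (ler_norm _) _; rewrite -normrN -sub0r.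
by near: x; exact: g0.
Unshelve. all: by end_near. Qed.

Lemma cvg_Re (T : Type) (F : set_system T) (FF : Filter F)
    (f : T -> R[i]) (l : R[i]) :
  f x @[x --> F] --> l -> complex.Re (f x) @[x --> F] --> complex.Re l.
Proof.
move=> /cvg_normcP h; apply/cvgrPdist_lt => e /h; apply: filterS => x.
by rewrite -ReN -ReD; apply: le_lt_trans; exact: Re_le_normc.
Qed.

Lemma cvg_Im (T : Type) (F : set_system T) (FF : Filter F)
    (f : T -> R[i]) (l : R[i]) :
  f x @[x --> F] --> l -> complex.Im (f x) @[x --> F] --> complex.Im l.
Proof.
move=> /cvg_normcP h; apply/cvgrPdist_lt => e /h; apply: filterS => x.
by rewrite -ImN -ImD; apply: le_lt_trans; exact: Im_le_normc.
Qed.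

Lemma cvg_complex (T : Type) (F : set_system T) (FF : Filter F)
    (f : T -> R[i]) (a b : R) :
  complex.Re (f x) @[x --> F] --> a -> complex.Im (f x) @[x --> F] --> b ->
  f x @[x --> F] --> a +i* b.
Proof.
move=> /cvgrPdist_lt ha /cvgrPdist_lt hb; apply/cvg_normcP => e e0.
have e20 : 0 < e / 2 by rewrite divr_gt0.
near=> x; apply: le_lt_trans (normc_le_ReIm _) _; rewrite (splitr e) ltrD//.
- by rewrite ReD ReN/=; near: x; exact: ha.
- by rewrite ImD ImN/=; near: x; exact: hb.
Unshelve. all: by end_near. Qed.

Lemma cvg_real_complex (T : Type) (F : set_system T) (FF : Filter F)
    (f : T -> R) (a : R) :
  f x @[x --> F] --> a -> (f x)%:C @[x --> F] --> a%:C.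
Proof. by move=> h; apply: cvg_complex => //=; exact: cvg_cst. Qed.

End ComplexNorm.

(** * Complex differentiability through first-order remainders *)

Section ComplexDerivative.
Context {R : realType}.
Implicit Types (f g : R[i] -> R[i]) (z w d h : R[i]).

(** Direction 1 over the field [R[i]] makes this complex differentiability. The remainder form has
    no division by h, so it composes well and can be proved from explicit bounds. *)
Lemma is_derive_normcP f z d :
  is_derive z 1 f d <->
  (forall e : R, 0 < e -> exists2 rho : R, 0 < rho &
     forall h, normc h < rho -> normc (f (z + h) - f z - d * h) <= e * normc h).
Proof.
have E h : h != 0 -> d - h^-1 *: ((f \o shift z) (h *: 1) - f z) =
    - (h^-1 * (f (z + h) - f z - d * h)).
  move=> h0; rewrite /= /GRing.scale /= mulr1 (addrC h z) [in RHS]mulrBr opprB.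
  by congr (_ - _); rewrite mulrCA mulVf// mulr1.
split=> [[/cvg_ex[l fl] fd]|H].
  have ld : l = d by rewrite -fd; apply/esym; exact: cvg_lim.
  rewrite ld in fl; move/cvg_normcP : fl => fl e /fl.
  rewrite near_withinE => /near_normcP[rho rho0 H]; exists rho => // h hrho.
  have [->|h0] := eqVneq h 0.
    by rewrite !normc0 addr0 subrr mulr0 subr0 normc0 mulr0.
  have := H h; rewrite subr0 => /(_ hrho h0); rewrite E// normcN normcM normcV.
  by rewrite mulrC ltr_pdivrMr ?normc_gt0// => /ltW.
suff fl : h^-1 *: ((f \o shift z) (h *: 1) - f z) @[h --> 0^'] --> d.
  by apply: DeriveDef; [apply/cvg_ex; exists d|exact: cvg_lim].
apply/cvg_normcP => e e0; rewrite near_withinE; apply/near_normcP.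
have [|rho rho0 {}H] := H (e / 2); first by rewrite divr_gt0.
exists rho => // h; rewrite subr0 => hrho h0.
rewrite E// normcN normcM normcV mulrC ltr_pdivrMr ?normc_gt0//.
apply: le_lt_trans (H _ hrho) _; rewrite ltr_pM2r ?normc_gt0//.
by rewrite gtr_pMr// invf_lt1// ltr1n.
Qed.

Lemma is_derive_quadratic f z d (K rho : R) : 0 < rho ->
  (forall h, normc h < rho -> normc (f (z + h) - f z - d * h) <=
     K * normc h ^+ 2) -> is_derive z 1 f d.
Proof.
move=> rho0 hf; apply/is_derive_normcP => e e0.
have K0 : 0 < `|K| + 1 by rewrite ltr_wpDl.
exists (Num.min rho (e / (`|K| + 1))); first by rewrite lt_min rho0 divr_gt0.
move=> h; rewrite lt_min => /andP[h1 h2].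
apply: le_trans (hf _ h1) _; rewrite expr2 mulrA ler_wpM2r ?normc_ge0//.
apply: (@le_trans _ _ ((`|K| + 1) * normc h)).
  by rewrite ler_wpM2r ?normc_ge0// (le_trans (ler_norm _))// lerDl.
by rewrite mulrC -ler_pdivlMr// ltW.
Qed.

Lemma is_derive_cvg f z d : is_derive z 1 f d -> f w @[w --> z] --> f z.
Proof.
move=> [/derivable1_diffP hf _]; exact: (differentiable_continuous hf).
Qed.

Lemma is_deriveV_complex f z d : f z != 0 -> is_derive z 1 f d ->
  is_derive z 1 (fun w => (f w)^-1) (- d / f z ^+ 2).
Proof.
move=> fz0 [fd <-]; apply: DeriveDef; first exact: derivableV.
by rewrite deriveV// /GRing.scale /= mulrC mulrN mulNr.
Qed.

Lemma is_deriveM_complex f g z a b : is_derive z 1 f a -> is_derive z 1 g b ->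
  is_derive z 1 (fun w => f w * g w) (a * g z + f z * b).
Proof.
by move=> fa gb; apply: is_derive_eq; rewrite /GRing.scale /= addrC (mulrC a).
Qed.

Lemma is_deriveD_complex f g z a b : is_derive z 1 f a -> is_derive z 1 g b ->
  is_derive z 1 (fun w => f w + g w) (a + b).
Proof. by move=> fa gb; exact: is_deriveD. Qed.

Lemma is_deriveN_complex f z a : is_derive z 1 f a ->
  is_derive z 1 (fun w => - f w) (- a).
Proof. by move=> fa; exact: is_deriveN. Qed.

Lemma is_deriveZ_complex f z a (k : R[i]) : is_derive z 1 f a ->
  is_derive z 1 (fun w => k * f w) (k * a).
Proof.
by move=> fa; have := is_deriveM_complex (is_derive_cst k z 1) fa; rewrite mul0r add0r.
Qed.

Lemma is_derive_comp_complex f g z a b :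
  is_derive z 1 f a -> is_derive (f z) 1 g b ->
  is_derive z 1 (fun w => g (f w)) (b * a).
Proof.
move=> /is_derive_normcP Hf /is_derive_normcP Hg.
apply/is_derive_normcP => e e0.
set A := normc a + 1; set B := normc b + 1.
have A0 : 0 < A by rewrite ltr_wpDl ?normc_ge0.
have B0 : 0 < B by rewrite ltr_wpDl ?normc_ge0.
have [|r1 r10 {}Hg] := Hg (e / 2 / A); first by rewrite !divr_gt0.
(* The bound 1 gives |k| <= A |h| for the increment k of f; the bound e / 2 / B lets b times the
   error of f take at most half of e. *)
have [|r2 r20 {}Hf] := Hf (Num.min 1 (e / 2 / B)).
  by rewrite lt_min ltr01 !divr_gt0.
exists (Num.min r2 (r1 / A)); first by rewrite lt_min r20 divr_gt0.
move=> h; rewrite lt_min => /andP[h2 h1].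
set k := f (z + h) - f z.
have k' : normc (k - a * h) <= Num.min 1 (e / 2 / B) * normc h by exact: Hf.
have kh : normc k <= A * normc h.
  rewrite -(subrK (a * h) k); apply: le_trans (normcD _ _) _.
  rewrite normcM /A mulrDl addrC lerD2l (le_trans k')//.
  by rewrite ler_wpM2r ?normc_ge0// ge_min lexx.
have kr1 : normc k < r1 by rewrite (le_lt_trans kh)// mulrC -ltr_pdivlMr.
have -> : g (f (z + h)) - g (f z) - b * a * h =
    (g (f z + k) - g (f z) - b * k) + b * (k - a * h).
  by rewrite /k (addrC (f z)) subrK; ring.
apply: le_trans (normcD _ _) _; rewrite normcM (splitr e) mulrDl lerD//.
  apply: le_trans (Hg _ kr1) _.
  apply: (@le_trans _ _ (e / 2 / A * (A * normc h))).
    by rewrite ler_wpM2l// !divr_ge0// ltW.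
  by rewrite mulrA mulfVK// lt0r_neq0.
apply: (@le_trans _ _ (B * (e / 2 / B * normc h))).
  rewrite ler_pM ?normc_ge0 ?lerDl// (le_trans k')//.
  by rewrite ler_wpM2r ?normc_ge0// ge_min lexx orbT.
by rewrite mulrA mulrCA mulfV ?lt0r_neq0// mulr1.
Qed.

Lemma is_derive_scale_complex f z a (k : R[i]) : is_derive (k * z) 1 f a ->
  is_derive z 1 (fun w => f (k * w)) (a * k).
Proof.
move=> fa; rewrite -[X in is_derive _ _ _ (a * X)]mulr1.
exact: is_derive_comp_complex (is_deriveZ_complex k (is_derive_id z 1)) fa.
Qed.

End ComplexDerivative.

Section ComplexExponential.
Context {R : realType}.
Implicit Types (z w : R[i]) (a b : R).

Lemma cexpD z w : cexp (z + w) = cexp z * cexp w.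
Proof.
rewrite /cexp ReD ImD expRD cosD sinD; apply: eq_ReIm; rewrite ?ReM ?ImM/=; ring.
Qed.

Lemma cexp0 : cexp (0 : R[i]) = 1.
Proof. by rewrite /cexp /= expR0 cos0 sin0 mulr1 mulr0. Qed.

Lemma normc_cexp z : normc (cexp z) = expR (complex.Re z).
Proof.
rewrite /cexp /= !exprMn -mulrDr cos2Dsin2 mulr1 sqrtr_sqr ger0_norm// expR_ge0.
Qed.

Lemma cexp_neq0 z : cexp z != 0.
Proof. by rewrite -normc_gt0 normc_cexp expR_gt0. Qed.

Lemma cexpN z : cexp (- z) = (cexp z)^-1.
Proof.
by apply: (mulfI (cexp_neq0 z)); rewrite -cexpD subrr cexp0 mulfV// cexp_neq0.
Qed.

Lemma cexp_real a : cexp a%:C = (expR a)%:C.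
Proof. by rewrite /cexp /= cos0 sin0 mulr1 mulr0. Qed.

Lemma cexpM_nat z n : cexp (n%:R * z) = cexp z ^+ n.
Proof.
elim: n => [|n IH]; first by rewrite mul0r cexp0 expr0.
by rewrite -[n.+1]addn1 natrD mulrDl mul1r cexpD IH addn1 exprSr.
Qed.

Lemma cexp_2pi : cexp ((2 * pi)%:C * 'i%C) = 1 :> R[i].
Proof.
rewrite /cexp ReM ImM /= !(mul0r, mulr0, mulr1, subr0, addr0, add0r) oppr0 expR0.
by rewrite mulr_natl cos2pi sin2pi mul1r mulr0.
Qed.

Lemma cexp_2pi_nat n : cexp ((2 * pi)%:C * 'i%C * n%:R) = 1 :> R[i].
Proof. by rewrite mulrC cexpM_nat cexp_2pi expr1n. Qed.

End ComplexExponential.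

(** * Curves in the complex plane and the mean value inequality *)

Section ComplexCurves.
Context {R : realType}.
Implicit Types (f g : R -> R[i]) (t : R) (d : R[i]).

(** The normed structure of [R[i]] is over [R[i]] itself, so the derivative in a real variable is
    taken on real and imaginary parts. *)
Definition is_derive_curve f t d :=
  is_derive t 1 (fun u => complex.Re (f u)) (complex.Re d) /\
  is_derive t 1 (fun u => complex.Im (f u)) (complex.Im d).

Lemma is_derive_curve_cst d t : is_derive_curve (fun=> d) t 0.
Proof. by split; exact: is_derive_cst. Qed.

Lemma is_derive_curveD f g t a b : is_derive_curve f t a ->
  is_derive_curve g t b -> is_derive_curve (fun u => f u + g u) t (a + b).
Proof.
move=> [fa fa'] [gb gb']; split.
- by under eq_fun do rewrite ReD; rewrite ReD; exact: is_deriveD.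
- by under eq_fun do rewrite ImD; rewrite ImD; exact: is_deriveD.
Qed.

Lemma is_derive_curveN f t a : is_derive_curve f t a ->
  is_derive_curve (fun u => - f u) t (- a).
Proof.
move=> [fa fa']; split.
- by under eq_fun do rewrite ReN; rewrite ReN; exact: is_deriveN.
- by under eq_fun do rewrite ImN; rewrite ImN; exact: is_deriveN.
Qed.

Lemma is_derive_curveM f g t a b : is_derive_curve f t a ->
  is_derive_curve g t b ->
  is_derive_curve (fun u => f u * g u) t (a * g t + f t * b).
Proof.
move=> [fa fa'] [gb gb']; split.
- under eq_fun do rewrite ReM.
  apply: is_derive_eq; rewrite !(ReD, ReM) /GRing.scale /=; ring.
- under eq_fun do rewrite ImM.
  apply: is_derive_eq; rewrite !(ImD, ImM) /GRing.scale /=; ring.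
Qed.

Lemma is_derive_curve_real t : is_derive_curve (real_complex R) t 1.
Proof. by split => /=; [exact: is_derive_id|exact: is_derive_cst]. Qed.

Lemma is_derive_curve_exp z t :
  is_derive_curve (fun u => cexp (u%:C * z)) t (z * cexp (t%:C * z)).
Proof.
case: z => a b; rewrite /is_derive_curve /cexp /=.
split.
- under eq_fun do rewrite !mul0r subr0 addr0.
  apply: is_derive_eq; rewrite /GRing.scale/= !mul0r subr0 addr0; ring.
- under eq_fun do rewrite !mul0r subr0 addr0.
  apply: is_derive_eq; rewrite /GRing.scale/= !mul0r subr0 addr0; ring.
Qed.

(** The curve is projected on the direction of its total increment w, by multiplying with the
    conjugate of w and taking the real part. The real mean value theorem then bounds |w|^2 by |w|
    M. *)
Lemma mean_value_curve f df (M : R) :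
  (forall t, is_derive_curve f t (df t)) ->
  (forall t, 0 <= t <= 1 -> normc (df t) <= M) -> normc (f 1 - f 0) <= M.
Proof.
move=> fd dM; set w := f 1 - f 0.
have M0 : 0 <= M by apply: le_trans (dM 0 _); rewrite ?normc_ge0 ?lexx ?ler01.
have [->|w0] := eqVneq w 0; first by rewrite normc0.
pose c := w^*.
have cE : normc c = normc w.
  by rewrite /c; case: (w) => a b /=; rewrite sqrrN.
pose phi u := complex.Re (c * f u).
have phid t : is_derive t 1 phi (complex.Re (c * df t)).
  have [] := is_derive_curveM (is_derive_curve_cst c t) (fd t).
  by rewrite mul0r add0r.
have phic : {within `[0, 1]%classic, continuous phi}.
  apply: derivable_within_continuous => t _; exact: (@ex_derive _ _ _ _ _ _ _ (phid t)).
have [t t01 ht] := MVT (@ltr01 R) (fun t _ => phid t) phic.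
have := Re_le_normc (c * df t); rewrite normcM cE => h1.
have E : phi 1 - phi 0 = normc w ^+ 2.
  rewrite /phi -ReN -ReD -mulrBr -/w /c; case: (w) => a b /=.
  rewrite sqr_sqrtr ?addr_ge0 ?sqr_ge0//; ring.
rewrite -(@ler_pM2l _ (normc w)) ?normc_gt0// -expr2 -E ht subr0 mulr1.
apply: le_trans (ler_norm _) _; apply: (le_trans h1).
rewrite ler_wpM2l ?normc_ge0//; apply: dM.
by move: t01; rewrite in_itv/= => /andP[/ltW -> /ltW ->].
Qed.

End ComplexCurves.

(** * Normalized Taylor remainders of the exponential *)

Section ExponentialRemainders.
Context {R : realType}.
Implicit Types (z w h : R[i]) (k : nat).

Definition exp_poly k z := \sum_(i < k) z ^+ i / i`!%:R.

(** This is the entire function sum_i z^i / (i + k)! in closed form; the value at 0 is its constant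
    term. For k = 0 it is exp, for k = 1 it is (e^z - 1) / z. *)
Definition exp_rem k z : R[i] :=
  if z == 0 then (k`!%:R)^-1 else (cexp z - exp_poly k z) / z ^+ k.

Lemma exp_polyS k z : exp_poly k.+1 z = exp_poly k z + z ^+ k / k`!%:R.
Proof. by rewrite /exp_poly big_ord_recr. Qed.

Lemma natf_fact_neq0 k : k`!%:R != 0 :> R[i].
Proof. by rewrite pnatr_eq0 -lt0n fact_gt0. Qed.

Lemma is_derive_curve_pow z k t :
  is_derive_curve (fun u => (u%:C * z) ^+ k.+1) t (k.+1%:R * z * (t%:C * z) ^+ k).
Proof.
have h1 : is_derive_curve (fun u => u%:C * z) t z.
  have := is_derive_curveM (is_derive_curve_real t) (is_derive_curve_cst z t).
  by rewrite mul1r mulr0 addr0.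
elim: k => [|k IH].
  by under eq_fun do rewrite expr1; rewrite mul1r expr0 mulr1.
under eq_fun do rewrite exprS.
have := is_derive_curveM h1 IH; congr (is_derive_curve _ _ _).
rewrite -[in RHS](addn1 k.+1) natrD exprS; ring.
Qed.

Lemma is_derive_curve_exp_poly z k t :
  is_derive_curve (fun u => exp_poly k.+1 (u%:C * z)) t
    (z * exp_poly k (t%:C * z)).
Proof.
elim: k => [|k IH].
  under eq_fun do rewrite exp_polyS /exp_poly big_ord0 expr0 add0r.
  by rewrite /exp_poly big_ord0 mulr0; exact: is_derive_curve_cst.
under eq_fun do rewrite exp_polyS.
rewrite exp_polyS mulrDr; apply: is_derive_curveD IH _.
have := is_derive_curveM (is_derive_curve_pow z k t)
  (is_derive_curve_cst (k.+1`!%:R)^-1 t).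
rewrite mulr0 addr0; congr (is_derive_curve _ _ _).
rewrite factS natrM invfM.
have k0 : k.+1%:R != 0 :> R[i] by rewrite pnatr_eq0.
move: (natf_fact_neq0 k) k0.
move: (k`!%:R) (k.+1%:R) (t%:C * z) => f e y f0 e0.
by field; rewrite e0 f0.
Qed.

(** Along the segment t z, the t-derivative of the remainder of order k + 1 is z times the remainder
    of order k. The mean value inequality therefore raises the exponent by one at each step of the
    induction. *)
Lemma normc_exp_sub_poly k z :
  normc (cexp z - exp_poly k z) <= normc z ^+ k * expR (normc z).
Proof.
elim: k z => [|k IH] z.
  rewrite /exp_poly big_ord0 subr0 expr0 mul1r normc_cexp ler_expR.
  by rewrite (le_trans (ler_norm _))// Re_le_normc.
pose f u := cexp (u%:C * z) - exp_poly k.+1 (u%:C * z).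
have -> : cexp z - exp_poly k.+1 z = f 1 - f 0.
  rewrite /f mul1r mul0r cexp0; suff -> : exp_poly k.+1 0 = 1.
    by rewrite subrr subr0.
  rewrite /exp_poly big_ord_recl expr0 fact0 divr1 big1 ?addr0// => i _.
  by rewrite /= exprS !mul0r.
apply: (@mean_value_curve _ f
  (fun t => z * (cexp (t%:C * z) - exp_poly k (t%:C * z)))) => [t|t /andP[t0 t1]].
  rewrite mulrBr; apply: is_derive_curveD; first exact: is_derive_curve_exp.
  by apply: is_derive_curveN; exact: is_derive_curve_exp_poly.
have tz : normc (t%:C * z) <= normc z.
  by rewrite normcM normc_real ger0_norm// ler_piMl// normc_ge0.
rewrite normcM exprS -mulrA ler_wpM2l ?normc_ge0// (le_trans (IH _))//.
by rewrite ler_pM ?exprn_ge0 ?normc_ge0 ?expR_ge0 ?ler_expR// lerXn2r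
  // nnegrE normc_ge0.
Qed.

Lemma exp_rem_rec k z : exp_rem k z = (k`!%:R)^-1 + z * exp_rem k.+1 z.
Proof.
rewrite /exp_rem; have [->|z0] := eqVneq z 0; first by rewrite mul0r addr0.
have zk : z ^+ k != 0 by rewrite expf_neq0.
rewrite exp_polyS exprS; have := natf_fact_neq0 k.
move: (cexp z) (exp_poly k z) (z ^+ k) zk (k`!%:R) => a b c c0 f f0.
by field; rewrite z0 c0 f0.
Qed.

Lemma exp_rem0 z : exp_rem 0 z = cexp z.
Proof.
rewrite /exp_rem /exp_poly big_ord0 expr0 divr1 subr0 fact0 invr1.
by case: eqP => // ->; rewrite cexp0.
Qed.

Lemma exp_rem_at0 k : exp_rem k 0 = (k`!%:R)^-1.
Proof. by rewrite /exp_rem eqxx. Qed.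

Lemma normc_exp_rem k z : normc (exp_rem k z) <= expR (normc z).
Proof.
rewrite /exp_rem; have [->|z0] := eqVneq z 0.
  rewrite normc0 expR0 normcV normc_nat invf_le1 ?ltr0n ?fact_gt0//.
  by rewrite ler1n fact_gt0.
rewrite normcM normcV normcX ler_pdivrMr ?exprn_gt0 ?normc_gt0// mulrC.
exact: normc_exp_sub_poly.
Qed.

Lemma exp_rem1E z : z * exp_rem 1 z = cexp z - 1.
Proof.
by rewrite -exp_rem0 [in RHS]exp_rem_rec fact0 invr1 addrC addKr.
Qed.

Lemma is_derive_cexp z : is_derive z 1 (@cexp R) (cexp z).
Proof.
apply: (@is_derive_quadratic _ _ _ _ (normc (cexp z) * expR 1) 1 ltr01) => h h1.
have -> : cexp (z + h) - cexp z - cexp z * h = cexp z * (h ^+ 2 * exp_rem 2 h).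
  rewrite cexpD -(exp_rem0 h) exp_rem_rec (exp_rem_rec 1) !factS !fact0 !invr1.
  ring.
rewrite 2!normcM normcX -[leRHS]mulrA ler_wpM2l ?normc_ge0// mulrC.
rewrite ler_wpM2r ?exprn_ge0 ?normc_ge0//.
by rewrite (le_trans (normc_exp_rem _ _))// ler_expR ltW.
Qed.

(** The formula is the termwise derivative of sum_i z^i / (i + k)!. At 0 the recurrence, used twice,
    exhibits the quadratic error; at a fixed z other than 0 the recurrence is solved for
    [exp_rem k.+1] and differentiated by induction on k. *)
Lemma is_derive_exp_rem k z :
  is_derive z 1 (@exp_rem k) (exp_rem k z - k%:R * exp_rem k.+1 z).
Proof.
have [->|z0] := eqVneq z 0.
  apply: (@is_derive_quadratic _ _ _ _ (expR 1) 1 ltr01) => h h1.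
  have -> : exp_rem k (0 + h) - exp_rem k 0 -
      (exp_rem k 0 - k%:R * exp_rem k.+1 0) * h = h ^+ 2 * exp_rem k.+2 h.
    rewrite add0r (exp_rem_rec k h) (exp_rem_rec k.+1 h) !exp_rem_at0.
    have := natf_fact_neq0 k; have : k.+1%:R != 0 :> R[i] by rewrite pnatr_eq0.
    rewrite factS natrM -[k.+1]addn1 natrD.
    by move: (k`!%:R) (exp_rem _ h) (k%:R) => a b c c0 a0; field; rewrite a0 c0.
  rewrite normcM normcX mulrC ler_wpM2r ?exprn_ge0 ?normc_ge0//.
  by rewrite (le_trans (normc_exp_rem _ _))// ler_expR ltW.
elim: k => [|k IH].
  rewrite mul0r subr0 (_ : @exp_rem 0 = @cexp R) ?exp_rem0; last first.
    by apply/funext => w; rewrite exp_rem0.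
  exact: is_derive_cexp.
have E w : w != 0 -> exp_rem k.+1 w = (exp_rem k w - (k`!%:R)^-1) * w^-1.
  by move=> w0; rewrite (exp_rem_rec k) addrC addKr mulrAC mulfV ?mul1r.
pose g w := (exp_rem k w - (k`!%:R)^-1) * w^-1.
have gz : is_derive z 1 g ((exp_rem k z - k%:R * exp_rem k.+1 z) * z^-1 +
    (exp_rem k z - (k`!%:R)^-1) * (- 1 / z ^+ 2)).
  apply: is_deriveM_complex; last first.
    by apply: (is_deriveV_complex z0); exact: is_derive_id.
  rewrite -[X in is_derive _ _ _ X]subr0.
  by apply: is_deriveB; exact: is_derive_cst.
have near_neq0 : \forall w \near z, w != 0.
  apply/near_normcP; exists (normc z); rewrite ?normc_gt0// => w.
  by apply: contraTneq => ->; rewrite sub0r normcN ltxx.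
have -> : exp_rem k.+1 z - k.+1%:R * exp_rem k.+2 z =
  (exp_rem k z - k%:R * exp_rem k.+1 z) * z^-1 +
    (exp_rem k z - (k`!%:R)^-1) * (- 1 / z ^+ 2).
  rewrite (exp_rem_rec k z) (exp_rem_rec k.+1 z).
  have := natf_fact_neq0 k; have : k.+1%:R != 0 :> R[i] by rewrite pnatr_eq0.
  rewrite factS natrM -[k.+1]addn1 natrD.
  by move: (k`!%:R) (exp_rem _ z) (k%:R) => a b c c0 a0; field; rewrite a0 c0 z0.
apply: near_eq_is_derive gz.
by apply: filterS near_neq0 => w w0; rewrite /g E.
Qed.

End ExponentialRemainders.

(** * The reciprocal Gamma function and the Hankel factor *)

Section Jets.
Context {R : realType}.
Implicit Types (f g : R[i] -> R[i]) (x y h : R[i]) (b : R).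

(** A first-order expansion at x on the unit disc. One constant bounds value, derivative and
    quadratic error together, so that the constants of a long product can be followed by
    multiplication and then passed to the limit. *)
Definition jet x f d b := [/\ normc (f x) <= b, normc d <= b &
  forall h, normc h <= 1 -> normc (f (x + h) - f x - d * h) <= b * normc h ^+ 2].

Lemma jet_ge0 x f d b : jet x f d b -> 0 <= b.
Proof. by move=> [+ _ _]; apply: le_trans; exact: normc_ge0. Qed.

Lemma jetW x f d b b' : b <= b' -> jet x f d b -> jet x f d b'.
Proof.
move=> bb [h0 h1 h2]; split; [exact: le_trans bb|exact: le_trans bb|].
move=> h hh; apply: (le_trans (h2 _ hh)).
by rewrite ler_wpM2r ?exprn_ge0 ?normc_ge0.
Qed.

Lemma jetD x f g d e b c : jet x f d b -> jet x g e c ->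
  jet x (fun y => f y + g y) (d + e) (b + c).
Proof.
move=> [f0 f1 f2] [g0 g1 g2]; split.
- by rewrite (le_trans (normcD _ _))// lerD.
- by rewrite (le_trans (normcD _ _))// lerD.
move=> h hh; rewrite mulrDl.
have -> : f (x + h) + g (x + h) - (f x + g x) - (d * h + e * h) =
  (f (x + h) - f x - d * h) + (g (x + h) - g x - e * h) by ring.
by rewrite (le_trans (normcD _ _))// mulrDl lerD ?f2 ?g2.
Qed.

Lemma jet_le3 x f d b h : jet x f d b -> normc h <= 1 ->
  normc (f (x + h)) <= 3 * b.
Proof.
move=> J h1; have b0 := jet_ge0 J; case: J => [f0 f1 /(_ _ h1) f2].
have -> : f (x + h) = (f (x + h) - f x - d * h) + (f x + d * h) by ring.
rewrite (le_trans (normcD _ _))//.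
have -> : 3 * b = b * 1 + (b + b * 1) by ring.
rewrite lerD//.
  by rewrite (le_trans f2)// ler_wpM2l// exprn_ile1// normc_ge0.
by rewrite (le_trans (normcD _ _))// lerD// normcM ler_pM ?normc_ge0.
Qed.

(** The error of the product splits into the error of f times g (x + h), the affine part of f times
    the error of g, and d e h^2. These cost 3, 2 and 1 times b c, whence the 6. *)
Lemma jetM x f g d e b c : jet x f d b -> jet x g e c ->
  jet x (fun y => f y * g y) (d * g x + f x * e) (6 * b * c).
Proof.
move=> Jf Jg; have b0 := jet_ge0 Jf; have c0 := jet_ge0 Jg.
have bc0 : 0 <= b * c by rewrite mulr_ge0.
have g3 h := jet_le3 (h := h) Jg.
case: Jf Jg => [f0 f1 f2] [g0 g1 g2]; split.
- rewrite normcM (le_trans (ler_pM _ _ f0 g0)) ?normc_ge0//.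
  by rewrite -mulrA ler_peMl// ler1n.
- rewrite (le_trans (normcD _ _))// !normcM.
  have := ler_pM (normc_ge0 _) (normc_ge0 _) f1 g0.
  have := ler_pM (normc_ge0 _) (normc_ge0 _) f0 g1.
  by move=> *; lra.
move=> h h1.
have -> : f (x + h) * g (x + h) - f x * g x - (d * g x + f x * e) * h =
  (f (x + h) - f x - d * h) * g (x + h) +
  ((f x + d * h) * (g (x + h) - g x - e * h) + d * e * h ^+ 2) by ring.
set H2 := normc h ^+ 2; have H20 : 0 <= H2 by rewrite exprn_ge0 ?normc_ge0.
have -> : 6 * b * c * H2 =
  b * H2 * (3 * c) + ((b + b * 1) * (c * H2) + b * c * H2) by ring.
rewrite (le_trans (normcD _ _))// lerD//.
  by rewrite normcM ler_pM ?normc_ge0 ?f2 ?g3.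
rewrite (le_trans (normcD _ _))// lerD//.
  rewrite normcM ler_pM ?normc_ge0 ?g2//.
  by rewrite (le_trans (normcD _ _))// lerD// normcM ler_pM ?normc_ge0.
by rewrite normcM normcX ler_wpM2r// normcM ler_pM ?normc_ge0.
Qed.

Lemma jetZ x f d b (k : R[i]) : jet x f d b ->
  jet x (fun y => k * f y) (k * d) (normc k * b).
Proof.
move=> [f0 f1 f2]; split; rewrite ?normcM ?ler_wpM2l ?normc_ge0//.
move=> h h1; have -> : k * f (x + h) - k * f x - k * d * h =
  k * (f (x + h) - f x - d * h) by ring.
by rewrite normcM -mulrA ler_wpM2l ?normc_ge0 ?f2.
Qed.

Lemma jet_id x : jet x id 1 (normc x + 1).
Proof.
split=> [||h _]; rewrite ?normc1 ?lerDl ?lerDr ?ler01 ?normc_ge0//.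
have -> : id (x + h) - id x - 1 * h = 0 by rewrite /=; ring.
by rewrite normc0 mulr_ge0 ?exprn_ge0 ?addr_ge0 ?normc_ge0.
Qed.

Lemma jet_cst x (k : R[i]) : jet x (fun=> k) 0 (normc k).
Proof.
split=> [||h _]; rewrite ?normc0 ?normc_ge0// subrr mul0r subr0 normc0.
by rewrite mulr_ge0 ?exprn_ge0 ?normc_ge0.
Qed.

End Jets.

(** * Euler's product and the entire function 1 / Gamma *)

Section ReciprocalGamma.
Context {R : realType}.
Implicit Types (x w z h : R[i]) (n : nat).

(** For a real sequence a, adding K / (n + 1) makes it nonincreasing and subtracting K / (n + 1)
    makes it nondecreasing. The first modification is bounded below by the start of the second, so
    it converges, and so does a. This is applied to real and imaginary parts. *)
Lemma cvg_of_harmonic_increments (u : nat -> R[i]) (K : R) :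
  (forall n, normc (u n.+1 - u n) <= K * (n.+1%:R^-1 - n.+2%:R^-1)) ->
  cvgn u.
Proof.
move=> H.
have real (a : nat -> R) :
    (forall n, `|a n.+1 - a n| <= K * (n.+1%:R^-1 - n.+2%:R^-1)) -> cvgn a.
  move=> Ha.
  pose b n := a n + K * n.+1%:R^-1; pose c n := a n - K * n.+1%:R^-1.
  have bdec : nonincreasing_seq b.
    apply/nonincreasing_seqP => n; rewrite /b.
    move: (le_trans (ler_norm _) (Ha n)).
    by move: (n.+1%:R^-1) (n.+2%:R^-1) => p q ?; lra.
  have cinc : nondecreasing_seq c.
    apply/nondecreasing_seqP => n; rewrite /c.
    have := Ha n; rewrite ler_norml.
    by move: (n.+1%:R^-1) (n.+2%:R^-1) => p q /andP[? _]; lra.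
  have K0 : 0 <= K.
    have := le_trans (normr_ge0 _) (Ha 0%N).
    by rewrite pmulr_lge0// subr_gt0 ltf_pV2 ?posrE ?ltr0n// ltr_nat.
  have blb : has_lbound (range b).
    exists (c 0%N) => _ [n _ <-]; apply: le_trans (cinc 0%N n (leq0n n)) _.
    by rewrite /b /c lerD2l -subr_ge0 opprK addr_ge0// mulr_ge0.
  have cb := nonincreasing_is_cvgn bdec blb.
  have -> : a = b \- (fun n => K * n.+1%:R^-1).
    by apply/funext => n; rewrite /b /= addrK.
  apply: is_cvgB => //; apply/cvg_ex; exists (K * 0).
  by apply: cvgMr; exact: cvg_harmonic.
have hR : cvgn (fun n => complex.Re (u n)).
  by apply: real => n; rewrite -ReN -ReD (le_trans (Re_le_normc _)).
have hI : cvgn (fun n => complex.Im (u n)).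
  by apply: real => n; rewrite -ImN -ImD (le_trans (Im_le_normc _)).
apply/cvg_ex; eexists; apply: cvg_complex; [exact: hR|exact: hI].
Qed.

(** The reciprocal of the n-th term of Euler's limit: a polynomial times an exponential, hence well
    behaved at the poles of Gamma. *)
Definition gamma_prod n w : R[i] :=
  \prod_(k < n.+1) (w + k%:R) / (n`!%:R * cexp (w * (ln n%:R)%:C)).

Definition rGamma w : R[i] := lim (gamma_prod n w @[n --> \oo]).

(** [ratio], built from [nu] and [lam], is the quotient of the products of indices n + 2 and n + 1;
    index 0, where ln 0 = 0 by convention, is left aside. The telescoping [tau] is the summable
    scale of the estimates. *)
Let nu n : R := n.+2%:R^-1.
Let lam n : R := ln n.+2%:R - ln n.+1%:R.
Let tau n : R := n.+1%:R^-1 - n.+2%:R^-1.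

Let tauE n : tau n = n.+1%:R^-1 * n.+2%:R^-1.
Proof.
rewrite /tau -[n.+2%:R]natr1.
have : 0 < n.+1%:R :> R by rewrite ltr0n.
by move: (n.+1%:R : R) => a a0; field; rewrite !lt0r_neq0// addr_gt0.
Qed.

Let tau_gt0 n : 0 < tau n.
Proof. by rewrite tauE mulr_gt0// invr_gt0 ltr0n. Qed.

Let lam_bounds n : nu n <= lam n <= n.+1%:R^-1.
Proof.
have a0 : 0 < n.+1%:R :> R by rewrite ltr0n.
have b0 : 0 < n.+2%:R :> R by rewrite ltr0n.
have ab : n.+2%:R = n.+1%:R + 1 :> R by rewrite natr1.
rewrite /nu /lam -ln_div ?posrE//; apply/andP; split; last first.
  have -> : n.+2%:R / n.+1%:R = 1 + n.+1%:R^-1 :> R.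
    by rewrite ab mulrDl mulfV ?lt0r_neq0// mul1r.
  by rewrite le_ln1Dx// (lt_trans (ltrN10 R))// invr_gt0.
rewrite -[leRHS]opprK -lnV ?posrE ?divr_gt0// invf_div lerNr.
have -> : n.+1%:R / n.+2%:R = 1 - n.+2%:R^-1 :> R.
  by rewrite -[n.+1%:R](addrK 1) -ab mulrBl mulfV ?lt0r_neq0// mul1r.
by rewrite le_ln1Dx// ltrN2 invf_lt1// ltr1n.
Qed.

Let ratio n w := (1 + w * (nu n)%:C) * cexp (- (w * (lam n)%:C)).

Lemma gamma_prodS n w :
  gamma_prod n.+2 w = gamma_prod n.+1 w * ratio n w.
Proof.
have N0 : n.+2%:R != 0 :> R[i] by rewrite pnatr_eq0.
rewrite /gamma_prod big_ord_recr /= factS natrM /ratio /nu /lam.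
rewrite fmorphV rmorph_nat -mulrN rmorphB opprB mulrBr cexpD cexpN.
rewrite !invfM -!mulrA; congr (_ * _).
have := cexp_neq0 (w * (ln n.+1%:R)%:C); have := cexp_neq0 (w * (ln n.+2%:R)%:C).
have : n.+1`!%:R != 0 :> R[i] by rewrite pnatr_eq0 -lt0n fact_gt0.
move: (cexp _) (cexp _) (n.+1`!%:R) (n.+2%:R) N0 => a b c N N0 c0 a0 b0.
by field; rewrite N0 a0 b0 c0.
Qed.

Let b n w := ratio n w - 1.

(** With e^{-lam y} = 1 - lam y + lam^2 D(y), one gets ratio - 1 = (nu - lam) y - nu lam y^2 + lam^2
    (1 + nu y) D(y). The linear terms nearly cancel: |nu - lam| <= tau, while nu lam <= tau and
    lam^2 <= 2 tau. This is what makes the product converge. *)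
Let jet_b x : exists K : R, 0 <= K /\ forall n, exists d, jet x (b n) d (K * tau n).
Proof.
pose M := normc x + 1; pose B := M ^+ 2 * expR M.
have M1 : 1 <= M by rewrite /M lerDr normc_ge0.
have M0 : 0 <= M by exact: le_trans M1.
have B0 : 0 <= B by rewrite mulr_ge0 ?exprn_ge0 ?expR_ge0.
exists (M + 6 * M * M + 12 * (1 + M) * B); split.
  by rewrite !(addr_ge0, mulr_ge0, exprn_ge0, ler0n, ler01, expR_ge0, normc_ge0).
move=> n; have /andP[l1 l2] := lam_bounds n; have t0 := tau_gt0 n.
have n1 : 0 < n.+1%:R^-1 :> R by rewrite invr_gt0.
have n2 : 0 < nu n by rewrite invr_gt0.
have n1le : n.+1%:R^-1 <= 1 :> R by rewrite invf_le1// ler1n.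
have l0 : 0 < lam n by exact: lt_le_trans l1.
have l01 : lam n <= 1 by exact: le_trans n1le.
have hnl : nu n * lam n <= tau n.
  by rewrite tauE mulrC; apply: ler_pM => //; exact: ltW.
have hnu : n.+1%:R^-1 <= 2 * nu n.
  rewrite /nu -[2]invrK -invfM lef_pV2 ?posrE ?mulr_gt0 ?invr_gt0//.
  rewrite mulrC ler_pdivrMr// -natrM ler_nat muln2 -addnn.
  by rewrite addSn addnS ltnS ltnS leq_addr.
have hll : lam n ^+ 2 <= 2 * tau n.
  have l0' := ltW l0; rewrite expr2 tauE; apply: (le_trans (ler_pM l0' l0' l2 l2)).
  by rewrite [leRHS]mulrCA; apply: ler_wpM2l hnu; exact: ltW.
have hln : `|nu n - lam n| <= tau n.
  rewrite distrC ger0_norm ?subr_ge0// /tau lerD2r//.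
pose l : R[i] := - (lam n)%:C.
have nl : normc l = lam n by rewrite normcN normc_real gtr0_norm.
have l_neq0 : l != 0 by rewrite -normc_gt0 nl.
pose D y := y ^+ 2 * exp_rem 2 (y * l).
have DE y : D y = (cexp (y * l) - 1 - y * l) / l ^+ 2.
  rewrite /D -(exp_rem0 (y * l)) (exp_rem_rec 0) (exp_rem_rec 1) !factS !fact0 !invr1.
  by field.
have jD : jet x D (x * exp_rem 1 (x * l)) B.
  have xM : normc x <= M by rewrite lerDl.
  have eM (k : nat) : normc (exp_rem k (x * l)) <= expR M.
    rewrite (le_trans (normc_exp_rem _ _))// ler_expR normcM nl.
    by rewrite (le_trans _ xM)// ler_piMr ?normc_ge0.
  split.
  - by rewrite /D normcM normcX ler_pM ?exprn_ge0 ?normc_ge0// lerXn2r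
      // nnegrE normc_ge0.
  - rewrite normcM ler_pM ?normc_ge0// (le_trans xM)// expr2 ler_peMr//.
  move=> h h1.
  have -> : D (x + h) - D x - x * exp_rem 1 (x * l) * h =
      h ^+ 2 * (cexp (x * l) * exp_rem 2 (h * l)).
    have -> : x * exp_rem 1 (x * l) = (cexp (x * l) - 1) / l.
      by rewrite -exp_rem1E; field.
    have -> : h ^+ 2 * (cexp (x * l) * exp_rem 2 (h * l)) =
      cexp (x * l) * D h by rewrite /D mulrCA.
    by rewrite !DE [(x + h) * l]mulrDl cexpD; field.
  rewrite normcM normcX mulrC ler_wpM2r ?exprn_ge0 ?normc_ge0// normcM.
  apply: (@le_trans _ _ (expR (normc x) * expR 1)).
    rewrite ler_pM ?normc_ge0//.
      rewrite -exp_rem0 (le_trans (normc_exp_rem _ _))// ler_expR normcM nl.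
      by rewrite ler_piMr ?normc_ge0.
    rewrite (le_trans (normc_exp_rem _ _))// ler_expR normcM nl.
    by apply: mulr_ile1 => //; [exact: normc_ge0|exact: ltW].
  by rewrite -expRD ler_peMl ?expR_ge0// exprn_ege1.
pose f y := ((nu n - lam n)%:C * y + - (nu n * lam n)%:C * (y * y)) +
  (lam n ^+ 2)%:C * ((1 + (nu n)%:C * y) * D y).
have -> : b n = f.
  apply/funext => y; rewrite /b /ratio /f DE.
  have -> : - (y * (lam n)%:C) = y * l by rewrite /l mulrN.
  have lE : (lam n)%:C = - l by rewrite /l opprK.
  rewrite rmorphB rmorphM rmorphXn /= lE; by field.
have ji := jet_id x; rewrite -/M in ji.
eexists; apply: jetW; last first.
  apply: jetD; first (apply: jetD; first exact: jetZ ji).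
    by apply: jetZ; exact: (jetM ji ji).
  by apply: jetZ; apply: jetM jD; apply: jetD; [exact: jet_cst|exact: (jetZ _ ji)].
rewrite normcN !normc_real normr1 -/M.
rewrite (ger0_norm (ltW (mulr_gt0 n2 l0))) (ger0_norm (ltW n2)).
rewrite (ger0_norm (sqr_ge0 _)).
have -> : (M + 6 * M * M + 12 * (1 + M) * B) * tau n =
  tau n * M + tau n * (6 * M * M) + 2 * tau n * (6 * (1 + M) * B) by ring.
have t0' := ltW t0; have n2' := ltW n2.
have M6 : 0 <= 6 * M * M by rewrite 2?mulr_ge0.
apply: lerD; first by apply: lerD; apply: ler_wpM2r.
have nM : nu n * M <= M.
  by rewrite ler_piMl// /nu invf_le1// ler1n.
apply: ler_pM => //; first exact: sqr_ge0.
  by rewrite !mulr_ge0// addr_ge0// mulr_ge0.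
by apply: ler_wpM2r => //; apply: ler_wpM2l => //; rewrite lerD2l.
Qed.

(** The expansions of all partial products share one constant, and both the values and the
    derivatives have increments of size [tau]; so they converge, and the quadratic error survives in
    the limit. *)
Lemma jet_gamma_prod x : exists (d : nat -> R[i]) (B : R),
  [/\ forall n, jet x (gamma_prod n.+1) (d n) B,
      forall n, normc (d n.+1 - d n) <= B * (n.+1%:R^-1 - n.+2%:R^-1) &
      forall n, normc (gamma_prod n.+2 x - gamma_prod n.+1 x) <=
        B * (n.+1%:R^-1 - n.+2%:R^-1)].
Proof.
have [K [K0 /choice[b1 Hb]]] := jet_b x.
have [d0 [B0 J0]] : exists d0 B0, jet x (gamma_prod 1) d0 B0.
  have -> : gamma_prod 1 = (fun y => y * (1 + y)).
    apply/funext => y; rewrite /gamma_prod !big_ord_recr big_ord0 /= ln1 mulr0.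
    by rewrite cexp0 mulr1 divr1 mul1r addr0 [y + 1]addrC.
  eexists; eexists; apply: jetM (jet_id x) _.
  by apply: jetD (jet_id x); exact: jet_cst.
pose d := fix d n := if n is m.+1 then
  d m + (d m * b m x + gamma_prod m.+1 x * b1 m) else d0.
(* A discrete Gronwall bound: each factor multiplies the constant by 1 + 6 K tau <= exp(6 K tau),
   and the [tau] telescope to 1 - 1 / (n + 1). *)
pose B n := B0 * expR (6 * K * (1 - n.+1%:R^-1)).
have B00 : 0 <= B0 := jet_ge0 J0.
have PS n : gamma_prod n.+2 =
    (fun y => gamma_prod n.+1 y + gamma_prod n.+1 y * b n y).
  by apply/funext => y; rewrite gamma_prodS /b mulrBr mulr1 addrC subrK.
have J n : jet x (gamma_prod n.+1) (d n) (B n).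
  elim: n => [|n IH]; first by rewrite /B invr1 subrr mulr0 expR0 mulr1.
  rewrite PS /=; apply: jetW (jetD IH (jetM IH (Hb n))).
  have -> : B n.+1 = B n * expR (6 * K * tau n).
    by rewrite /B -[RHS]mulrA -expRD -mulrDr /tau; congr (_ * expR (_ * _)); ring.
  have -> : B n + 6 * B n * (K * tau n) = B n * (1 + 6 * K * tau n) by ring.
  by rewrite ler_wpM2l ?expR_ge1Dx// mulr_ge0// expR_ge0.
pose C := B0 * expR (6 * K).
have BC n : B n <= C.
  apply: ler_wpM2l => //; rewrite ler_expR; apply: ler_piMr.
    by rewrite mulr_ge0.
  by rewrite gerBl invr_ge0.
have C0 : 0 <= C by rewrite mulr_ge0 ?expR_ge0.
have J' n : jet x (fun y => gamma_prod n.+1 y * b n y)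
    (d n * b n x + gamma_prod n.+1 x * b1 n) (6 * C * K * tau n).
  apply: jetW (jetM (J n) (Hb n)); rewrite -[leRHS]mulrA; apply: ler_wpM2r.
    by rewrite mulr_ge0// ltW.
  by apply: ler_wpM2l.
have CW : C <= C + 6 * C * K by rewrite lerDl !mulr_ge0.
exists d, (C + 6 * C * K); split=> n.
- by apply: jetW (J n); exact: le_trans CW.
- rewrite /= addrC addKr; case: (J' n) => _ h _; apply: (le_trans h).
  by apply: ler_wpM2r; [exact: ltW|rewrite lerDr].
- rewrite PS addrC addKr; case: (J' n) => h _ _; apply: (le_trans h).
  by apply: ler_wpM2r; [exact: ltW|rewrite lerDr].
Qed.

Lemma normc_lim_le (u : nat -> R[i]) (l : R[i]) (B : R) :
  u n @[n --> \oo] --> l -> (forall n, normc (u n) <= B) -> normc l <= B.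
Proof.
move=> /cvg_normcP ul uB; rewrite leNgt; apply/negP => Bl.
have [|n _ /(_ n (leqnn n))] := ul (normc l - B); first by rewrite subr_gt0.
apply/negP; rewrite -leNgt lerBlDr -{1}(subrK (u n) l).
by rewrite (le_trans (normcD _ _))// lerD2l.
Qed.

Lemma cvg_gamma_prod x : gamma_prod n x @[n --> \oo] --> rGamma x.
Proof.
have [d [B [_ _ H]]] := jet_gamma_prod x.
have /cvg_ex[l hl] := cvg_of_harmonic_increments H.
have hl' : gamma_prod n x @[n --> \oo] --> l by rewrite -cvg_shiftS.
by apply/cvg_ex; exists l.
Qed.

Lemma cvg_gamma_prodS x : gamma_prod n.+1 x @[n --> \oo] --> rGamma x.
Proof. by have := @cvg_gamma_prod x; rewrite -cvg_shiftS. Qed.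

Lemma derivable_rGamma x : derivable rGamma x 1.
Proof.
have [d [B [J H _]]] := jet_gamma_prod x.
have /cvg_ex[l hl] := cvg_of_harmonic_increments H.
suff h : is_derive x 1 rGamma l by exact: ex_derive.
apply: (@is_derive_quadratic _ _ _ _ B 1 ltr01) => h h1.
pose u n := gamma_prod n.+1 (x + h) - gamma_prod n.+1 x - d n * h.
apply: (@normc_lim_le u).
  apply: cvgB; last by apply: cvgM hl (cvg_cst h).
  by apply: cvgB; exact: cvg_gamma_prodS.
by move=> n; case: (J n) => _ _; apply; exact: ltW.
Qed.

(** The identity includes the poles of Gamma. If [rGamma x] is 0, Euler's sequence either diverges,
    and its [lim] is the default 0, or has a limit l; a nonzero l would force [rGamma x] to be l^-1.
    Both sides are then 0. *)
Lemma invr_cGamma x : (cGamma x)^-1 = rGamma x.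
Proof.
have E : (fun n => n`!%:R * cexp (x * (ln n%:R)%:C) / \prod_(k < n.+1) (x + k%:R))
    = (fun n => (gamma_prod n x)^-1).
  by apply/funext => n; rewrite /gamma_prod invf_div.
rewrite /cGamma E; have hG := @cvg_gamma_prod x.
have [G0|G0] := eqVneq (rGamma x) 0; last first.
  by rewrite (cvg_lim _ (cvgV G0 hG)) ?invrK//.
rewrite G0; apply/eqP; rewrite invr_eq0; apply/eqP.
have [/cvg_ex[l hl]|/dvgP//] :=
  pselect (cvg ((gamma_prod n x)^-1 @[n --> \oo])).
rewrite (cvg_lim _ hl)//; apply/eqP; apply: contraT => l0.
have hl' : gamma_prod n x @[n --> \oo] --> l^-1.
  have -> : gamma_prod^~ x = (fun n => ((gamma_prod n x)^-1)^-1).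
    by apply/funext => n; rewrite invrK.
  exact: cvgV.
have : rGamma x = l^-1 by exact: cvg_lim hl'.
by rewrite G0 => h; rewrite -(invr_eq0 l) -h eqxx in l0.
Qed.

(** On partial products the equation holds up to the factor 1 + (x + 1) / (n + 1), which tends to
    1. *)
Lemma rGamma_shift x : rGamma x = x * rGamma (x + 1).
Proof.
have H : x * gamma_prod n.+1 (x + 1) @[n --> \oo] --> rGamma x.
  have E n : x * gamma_prod n.+1 (x + 1) =
      gamma_prod n.+1 x * (1 + (x + 1) * (n.+1%:R^-1)%:C).
    rewrite /gamma_prod big_ord_recr [in RHS]big_ord_recl /= addr0.
    rewrite mulrDl mul1r cexpD cexp_real lnK ?posrE// rmorph_nat fmorphV rmorph_nat.
    have -> : \prod_(i < n.+1) (x + (bump 0 i)%:R) =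
      \prod_(i < n.+1) (x + 1 + i%:R).
      by apply: eq_bigr => i _; rewrite /bump /= natrD addrA.
    have : n.+1%:R != 0 :> R[i] by rewrite pnatr_eq0.
    have := cexp_neq0 (x * (ln n.+1%:R)%:C).
    have : n.+1`!%:R != 0 :> R[i] by rewrite pnatr_eq0 -lt0n fact_gt0.
    move: (\prod_(i < n.+1) (x + 1 + i%:R)) => P.
    move: (cexp (x * (ln n.+1%:R)%:C)) => a.
    move: ((n.+1)`!%:R : R[i]) (n.+1%:R : R[i]) => c N c0 a0 N0.
    by field; rewrite N0 a0 c0.
  under eq_fun do rewrite E.
  have h1 : 1 + (x + 1) * (n.+1%:R^-1)%:C @[n --> \oo] --> (1 + (x + 1) * 0%:C : R[i]).
    apply: cvgD; first exact: cvg_cst.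
    apply: cvgM; first exact: cvg_cst.
    apply: cvg_real_complex; exact: cvg_harmonic.
  rewrite mulr0 addr0 in h1; rewrite -[rGamma x]mulr1; apply: cvgM h1.
  exact: cvg_gamma_prodS.
have H' : x * gamma_prod n.+1 (x + 1) @[n --> \oo] --> x * rGamma (x + 1).
  apply: cvgM; first exact: cvg_cst.
  exact: cvg_gamma_prodS.
transitivity (lim (x * gamma_prod n.+1 (x + 1) @[n --> \oo])).
  by apply/esym; exact: cvg_lim H.
exact: cvg_lim H'.
Qed.

(** Iterating the functional equation isolates the zero of 1 / Gamma at -m, which is to cancel the
    zero of e^{2 pi i w} - 1 there. *)
Lemma rGamma_factor (m : nat) : exists g : R[i] -> R[i],
  (forall x, derivable g x 1) /\ (forall x, rGamma x = (x + m%:R) * g x).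
Proof.
have shift (g : R[i] -> R[i]) : (forall x, derivable g x 1) ->
    forall x, derivable (fun y : R[i] => g (y + 1)) x 1.
  move=> dg x; have /derivableP hg := dg (x + 1).
  have hs : is_derive x 1 (fun y : R[i] => y + 1) (1 + 0).
    by apply: is_deriveD; exact: is_derive_cst.
  by have [] := is_derive_comp_complex hs hg.
elim: m => [|m [g [dg hg]]].
  exists (fun y : R[i] => rGamma (y + 1)); split; first exact/shift/derivable_rGamma.
  by move=> x; rewrite addr0 -rGamma_shift.
exists (fun y : R[i] => y * g (y + 1)); split=> [x|x].
  by apply: derivableM; [exact: derivable_id|exact: shift].
by rewrite rGamma_shift hg mulrCA -addrA nat1r.
Qed.

End ReciprocalGamma.

(** * Regular points and poles of the factor in front of the integral *)

Section HankelFactor.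
Context {R : realType}.
Implicit Types (f g : R[i] -> R[i]) (x w s : R[i]).

(** [fill_removable] is a punctured limit at every point, not only at the singular one. At x itself
    a whole punctured disc is available; at w other than x the disc around w must be small enough to
    avoid x. *)
Lemma fill_removable_near f g x : (\forall w \near x, g v @[v --> w] --> g w) ->
  (\forall w \near x, w != x -> f w = g w) ->
  \forall w \near x, fill_removable f w = g w.
Proof.
move=> /near_normcP[e1 e10 h1] /near_normcP[e2 e20 h2].
apply/near_normcP; exists (Num.min e1 e2); first by rewrite lt_min e10.
move=> w; rewrite lt_min => /andP[w1 w2].
apply: cvg_lim => //.
have gw : g v @[v --> w^'] --> g w.
  by apply: cvg_within_filter; exact: h1.
apply: cvg_trans gw; apply: near_eq_cvg.
rewrite near_withinE; apply/near_normcP.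
have [->|wx] := eqVneq w x.
  exists e2 => // v vx v_neq; exact/esym/h2.
exists (Num.min (normc (w - x)) (e2 - normc (w - x))).
  by rewrite lt_min normc_gt0 subr_eq0 wx subr_gt0.
move=> v; rewrite lt_min => /andP[v1 v2] _; apply/esym/h2.
  have -> : v - x = (v - w) + (w - x) by ring.
  by rewrite (le_lt_trans (normcD _ _))// -ltrBrDr.
by apply: contraTneq v1 => ->; rewrite normc_distC ltxx.
Qed.

Lemma derivable_cvg f x : derivable f x 1 -> f w @[w --> x] --> f x.
Proof. by move=> /derivableP; exact: is_derive_cvg. Qed.

Lemma derivable_near_neq0 f x : derivable f x 1 -> f x != 0 ->
  \forall w \near x, f w != 0.
Proof.
move=> /derivable_cvg/cvg_normcP/(_ (normc (f x))); rewrite normc_gt0.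
move=> h fx; apply: filterS (h fx) => w.
by apply: contraTneq => ->; rewrite subr0 ltxx.
Qed.

Lemma cexp_2pi_int (k : int) : cexp ((2 * pi)%:C * 'i%C * k%:~R) = 1 :> R[i].
Proof.
case: k => k; first exact: cexp_2pi_nat.
by rewrite NegzE intrN mulrN cexpN -[_%:~R]/(k.+1%:R) cexp_2pi_nat invr1.
Qed.

Lemma cexp_eq1 (z : R[i]) : cexp z = 1 ->
  exists k : int, z = (2 * pi)%:C * 'i%C * k%:~R.
Proof.
move=> ez.
have Rez : complex.Re z = 0.
  have := normc_cexp z; rewrite ez normc1 => /esym/(congr1 (@ln R)).
  by rewrite expRK ln1.
have p2 : 0 < 2 * pi :> R by rewrite mulr_gt0// pi_gt0.
pose k := Num.floor (complex.Im z / (2 * pi)); exists k.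
pose t := complex.Im z - 2 * pi * k%:~R.
have /andP[k1 k2] := real_floor_itv (num_real (complex.Im z / (2 * pi))).
have t0 : 0 <= t by rewrite subr_ge0 mulrC -ler_pdivlMr.
have t1 : t < 2 * pi.
  rewrite ltrBlDr -[X in X + _]mulr1 -mulrDr mulrC -ltr_pdivrMr// addrC.
  by move: k2; rewrite intrD.
have zE : z = (2 * pi)%:C * 'i%C * k%:~R + 0 +i* t.
  have kE : (k%:~R : R[i]) = (k%:~R)%:C by rewrite rmorph_int.
  rewrite kE; apply: eq_ReIm.
    by rewrite Rez ReD !ReM !ImM /=; ring.
  by rewrite ImD !(ReM, ImM) /t /=; ring.
suff t_eq0 : t = 0 by rewrite [LHS]zE t_eq0 addr0.
have : cexp (0 +i* t) = 1 by rewrite -ez zE cexpD cexp_2pi_int mul1r.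
rewrite /cexp /= expR0 !mul1r => -[ct _].
(* The half angle lies in [0, pi[, where the sine vanishes only at 0; cos t = 1 forces sin (t / 2) =
   0 and so t = 0. *)
have : cos (t / 2 + t / 2) = 1 by rewrite -splitr.
rewrite cosD -!expr2 => h.
have := cos2Dsin2 (t / 2) => h'.
have st : sin (t / 2) ^+ 2 = 0 by lra.
apply/eqP; rewrite -[_ == 0]negbK; apply/negP => t_neq0.
have : 0 < sin (t / 2).
  apply: sin_gt0_pi; apply/andP; split.
    by rewrite divr_gt0// lt_def t_neq0.
  by rewrite ltr_pdivrMr// mulrC.
by move/eqP: st; rewrite sqrf_eq0 => /eqP ->; rewrite ltxx.
Qed.

Let tpi : R[i] := (2 * pi)%:C * 'i%C.

Let tpi_neq0 : tpi != 0.
Proof.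
rewrite -normc_gt0 normcM normc_i mulr1 normc_real normr_gt0.
by rewrite mulf_neq0// ?pnatr_eq0// gt_eqF// pi_gt0.
Qed.

Let hf w := ((cexp (tpi * w) - 1) * cGamma w)^-1.

Let hfE w : hf w = rGamma w / (cexp (tpi * w) - 1).
Proof. by rewrite /hf invfM invr_cGamma mulrC. Qed.

Let derivable_affine (f : R[i] -> R[i]) (a b x : R[i]) :
  (forall y, derivable f y 1) -> derivable (fun w => f (a * (w - b))) x 1.
Proof.
move=> /(_ (a * (x - b)))/derivableP df.
have ha : is_derive x 1 (fun w : R[i] => a * (w - b)) (a * (1 - 0)).
  have h1 : is_derive x 1 (fun w : R[i] => w - b) (1 - 0).
    by apply: is_deriveB; exact: is_derive_cst.
  have := is_deriveM_complex (is_derive_cst a x 1) h1.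
  by rewrite mul0r add0r.
by have [] := is_derive_comp_complex ha df.
Qed.

Let derivable_exp_rem k y : derivable (@exp_rem R k) y 1.
Proof. by have [] := is_derive_exp_rem k y. Qed.

(* (e^{2 pi i w} - 1) / (w - k), for an integer k. *)
Let e (k : int) w := tpi * exp_rem 1 (tpi * (w - k%:~R)).

Let eE k w : cexp (tpi * w) - 1 = (w - k%:~R) * e k w.
Proof.
rewrite /e mulrCA mulrA exp_rem1E mulrBr cexpD cexpN -/tpi.
by rewrite /tpi cexp_2pi_int invr1 mulr1.
Qed.

Let derivable_e k x : derivable (e k) x 1.
Proof.
apply: derivableM; first exact: derivable_cst.
by apply: derivable_affine => y; exact: derivable_exp_rem.
Qed.

Let e_near k : \forall w \near (k%:~R : R[i]), e k w != 0.
Proof.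
apply: (derivable_near_neq0 (@derivable_e k k%:~R)).
by rewrite /e subrr mulr0 exp_rem_at0 invr1 mulr1.
Qed.

Let derivable_div (f g : R[i] -> R[i]) x : derivable f x 1 -> derivable g x 1 ->
  g x != 0 -> derivable (fun w => f w / g w) x 1.
Proof.
move=> /derivableP df /derivableP dg gx.
by have [] := is_deriveM_complex df (is_deriveV_complex gx dg).
Qed.

Let near_derivable_div (f g : R[i] -> R[i]) x :
  (forall y, derivable f y 1) -> (forall y, derivable g y 1) ->
  (\forall w \near x, g w != 0) ->
  \forall w \near x, f v / g v @[v --> w] --> f w / g w.
Proof.
move=> df dg; apply: filterS => w gw.
by apply: (@derivable_cvg (fun v => f v / g v)); exact: derivable_div.
Qed.

Let derivable_cexpB1 x : derivable (fun w => cexp (tpi * w) - 1) x 1.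
Proof.
have h1 : is_derive x 1 (fun w => tpi * w) (0 * x + tpi * 1).
  exact: is_deriveM_complex.
have h2 := is_derive_comp_complex h1 (is_derive_cexp (tpi * x)).
by have [] := is_deriveB h2 (is_derive_cst (1 : R[i]) x 1).
Qed.

(** The factor is 1 / Gamma divided by e^{2 pi i w} - 1, whose zeros are the integers. At -m,
    numerator and denominator both carry a factor w + m, which is removed from each before
    differentiating the quotient. *)
Lemma derivable_hankel_factor x : (forall n, x <> n.+1%:R) ->
  derivable hankel_factor x 1.
Proof.
move=> xn.
suff [f [g [df dg gx hfg]]] : exists f g : R[i] -> R[i],
    [/\ forall y, derivable f y 1, forall y, derivable g y 1,
     \forall w \near x, g w != 0 &
     \forall w \near x, w != x -> hf w = f w / g w].
  have := fill_removable_near (near_derivable_div df dg gx) hfg => h.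
  apply: near_eq_derivable (derivable_div (df x) (dg x) (nbhs_singleton gx)).
  by apply: filterS h => w hw; exact: esym hw.
have [xi|xi] := eqVneq (cexp (tpi * x)) 1.
  have [k] := cexp_eq1 xi; rewrite -/tpi => /(mulfI tpi_neq0) xk.
  have [m km] : exists m : nat, k = - m%:Z.
    case: k xk => [[|n]|n] xk; first by exists 0%N.
      by exfalso; apply: (xn n).
    by exists n.+1; rewrite NegzE.
  have [g [dg hg]] := @rGamma_factor R m.
  exists g, (e k); split.
  - exact: dg.
  - exact: derivable_e.
  - by rewrite xk; exact: e_near.
  near=> w => wx; rewrite hfE (eE k) hg km intrN opprK -pmulrn.
  have w0 : w + m%:R != 0 by move: wx; rewrite xk km intrN -pmulrn -subr_eq0 opprK.
  by rewrite -mulf_div mulfV// mul1r.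
exists (@rGamma R), (fun w => cexp (tpi * w) - 1); split.
- exact: derivable_rGamma.
- exact: derivable_cexpB1.
- by apply: (derivable_near_neq0 (@derivable_cexpB1 x)); rewrite subr_eq0.
- by near=> w => _; rewrite hfE.
Unshelve. all: by end_near. Qed.

(** At a positive integer the simple zero of e^{2 pi i w} - 1 gives at most a simple pole; [e k] is
    the nonvanishing cofactor of that zero. *)
Lemma hankel_factor_pole n : exists A : R[i] -> R[i],
  derivable A n.+1%:R 1 /\
  \forall s \near (n.+1%:R : R[i]), s != n.+1%:R ->
    (s - n.+1%:R) * hankel_factor s = A s.
Proof.
pose k : int := n.+1; have kE : k%:~R = n.+1%:R :> R[i] by [].
exists (fun w => rGamma w / e k w); split.
  apply: derivable_div; [exact: derivable_rGamma|exact: derivable_e|].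
  exact: (nbhs_singleton (e_near k)).
have := e_near k; rewrite kE => /near_normcP[r r0 hr].
apply/near_normcP; exists r => // s sr sn.
have sk : s - k%:~R != 0 by rewrite subr_eq0.
suff -> : hankel_factor s = rGamma s / (cexp (tpi * s) - 1).
  by rewrite (eE k) -kE invfM mulrCA; congr (_ * _); rewrite mulrA mulfV// mul1r.
have dg := derivable_cexpB1.
have gs : cexp (tpi * s) - 1 != 0 by rewrite (eE k) mulf_neq0// hr.
have gs' := derivable_near_neq0 (@derivable_cexpB1 s) gs.
have := fill_removable_near (near_derivable_div (@derivable_rGamma R) dg gs').
move=> /(_ hf) h; apply: (nbhs_singleton (h _)).
by near=> w => _; rewrite hfE.
Unshelve. all: by end_near. Qed.

End HankelFactor.

(** * Dominated integrals on tuples *)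

Section ComplexMeasurability.
Context {R : realType} d (T : measurableType d).
Implicit Types f g : T -> R[i].

Definition Cmeasurable f :=
  measurable_fun setT (fun x => complex.Re (f x)) /\
  measurable_fun setT (fun x => complex.Im (f x)).

Lemma Cmeasurable_cst (c : R[i]) : Cmeasurable (fun=> c).
Proof. by split; exact: measurable_cst. Qed.

Lemma CmeasurableD f g : Cmeasurable f -> Cmeasurable g ->
  Cmeasurable (fun x => f x + g x).
Proof.
move=> [f1 f2] [g1 g2]; split.
- by under eq_fun do rewrite ReD; exact: measurable_funD.
- by under eq_fun do rewrite ImD; exact: measurable_funD.
Qed.

Lemma CmeasurableM f g : Cmeasurable f -> Cmeasurable g ->
  Cmeasurable (fun x => f x * g x).
Proof.
move=> [f1 f2] [g1 g2]; split.
- under eq_fun do rewrite ReM.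
  by apply: measurable_funB; exact: measurable_funM.
- under eq_fun do rewrite ImM.
  by apply: measurable_funD; exact: measurable_funM.
Qed.

Lemma CmeasurableN f : Cmeasurable f -> Cmeasurable (fun x => - f x).
Proof.
move=> mf; under eq_fun do rewrite -mulN1r.
by apply: CmeasurableM => //; exact: Cmeasurable_cst.
Qed.

Lemma measurable_invr : measurable_fun setT (fun x : R => x^-1).
Proof.
have -> : (fun x : R => x^-1) = (fun x => if x == 0 then 0 else x^-1).
  by apply/funext => x; case: eqP => // ->; rewrite invr0.
apply: measurable_fun_if => //.
- apply: (@measurable_fun_bool _ _ _ _ true).
  rewrite setTI (_ : _ @^-1` _ = [set 0]); first exact: measurable_set1.
  by apply/seteqP; split=> x /= /eqP.
rewrite setTI; apply: open_continuous_measurable_fun.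
  rewrite (_ : _ @^-1` _ = [set x | x != 0]); first exact: open_neq.
  by apply/seteqP; split=> x /= => [->|/negbTE].
by move=> x; rewrite inE /= => x0; apply: inv_continuous; rewrite x0.
Qed.

Lemma CmeasurableV f : Cmeasurable f -> Cmeasurable (fun x => (f x)^-1).
Proof.
move=> [f1 f2].
pose n2 x := (complex.Re (f x) ^+ 2 + complex.Im (f x) ^+ 2)^-1.
have mn2 : measurable_fun setT n2.
  apply: (measurableT_comp measurable_invr).
  by apply: measurable_funD; exact: measurable_funX.
split.
- rewrite (_ : (fun _ => _) = (fun x => complex.Re (f x) * n2 x)).
    exact: measurable_funM.
  by apply/funext => x; rewrite /n2; case: (f x).
- rewrite (_ : (fun _ => _) = (fun x => - complex.Im (f x) * n2 x)).
    by apply: measurable_funM => //; exact: measurableT_comp.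
  by apply/funext => x; rewrite /n2; case: (f x) => a b /=; rewrite mulNr.
Qed.

Lemma Cmeasurable_cexp f : Cmeasurable f -> Cmeasurable (fun x => cexp (f x)).
Proof.
move=> [f1 f2]; have me := measurableT_comp (@measurable_expR R) f1.
split; rewrite /cexp /=; apply: measurable_funM => //.
- apply: measurableT_comp f2; apply: continuous_measurable_fun.
  exact: continuous_cos.
- apply: measurableT_comp f2; apply: continuous_measurable_fun.
  exact: continuous_sin.
Qed.

Lemma CmeasurableX f n : Cmeasurable f -> Cmeasurable (fun x => f x ^+ n).
Proof.
move=> mf; elim: n => [|n IH]; first exact: Cmeasurable_cst.
by under eq_fun do rewrite exprS; exact: CmeasurableM.
Qed.

Lemma Cmeasurable_prod (J : Type) (s : seq J) (P : pred J) (F : J -> T -> R[i]) :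
  (forall j, P j -> Cmeasurable (F j)) ->
  Cmeasurable (fun x => \prod_(j <- s | P j) F j x).
Proof.
move=> mF; elim: s => [|j s IH].
  by under eq_fun do rewrite big_nil; exact: Cmeasurable_cst.
have [Pj|/negbTE Pj] := boolP (P j); under eq_fun do rewrite big_cons Pj; last by [].
by apply: CmeasurableM => //; exact: mF.
Qed.

Lemma Cmeasurable_sum (J : Type) (s : seq J) (P : pred J) (F : J -> T -> R[i]) :
  (forall j, P j -> Cmeasurable (F j)) ->
  Cmeasurable (fun x => \sum_(j <- s | P j) F j x).
Proof.
move=> mF; elim: s => [|j s IH].
  by under eq_fun do rewrite big_nil; exact: Cmeasurable_cst.
have [Pj|/negbTE Pj] := boolP (P j); under eq_fun do rewrite big_cons Pj; last by [].
by apply: CmeasurableD => //; exact: mF.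
Qed.

Lemma Cmeasurable_if (p : T -> bool) f g : measurable_fun setT p ->
  Cmeasurable f -> Cmeasurable g ->
  Cmeasurable (fun x => if p x then f x else g x).
Proof.
move=> mp [f1 f2] [g1 g2]; split.
- rewrite (_ : (fun _ => _) = (fun x => if p x then complex.Re (f x)
    else complex.Re (g x))); first exact: measurable_fun_ifT.
  by apply/funext => x; case: ifP.
- rewrite (_ : (fun _ => _) = (fun x => if p x then complex.Im (f x)
    else complex.Im (g x))); first exact: measurable_fun_ifT.
  by apply/funext => x; case: ifP.
Qed.

Lemma Cmeasurable_eq0 f : Cmeasurable f -> measurable_fun setT (fun x => f x == 0).
Proof.
move=> [f1 f2].
rewrite (_ : (fun _ => _) = (fun x => (complex.Re (f x) == 0) &&
    (complex.Im (f x) == 0))); last first.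
  by apply/funext => x; rewrite eq_complex.
by apply: measurable_and; exact: measurable_fun_eqr.
Qed.

Lemma Cmeasurable_exp_rem k f : Cmeasurable f ->
  Cmeasurable (fun x => exp_rem k (f x)).
Proof.
move=> mf; rewrite /exp_rem; apply: Cmeasurable_if.
- exact: Cmeasurable_eq0.
- exact: Cmeasurable_cst.
apply: CmeasurableM; last by apply: CmeasurableV; exact: CmeasurableX.
apply: CmeasurableD; first exact: Cmeasurable_cexp.
apply: CmeasurableN; apply: Cmeasurable_sum => i _.
by apply: CmeasurableM; [exact: CmeasurableX|exact: Cmeasurable_cst].
Qed.

End ComplexMeasurability.

Lemma Cmeasurable_comp (R : realType) d1 d2 (T1 : measurableType d1)
    (T2 : measurableType d2) (h : T1 -> T2) (f : T2 -> R[i]) :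
  measurable_fun setT h -> Cmeasurable f -> Cmeasurable (fun x => f (h x)).
Proof.
move=> mh [f1 f2]; split.
- exact: (measurableT_comp f1 mh).
- exact: (measurableT_comp f2 mh).
Qed.

(** A real integral is [fine] of the difference of the integrals of the positive and negative parts,
    and each of these depends measurably on the parameter by Tonelli. *)
Lemma Cmeasurable_Cintegral (R : realType) d (T : measurableType d)
    (f : T * measurableTypeR R -> R[i]) : Cmeasurable f ->
  Cmeasurable (fun x => Cintegral (fun u => f (x, u))).
Proof.
have real (g : T * measurableTypeR R -> R) : measurable_fun setT g ->
    measurable_fun setT (fun x => (\int[mu]_u g (x, u))%R).
  move=> mg; rewrite /Rintegral; apply: (measurableT_comp (@fine_measurable R setT measurableT)).
  have mg' : measurable_fun setT (EFin \o g) by exact: measurableT_comp.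
  under eq_fun do rewrite integralE.
  apply: emeasurable_funB.
  - rewrite (_ : (fun _ => _) = fubini_F (@lebesgue_measure R) (EFin \o g)^\+%E).
      apply: measurable_fun_fubini_tonelli_F; last exact: funepos_ge0.
      exact: measurable_funepos.
    apply/funext => x; rewrite /fubini_F; apply: eq_integral => u _.
    exact: (congr1 (@^~ u) (funepos_comp (EFin \o g) (pair x))).
  - rewrite (_ : (fun _ => _) = fubini_F (@lebesgue_measure R) (EFin \o g)^\-%E).
      apply: measurable_fun_fubini_tonelli_F; last exact: funeneg_ge0.
      exact: measurable_funeneg.
    apply/funext => x; rewrite /fubini_F; apply: eq_integral => u _.
    exact: (congr1 (@^~ u) (funeneg_comp (EFin \o g) (pair x))).
move=> [f1 f2]; split; first exact: (real (fun z => complex.Re (f z))).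
exact: (real (fun z => complex.Im (f z))).
Qed.

(** The parameter space is arbitrary so that, in the induction, the first coordinate of the tuple
    can join the parameters while the others are integrated. *)
Lemma Cmeasurable_Cintegral_tuple (R : realType) r d (T : measurableType d)
    (f : T -> r.-tuple (measurableTypeR R) -> R[i]) :
  Cmeasurable (fun z : T * r.-tuple (measurableTypeR R) => f z.1 z.2) ->
  Cmeasurable (fun x => Cintegral_tuple (f x)).
Proof.
elim: r d T f => [|r IH] d T f mf /=.
  apply: (@Cmeasurable_comp _ _ _ _ _ (fun x : T => (x, [tuple]))) mf.
  by apply: measurable_fun_pair; [exact: measurable_id|exact: measurable_cst].
apply: (@Cmeasurable_Cintegral _ _ _
  (fun z => Cintegral_tuple (fun v => f z.1 [tuple of z.2 :: v]))).
apply: (IH _ _ (fun z v => f z.1 [tuple of z.2 :: v])).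
apply: (@Cmeasurable_comp _ _ _ _ _
  (fun z : T * measurableTypeR R * r.-tuple (measurableTypeR R) =>
     (z.1.1, [tuple of z.1.2 :: z.2]))) mf.
apply: measurable_fun_pair; first exact: measurableT_comp.
by apply: measurable_cons => //; exact: measurableT_comp.
Qed.

(** * Linearity, domination and Fubini for complex integrals *)

Section ComplexIntegral.
Context {R : realType}.
Implicit Types f g : R -> R[i].
Local Notation TR := (measurableTypeR R).

Definition Cintegrable f :=
  (@lebesgue_measure R).-integrable setT (fun u => (complex.Re (f u))%:E) /\
  (@lebesgue_measure R).-integrable setT (fun u => (complex.Im (f u))%:E).

Lemma CintegralD f g : Cintegrable f -> Cintegrable g ->
  Cintegral (fun u => f u + g u) = Cintegral f + Cintegral g.
Proof.
move=> [f1 f2] [g1 g2]; rewrite /Cintegral; apply: eq_ReIm; rewrite ?ReD ?ImD /=.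
- by rewrite -RintegralD//; apply: eq_Rintegral => u _; rewrite ReD.
- by rewrite -RintegralD//; apply: eq_Rintegral => u _; rewrite ImD.
Qed.

Lemma CintegrableD f g : Cintegrable f -> Cintegrable g ->
  Cintegrable (fun u => f u + g u).
Proof.
move=> [f1 f2] [g1 g2]; split.
- by under eq_fun do rewrite ReD EFinD; exact: integrableD.
- by under eq_fun do rewrite ImD EFinD; exact: integrableD.
Qed.

Lemma CintegrableZ f (c : R[i]) : Cintegrable f -> Cintegrable (fun u => c * f u).
Proof.
move=> [f1 f2]; split.
- under eq_fun do rewrite ReM EFinB !EFinM.
  by apply: integrableB => //; exact: integrableZl.
- under eq_fun do rewrite ImM EFinD !EFinM.
  by apply: integrableD => //; exact: integrableZl.
Qed.

Lemma CintegralZ f (c : R[i]) : Cintegrable f ->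
  Cintegral (fun u => c * f u) = c * Cintegral f.
Proof.
move=> [f1 f2]; have Z (a : R) (h : R -> R) :
    (@lebesgue_measure R).-integrable setT (fun u => (h u)%:E) ->
    (@lebesgue_measure R).-integrable setT (fun u => (a * h u)%:E).
  by move=> hi; under eq_fun do rewrite EFinM; exact: integrableZl.
rewrite /Cintegral; apply: eq_ReIm; rewrite ?ReM ?ImM /=.
- rewrite -!RintegralZl// -RintegralB//; try exact: Z.
  by apply: eq_Rintegral => u _; rewrite ReM.
- rewrite -!RintegralZl// -RintegralD//; try exact: Z.
  by apply: eq_Rintegral => u _; rewrite ImM.
Qed.

End ComplexIntegral.

(** The integral of a nonnegative function is a supremum over the simple functions below it, hence
    monotone for arbitrary functions. This suits the inner stages of an iterated integral, of which
    only bounds are at hand. *)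
Lemma le_integral_nonneg (R : realType) (f g : R -> \bar R) : (forall u, 0 <= f u)%E ->
  (forall u, f u <= g u)%E -> (\int[mu]_u f u <= \int[mu]_u g u)%E.
Proof.
move=> f0 fg; rewrite !ge0_integralTE//; last by move=> u; apply: le_trans (fg u).
apply: le_ereal_sup => _ [h hf <-]; exists h => // u; exact: le_trans (fg u).
Qed.

Section DominatedIntegrals.
Context {R : realType}.
Local Notation TR := (measurableTypeR R).
Variable B : R -> R.
Hypothesis B_ge0 : forall u, 0 <= B u.
Hypothesis iB : (@lebesgue_measure R).-integrable setT (fun u => (B u)%:E).
Implicit Types f g : R -> R[i].

Definition dom_integral : R := (\int[mu]_u B u)%R.

Lemma integral_dom : (\int[mu]_u (B u)%:E = dom_integral%:E)%E.
Proof.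
rewrite /dom_integral /Rintegral fineK//.
exact: (integrable_fin_num measurableT iB).
Qed.

Let real_dom (h : R -> R) (M : R) : measurable_fun (setT : set TR) h ->
  (forall u, `|h u| <= M * B u) ->
  (@lebesgue_measure R).-integrable setT (fun u => (h u)%:E) /\
  `|(\int[mu]_u h u)%R| <= M * dom_integral.
Proof.
move=> mh hB.
have iMB : (@lebesgue_measure R).-integrable setT (fun u => (M * B u)%:E).
  by under eq_fun do rewrite EFinM; exact: integrableZl.
have ih : (@lebesgue_measure R).-integrable setT (fun u => (h u)%:E).
  apply: le_integrable iMB => //; first exact: measurableT_comp.
  move=> u _; rewrite !abse_EFin lee_fin (le_trans (hB u))//.
  exact: ler_norm.
split=> //; apply: (le_trans (le_normr_Rintegral measurableT ih)).
rewrite -(RintegralZl _ measurableT iB)//; apply: le_Rintegral => //.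
by have := integrable_abse ih.
Qed.

(** The 2 comes from bounding the integrals of the real and imaginary parts separately. *)
Lemma dom_Cintegrable f (M : R) : @Cmeasurable R _ TR f ->
  (forall u, normc (f u) <= M * B u) ->
  Cintegrable f /\ normc (Cintegral f) <= M * (2 * dom_integral).
Proof.
move=> [f1 f2] fB.
have [i1 b1] := real_dom f1 (fun u => le_trans (Re_le_normc _) (fB u)).
have [i2 b2] := real_dom f2 (fun u => le_trans (Im_le_normc _) (fB u)).
split=> //; apply: (le_trans (normc_le_ReIm _)).
rewrite /Cintegral /= mulrCA mulr_natl mulr2n; exact: lerD.
Qed.

Lemma Cintegral_Fubini (f : TR * TR -> R[i]) (M : R) : Cmeasurable f ->
  (forall u v, normc (f (u, v)) <= M * B u * B v) ->
  Cintegral (fun u => Cintegral (fun v => f (u, v))) =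
  Cintegral (fun v => Cintegral (fun u => f (u, v))).
Proof.
move=> [f1 f2] fB.
have M0 u v : 0 <= M * B u * B v := le_trans (normc_ge0 _) (fB u v).
have real (h : TR * TR -> R) : measurable_fun setT h ->
    (forall u v, `|h (u, v)| <= M * B u * B v) ->
    (\int[mu]_u (\int[mu]_v h (u, v)))%R = (\int[mu]_v (\int[mu]_u h (u, v)))%R.
  move=> mh hB.
  have mh' : measurable_fun setT (EFin \o h) by exact: measurableT_comp.
  have ih : ((@lebesgue_measure R) \x (@lebesgue_measure R))%E.-integrable setT
      (EFin \o h).
    apply/(integrable12ltyP (@lebesgue_measure R) (@lebesgue_measure R) mh').
    apply: (@le_lt_trans _ _ (\int[mu]_u \int[mu]_v (M * B u * B v)%:E)%E).
      apply: le_integral_nonneg => u; first by apply: integral_ge0.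
      by apply: le_integral_nonneg => v //; rewrite lee_fin.
    under eq_integral do under eq_integral do rewrite EFinM.
    under eq_integral do rewrite (integralZl measurableT iB) integral_dom.
    under eq_integral do rewrite -EFinM mulrAC EFinM.
    by rewrite (integralZl measurableT iB) integral_dom -EFinM ltry.
  have E1 : forall u, (\int[mu]_v (h (u, v))%:E)%E \is a fin_num.
    move=> u; have [i _] := @real_dom (fun v => h (u, v)) (M * B u)
      (measurableT_comp mh (@measurable_pair1 _ _ TR TR u)) (hB u).
    exact: (integrable_fin_num measurableT i).
  have E2 : forall v, (\int[mu]_u (h (u, v))%:E)%E \is a fin_num.
    move=> v; have [|i _] := @real_dom (fun u => h (u, v)) (M * B v)
      (measurableT_comp mh (@measurable_pair2 _ _ TR TR v)).
      by move=> u; rewrite mulrAC.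
    exact: (integrable_fin_num measurableT i).
  rewrite /Rintegral; congr fine.
  under eq_integral do rewrite fineK//.
  under [RHS]eq_integral do rewrite fineK//.
  exact: (Fubini ih).
apply: (f_equal2 (@Complex R)).
- apply: (real (fun z => complex.Re (f z)) f1) => u v.
  exact: le_trans (Re_le_normc _) (fB u v).
- apply: (real (fun z => complex.Im (f z)) f2) => u v.
  exact: le_trans (Im_le_normc _) (fB u v).
Qed.

Definition tuple_dom r (v : r.-tuple R) : R := \prod_(k < r) B (tnth v k).

Lemma tuple_dom_cons r u (v : r.-tuple R) :
  tuple_dom [tuple of u :: v] = B u * tuple_dom v.
Proof.
rewrite /tuple_dom big_ord_recl (tnth_nth 0)/=; congr (_ * _).
by apply: eq_bigr => i _; rewrite !(tnth_nth 0).
Qed.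

Definition dominated r (f : r.-tuple R -> R[i]) (M : R) :=
  @Cmeasurable R _ (r.-tuple TR) f /\
  forall v, normc (f v) <= M * tuple_dom v.

Lemma dominated_section r (f : r.+1.-tuple R -> R[i]) M : dominated f M ->
  forall u, dominated (fun v => f [tuple of u :: v]) (M * B u).
Proof.
move=> [mf fM] u; split; last by move=> v; rewrite -mulrA -tuple_dom_cons.
apply: (@Cmeasurable_comp R _ _ (r.-tuple TR) (r.+1.-tuple TR)
  (fun v => [tuple of u :: v])) mf.
by apply: measurable_cons => //; exact: measurable_id.
Qed.

Lemma Cmeasurable_tuple_section r (f : r.+1.-tuple R -> R[i]) :
  @Cmeasurable R _ (r.+1.-tuple TR) f ->
  @Cmeasurable R _ TR (fun u => Cintegral_tuple (fun v => f [tuple of u :: v])).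
Proof.
move=> mf.
apply: (@Cmeasurable_Cintegral_tuple R r _ TR (fun u v => f [tuple of u :: v])).
apply: (@Cmeasurable_comp R _ _ (TR * r.-tuple TR)%type (r.+1.-tuple TR)
  (fun z => [tuple of z.1 :: z.2])) mf.
exact: measurable_cons.
Qed.

Lemma normc_Cintegral_tuple r (f : r.-tuple R -> R[i]) M : dominated f M ->
  normc (Cintegral_tuple f) <= M * (2 * dom_integral) ^+ r.
Proof.
elim: r f M => [|r IH] f M fM /=.
  case: fM => _ /(_ [tuple]); rewrite /tuple_dom big_ord0 expr0 //.
have h u : normc (Cintegral_tuple (fun v => f [tuple of u :: v])) <=
    M * (2 * dom_integral) ^+ r * B u.
  by rewrite mulrAC; apply: IH; exact: dominated_section.
have [_] := dom_Cintegrable (Cmeasurable_tuple_section fM.1) h.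
by move=> /le_trans; apply; rewrite exprSr [leRHS]mulrA.
Qed.

Lemma Cintegrable_tuple_section r (f : r.+1.-tuple R -> R[i]) M : dominated f M ->
  Cintegrable (fun u => Cintegral_tuple (fun v => f [tuple of u :: v])).
Proof.
move=> fM; have h u : normc (Cintegral_tuple (fun v => f [tuple of u :: v])) <=
    M * (2 * dom_integral) ^+ r * B u.
  by rewrite mulrAC; apply: normc_Cintegral_tuple; exact: dominated_section.
by have [] := dom_Cintegrable (Cmeasurable_tuple_section fM.1) h.
Qed.

Lemma Cintegral_tupleD r (f g : r.-tuple R -> R[i]) M N :
  dominated f M -> dominated g N ->
  Cintegral_tuple (fun v => f v + g v) = Cintegral_tuple f + Cintegral_tuple g.
Proof.
elim: r f g M N => [//|r IH] f g M N fM gN /=.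
rewrite -(CintegralD (Cintegrable_tuple_section fM) (Cintegrable_tuple_section gN)).
congr Cintegral; apply/funext => u.
exact: IH (dominated_section fM u) (dominated_section gN u).
Qed.

Lemma Cintegral_tupleZ r (f : r.-tuple R -> R[i]) M c : dominated f M ->
  Cintegral_tuple (fun v => c * f v) = c * Cintegral_tuple f.
Proof.
elim: r f M => [//|r IH] f M fM /=.
rewrite -(CintegralZ _ (Cintegrable_tuple_section fM)).
congr Cintegral; apply/funext => u; exact: IH (dominated_section fM u).
Qed.

Lemma dominatedZ r (f : r.-tuple R -> R[i]) M c : dominated f M ->
  dominated (fun v => c * f v) (normc c * M).
Proof.
move=> [mf fM]; split; first by apply: CmeasurableM => //; exact: Cmeasurable_cst.
by move=> v; rewrite normcM -mulrA ler_wpM2l ?normc_ge0.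
Qed.

Lemma Cintegral_tupleB r (f g : r.-tuple R -> R[i]) M N :
  dominated f M -> dominated g N ->
  Cintegral_tuple (fun v => f v - g v) = Cintegral_tuple f - Cintegral_tuple g.
Proof.
move=> fM gN; rewrite -mulN1r -(Cintegral_tupleZ (-1) gN).
rewrite -(Cintegral_tupleD fM (dominatedZ (-1) gN)).
by congr Cintegral_tuple; apply/funext => v; rewrite mulN1r.
Qed.

(** This makes the head variable the innermost one, so that a one-variable identity can be applied
    to it. In the induction, Fubini exchanges the first two variables; the induction hypothesis is
    then used on [fw], where the second variable is frozen. *)
Lemma Cintegral_tuple_swap r (f : r.+1.-tuple R -> R[i]) M : dominated f M ->
  Cintegral (fun u => Cintegral_tuple (fun v => f [tuple of u :: v])) =
  Cintegral_tuple (fun v => Cintegral (fun u => f [tuple of u :: v])).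
Proof.
elim: r f M => [//|r IH] f M fM /=.
pose g (z : TR * TR) :=
  Cintegral_tuple (fun v => f [tuple of z.1 :: [tuple of z.2 :: v]]).
transitivity (Cintegral (fun w => Cintegral (fun u => g (u, w)))).
  apply: (@Cintegral_Fubini g (M * (2 * dom_integral) ^+ r)).
    apply: (@Cmeasurable_Cintegral_tuple R r _ (TR * TR)%type
      (fun z v => f [tuple of z.1 :: [tuple of z.2 :: v]])).
    apply: (@Cmeasurable_comp R _ _ (TR * TR * r.-tuple TR)%type (r.+2.-tuple TR)
      (fun z => [tuple of z.1.1 :: [tuple of z.1.2 :: z.2]])) fM.1.
    apply: measurable_cons; first exact: measurableT_comp.
    by apply: measurable_cons => //; exact: measurableT_comp.
  move=> u w; rewrite /g /=.
  have := normc_Cintegral_tuple (dominated_section (dominated_section fM u) w).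
  by rewrite mulrAC (mulrAC _ _ (B u)) mulrAC.
congr Cintegral; apply/funext => w.
pose fw (v : r.+1.-tuple R) := f [tuple of thead v :: [tuple of w :: [tuple of behead v]]].
have dfw : dominated fw (M * B w).
  split.
    apply: (@Cmeasurable_comp R _ _ (r.+1.-tuple TR) (r.+2.-tuple TR)
      (fun v => [tuple of thead v :: [tuple of w :: [tuple of behead v]]])) fM.1.
    apply: measurable_cons; first exact: (@measurable_tnth _ TR _ ord0).
    by apply: measurable_cons => //; exact: measurable_behead.
  move=> v; rewrite /fw; apply: (le_trans (fM.2 _)); rewrite !tuple_dom_cons.
  rewrite [v in leRHS](tuple_eta v) tuple_dom_cons.
  by rewrite -mulrA (mulrCA (B w)).
have E (u : R) (v : r.-tuple R) : f [tuple of u :: [tuple of w :: v]] = fw [tuple of u :: v].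
  by rewrite /fw; congr f; apply: val_inj.
transitivity (Cintegral (fun u : R =>
    Cintegral_tuple (fun v : r.-tuple R => fw [tuple of u :: v]))).
  congr Cintegral; apply/funext => u; congr Cintegral_tuple.
  by apply/funext => v; rewrite -E.
rewrite (IH _ _ dfw); congr Cintegral_tuple; apply/funext => v.
by congr Cintegral; apply/funext => u.
Qed.

Lemma dominated_integrable r (f : r.-tuple R -> R[i]) M : dominated f M ->
  Cintegrable_tuple f.
Proof.
move=> fM; case: (fM) => -[f1 f2] fM2; split=> //.
have h : (0 <= eintegral_tuple (fun v => (normc (f v))%:E) <=
    (M * dom_integral ^+ r)%:E)%E.
  move: fM2 => {f1 f2 fM}.
  elim: r f M => [|r IH] f M fM /=.
    rewrite !lee_fin normc_ge0 expr0.
    by have := fM [tuple]; rewrite /tuple_dom big_ord0.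
  have h u := IH (fun v => f [tuple of u :: v]) (M * B u).
  have h' u : (0 <= eintegral_tuple (fun v => (normc (f [tuple of u :: v]))%:E)
      <= (M * B u * dom_integral ^+ r)%:E)%E.
    by apply: h => v; rewrite -mulrA -tuple_dom_cons.
  apply/andP; split; first by apply: integral_ge0 => u _; case/andP: (h' u).
  apply: (@le_trans _ _ (\int[mu]_u (M * dom_integral ^+ r * B u)%:E)%E).
    apply: le_integral_nonneg => u; first by case/andP: (h' u).
    by case/andP: (h' u) => _; rewrite mulrAC.
  under eq_integral do rewrite EFinM.
  by rewrite (integralZl measurableT iB) integral_dom -EFinM -mulrA -exprSr.
by case/andP: h => _ /le_lt_trans; apply; exact: ltry.
Qed.

End DominatedIntegrals.

(** * The desingularized kernel *)

Section DesingKernel.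
Context {R : realType}.
Implicit Types (w z g : R[i]) (c d : R).

(** The derivative of [exp_rem 1]. Hence, as a function of z = g w, the kernel at c = 1 is the
    derivative of 1 / [exp_rem 1 z]. *)
Definition exp_psi z : R[i] := exp_rem 1 z - exp_rem 2 z.

(* Minus the summand of the desingularized factor divided by c - 1, with its
   singularity at w = 0 removed. *)
Definition desing_kernel g c w : R[i] :=
  - (exp_psi (g * w) + (c - 1)%:C * (cexp (g * w) * exp_rem 2 ((c - 1)%:C * (g * w)))) /
  (c%:C * exp_rem 1 (g * w) * exp_rem 1 (c%:C * (g * w))).

Lemma exp_rem2E z : z * exp_rem 2 z = exp_rem 1 z - 1.
Proof. by rewrite [in RHS]exp_rem_rec !factS fact0 invr1 addrC addKr. Qed.

Lemma exp_psiE z : z * exp_psi z = cexp z - exp_rem 1 z.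
Proof. by rewrite /exp_psi mulrBr exp_rem1E exp_rem2E; ring. Qed.

(** An exact expansion about c = 1: multiplied by z, both sides become e^{cz} - 1, the right one
    through e^{cz} = e^z e^{(c-1)z}. *)
Lemma exp_rem1_scale c z :
  c%:C * exp_rem 1 (c%:C * z) =
  exp_rem 1 z + (c - 1)%:C * (cexp z * exp_rem 1 ((c - 1)%:C * z)).
Proof.
have [->|z0] := eqVneq z 0.
  by rewrite !mulr0 cexp0 !exp_rem_at0 invr1 mul1r !mulr1 -rmorphD addrC subrK.
apply: (mulfI z0); rewrite mulrDr mulrCA mulrA exp_rem1E exp_rem1E.
have -> : z * ((c - 1)%:C * (cexp z * exp_rem 1 ((c - 1)%:C * z))) =
  cexp z * ((c - 1)%:C * z * exp_rem 1 ((c - 1)%:C * z)) by ring.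
rewrite exp_rem1E mulrBr -cexpD rmorphB rmorph1 mulrBl mul1r.
by rewrite (addrC z) subrK; ring.
Qed.

(** Both terms have the same simple pole 1 / z. Over a common denominator the numerator becomes
    divisible by c - 1 and by z: the first gives the factor in front, the second cancels the
    pole. *)
Lemma desing_kernel_spec g c w : w != 0 -> g != 0 -> c != 0 ->
  exp_rem 1 (g * w) != 0 -> exp_rem 1 (c%:C * (g * w)) != 0 ->
  (cexp (g * w) - 1)^-1 - c%:C / (cexp (c%:C * g * w) - 1) =
  - (c - 1)%:C * desing_kernel g c w.
Proof.
move=> w0 g0 c0 h1 h2; set z := g * w.
have z0 : z != 0 by rewrite mulf_neq0.
have cC0 : c%:C != 0 :> R[i] by rewrite -[0]/(0%:C) (inj_eq (@complexI R)).
rewrite /desing_kernel -mulrA -/z -exp_rem1E -exp_rem1E.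
have E : c%:C * exp_rem 1 (c%:C * z) - c%:C * exp_rem 1 z =
    (c - 1)%:C * (z * (exp_psi z +
      (c - 1)%:C * (cexp z * exp_rem 2 ((c - 1)%:C * z)))).
  rewrite exp_rem1_scale mulrDr exp_psiE.
  have -> : z * ((c - 1)%:C * (cexp z * exp_rem 2 ((c - 1)%:C * z))) =
    cexp z * ((c - 1)%:C * z * exp_rem 2 ((c - 1)%:C * z)) by ring.
  rewrite exp_rem2E rmorphB rmorph1; ring.
move: h1 h2 E; rewrite -/z.
move: (exp_rem 1 z) (exp_rem 1 (c%:C * z)) (exp_psi z + _) => e1 e2 p h1 h2 E.
have -> : (z * e1)^-1 - c%:C / (c%:C * z * e2) =
    (c%:C * e2 - c%:C * e1) / (c%:C * z * e1 * e2).
  by field; rewrite z0 h1 h2 cC0.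
by rewrite E; field; rewrite z0 h1 h2 cC0.
Qed.

(** The factor c - 1 is exhibited by an exact formula, from which the Lipschitz bound in c can be
    read. *)
Lemma desing_kernelB g c w : c != 0 ->
  exp_rem 1 (g * w) != 0 -> exp_rem 1 (c%:C * (g * w)) != 0 ->
  desing_kernel g c w - desing_kernel g 1 w =
  - (c - 1)%:C * (cexp (g * w) *
    (exp_rem 2 ((c - 1)%:C * (g * w)) * exp_rem 1 (g * w) -
     exp_psi (g * w) * exp_rem 1 ((c - 1)%:C * (g * w)))) /
  (c%:C * exp_rem 1 (g * w) ^+ 2 * exp_rem 1 (c%:C * (g * w))).
Proof.
move=> c0 h1 h2; set z := g * w.
have cC0 : c%:C != 0 :> R[i] by rewrite -[0]/(0%:C) (inj_eq (@complexI R)).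
have -> : desing_kernel g 1 w = - exp_psi z / (exp_rem 1 z * exp_rem 1 z).
  by rewrite /desing_kernel subrr rmorph0 mul0r addr0 rmorph1 !mul1r.
rewrite /desing_kernel -/z; have := exp_rem1_scale c z; move: h1 h2; rewrite -/z.
move: (exp_rem 1 z) (exp_rem 1 (c%:C * z)) (exp_psi z) (cexp z)
  (exp_rem 2 ((c - 1)%:C * z)) (exp_rem 1 ((c - 1)%:C * z)).
move: ((c - 1)%:C) => d e1 e2 p x y t h1 h2 E.
have -> : - (p + d * (x * y)) / (c%:C * e1 * e2) - - p / (e1 * e1) =
   - ((p + d * (x * y)) * e1 - p * (c%:C * e2)) / (c%:C * e1 ^+ 2 * e2).
  by field; rewrite h1 h2 cC0.
by rewrite E; congr (_ / _); ring.
Qed.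

Lemma is_derive_desing_kernel g c w : c != 0 ->
  exp_rem 1 (g * w) != 0 -> exp_rem 1 (c%:C * (g * w)) != 0 ->
  exists e : R[i], is_derive w 1 (desing_kernel g c) e.
Proof.
move=> c0 h1 h2.
have er j (k : R[i]) := is_derive_scale_complex (is_derive_exp_rem j (k * w)).
have er' j (k : R) : is_derive w 1 (fun v => exp_rem j (k%:C * (g * v)))
    ((exp_rem j (k%:C * g * w) - j%:R * exp_rem j.+1 (k%:C * g * w)) * (k%:C * g)).
  by under eq_fun do rewrite mulrA; exact: er.
have ce := is_derive_scale_complex (is_derive_cexp (g * w)).
have cC0 : c%:C != 0 :> R[i] by rewrite -[0]/(0%:C) (inj_eq (@complexI R)).
have den : c%:C * exp_rem 1 (g * w) * exp_rem 1 (c%:C * (g * w)) != 0.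
  by rewrite !mulf_neq0.
have num := is_deriveN_complex (is_deriveD_complex
  (is_deriveD_complex (er 1%N g) (is_deriveN_complex (er 2%N g)))
  (is_deriveZ_complex (c - 1)%:C (is_deriveM_complex ce (er' 2%N (c - 1))))).
have inv := @is_deriveV_complex _ (fun w => c%:C * exp_rem 1 (g * w) *
    exp_rem 1 (c%:C * (g * w))) _ _ den
  (is_deriveM_complex (is_deriveZ_complex c%:C (er 1%N g)) (er' 1%N c)).
eexists; exact: (is_deriveM_complex num inv).
Qed.

(** * Exponential decay of the kernel on a strip *)

Section Estimates.
Variable g : R[i].
Hypothesis g_gt0 : 0 < complex.Re g.

Let a := complex.Re g.
Let N := normc g.

Let a_gt0 : 0 < a. Proof. exact: g_gt0. Qed.

Let aN : a <= N.
Proof. by rewrite (le_trans (ler_norm _))// Re_le_normc. Qed.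

Let N_gt0 : 0 < N. Proof. exact: lt_le_trans aN. Qed.

Let g0 : g != 0. Proof. by rewrite -normc_gt0. Qed.

(** A half-infinite strip contains the Hankel contours of radius at most rho and, unlike a contour,
    is convex; sums of contour points therefore stay in a strip of larger width. *)
Definition strip (rho : R) w := - rho <= complex.Re w /\ `|complex.Im w| <= rho.

(* On a narrow strip around the positive half-line, either z = c g w is small
   or its real part is bounded below. *)
Let rho0 := a / (64 * N ^+ 2).
Let kap := a / (32 * N).

Let rho0_gt0 : 0 < rho0.
Proof. by rewrite divr_gt0// mulr_gt0// exprn_gt0. Qed.

Let Nrho0 : N * rho0 = a / (64 * N).
Proof. by rewrite /rho0; field; rewrite lt0r_neq0. Qed.

Let Nrho0_le : N * rho0 <= 64^-1.
Proof.
rewrite Nrho0 invfM mulrCA ler_piMr ?invr_ge0//.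
by rewrite ler_pdivrMr ?mul1r.
Qed.

Let kap_gt0 : 0 < kap.
Proof. by rewrite divr_gt0// mulr_gt0. Qed.

Let ReIm_bound w : strip rho0 w ->
  `|complex.Im g * complex.Im w| <= a / (64 * N).
Proof.
move=> [_ h]; rewrite normrM -Nrho0 ler_pM//; exact: Im_le_normc.
Qed.

Let Re_cgw c w : complex.Re (c%:C * (g * w)) =
  c * (a * complex.Re w - complex.Im g * complex.Im w).
Proof. by rewrite !ReM /= mul0r subr0. Qed.

(** If |z| > 1/4 then N |w| >= 1/6 because c <= 3/2. As N rho0 <= 1/64, neither Im w nor a negative
    Re w can account for this, so N Re w >= 1/8. Then a Re w >= 4 kap while the cross term Im g Im w
    is at most kap / 2. *)
Let dichotomy c w : strip rho0 w -> 2^-1 <= c <= 3 / 2 ->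
  normc (c%:C * (g * w)) <= 4^-1 \/
  kap <= complex.Re (c%:C * (g * w)) /\ 4^-1 <= normc (c%:C * (g * w)).
Proof.
move=> sw /andP[c1 c2]; have [|/ltW h] := leP (normc (c%:C * (g * w))) 4^-1.
  by left.
right; split=> //; have := ReIm_bound sw; case: sw => r1 r2.
rewrite ler_norml => /andP[b1 b2].
have c0 : 0 <= c by apply: le_trans c1.
have hw : 6^-1 <= N * normc w.
  move: h; rewrite normcM normcM normc_real ger0_norm// => h.
  rewrite -(@ler_pM2l _ (3 / 2))//; apply: (@le_trans _ _ (c * (N * normc w))).
    by rewrite (le_trans _ h)//; lra.
  by rewrite ler_wpM2r// mulr_ge0// ?normc_ge0 ?ltW.
have hx : 8^-1 <= N * complex.Re w.
  have h1 : N * normc w <= N * `|complex.Re w| + N * `|complex.Im w|.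
    by rewrite -mulrDr; apply: ler_wpM2l; [exact: ltW|exact: normc_le_ReIm].
  have h2 : N * `|complex.Im w| <= N * rho0.
    by apply: ler_wpM2l => //; exact: ltW.
  have h3 : - (N * rho0) <= N * complex.Re w 
    by rewrite -mulrN; apply: ler_wpM2l => //; exact: ltW.
  have h4 := Nrho0_le.
  have [w0|w0] := leP 0 (complex.Re w); first by move: h1; rewrite (ger0_norm w0) => h1; lra.
  by move: h1; rewrite (ltr0_norm w0) mulrN => h1; lra.
rewrite Re_cgw.
have aw : a / (8 * N) <= a * complex.Re w.
  rewrite ler_pdivrMr ?mulr_gt0// -mulrA ler_peMr//; first exact: ltW.
  lra.
have e1 : a / (64 * N) = kap / 2 by rewrite /kap; field; rewrite lt0r_neq0.
have e2 : a / (8 * N) = 4 * kap by rewrite /kap; field; rewrite lt0r_neq0.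
rewrite e1 in b1 b2; rewrite e2 in aw.
apply: (@le_trans _ _ (2^-1 * (7 / 2 * kap))); first by have := kap_gt0 => ?; lra.
by rewrite ler_pM//; have := kap_gt0 => ?; lra.
Qed.

Let m := Num.min (4^-1) (1 - expR (- kap)).

Let m_gt0 : 0 < m.
Proof. by rewrite lt_min invr_gt0 ltr0n subr_gt0 expR_lt1 oppr_lt0. Qed.

Let expR4 : expR (4^-1) <= 2 :> R.
Proof.
rewrite -[4^-1]opprK expRN -[2]invrK lef_pV2 ?posrE ?invr_gt0 ?expR_gt0//.
by have := expR_ge1Dx (- 4^-1 : R) => ?; lra.
Qed.

Let expR4N (x : R) : - 4^-1 <= x -> 3 / 4 <= expR x.
Proof. by move=> hx; have := expR_ge1Dx x => ?; lra. Qed.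

(** For small z, |[exp_rem 1 z] - 1| = |z [exp_rem 2 z]| <= 1/2. Otherwise |e^z - 1| >= e^{Re z} - 1
    >= (1 - e^{-kap}) e^{Re z}. The factor 1 + |z| absorbs the division by z; the two cases account
    for the two terms of [m]. *)
Let exp_rem1_lb c w : strip rho0 w -> 2^-1 <= c <= 3 / 2 ->
  m * expR (complex.Re (c%:C * (g * w))) <=
  normc (exp_rem 1 (c%:C * (g * w))) * (1 + normc (c%:C * (g * w))).
Proof.
move=> sw hc; have := dichotomy sw hc; set z := c%:C * (g * w) => -[zs|[zk zl]].
  have h1 : normc (exp_rem 1 z - 1) <= 2^-1.
    rewrite -exp_rem2E normcM.
    apply: (@le_trans _ _ (4^-1 * expR (4^-1))); last by have := expR4 => ?; lra.
    rewrite ler_pM ?normc_ge0// (le_trans (normc_exp_rem _ _))// ler_expR//.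
  have h2 : 2^-1 <= normc (exp_rem 1 z).
    have := normcBl 1 (1 - exp_rem 1 z).
    by rewrite normc1 opprB addrCA subrr addr0 normc_distC => ?; lra.
  apply: (@le_trans _ _ (4^-1 * 2)).
    rewrite ler_pM ?expR_ge0 ?(ltW m_gt0)//; first by rewrite /m ge_min lexx.
    rewrite (le_trans _ expR4)// ler_expR (le_trans (ler_norm _))//.
    exact: le_trans (Re_le_normc _) zs.
  apply: (@le_trans _ _ (2^-1 * 1)); first by lra.
  by rewrite ler_pM// lerDl normc_ge0.
apply: (@le_trans _ _ (normc (z * exp_rem 1 z))); last first.
  by rewrite normcM mulrC ler_wpM2l ?normc_ge0// lerDr.
rewrite exp_rem1E; apply: (@le_trans _ _ (expR (complex.Re z) - 1)); last first.
  by rewrite -normc_cexp -[1 in leLHS]normc1 normcBl.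
have e0 := expR_gt0 (complex.Re z).
have h : m <= 1 - expR (- complex.Re z).
  apply: (@le_trans _ _ (1 - expR (- kap))); first by rewrite /m ge_min lexx orbT.
  by rewrite lerD2l lerN2 ler_expR lerN2.
have -> : expR (complex.Re z) - 1 = (1 - expR (- complex.Re z)) * expR (complex.Re z).
  by rewrite mulrBl mul1r -expRD addNr expR0.
by rewrite ler_wpM2r// ltW.
Qed.

Let exp_rem1_neq0 c w : strip rho0 w -> 2^-1 <= c <= 3 / 2 ->
  exp_rem 1 (c%:C * (g * w)) != 0.
Proof.
move=> sw hc; have := exp_rem1_lb sw hc; apply: contraTneq => ->.
by rewrite normc0 mul0r -ltNge mulr_gt0// expR_gt0.
Qed.

Let upper w : strip rho0 w ->
  normc (exp_rem 1 (g * w)) <= 32 * (1 + normc (g * w)) * expR (complex.Re (g * w)) /\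
  normc (exp_psi (g * w)) <= 32 * (1 + normc (g * w)) * expR (complex.Re (g * w)).
Proof.
move=> sw; have h12 : 2^-1 <= (1 : R) <= 3 / 2 by apply/andP; split; lra.
have := dichotomy sw h12; rewrite rmorph1 mul1r; set z := g * w => D.
have nz := normc_ge0 z; have ez := expR_gt0 (complex.Re z).
case: D => [zs|[zk zl]].
  have rz : 3 / 4 <= expR (complex.Re z).
    apply: expR4N; have := le_trans (Re_le_normc z) zs.
    by rewrite ler_norml => /andP[].
  have b k : normc (exp_rem k z) <= 2.
    rewrite (le_trans (normc_exp_rem _ _))// (le_trans _ expR4)// ler_expR//.
  have U : 24 <= 32 * (1 + normc z) * expR (complex.Re z).
    apply: (@le_trans _ _ (32 * 1 * (3 / 4))); first by lra.
    by rewrite ler_pM//; lra.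
  split; first by have := b 1%N => ?; lra.
  by have := normcB (exp_rem 1 z) (exp_rem 2 z); have := b 1%N; have := b 2%N => *; lra.
have rz : 1 <= expR (complex.Re z).
  by rewrite -[leLHS]expR0 ler_expR; apply: le_trans zk; exact: ltW.
have b1 : normc (exp_rem 1 z) <= 8 * expR (complex.Re z).
  rewrite -(@ler_pM2l _ (4^-1))//.
  apply: (@le_trans _ _ (normc (z * exp_rem 1 z))).
    by rewrite normcM ler_wpM2r ?normc_ge0.
  rewrite exp_rem1E (le_trans (normcB _ _))// normc1 normc_cexp; lra.
have b2 : normc (exp_psi z) <= 36 * expR (complex.Re z).
  rewrite -(@ler_pM2l _ (4^-1))//.
  apply: (@le_trans _ _ (normc (z * exp_psi z))).
    by rewrite normcM ler_wpM2r ?normc_ge0.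
  rewrite exp_psiE (le_trans (normcB _ _))// normc_cexp; lra.
have U : 40 * expR (complex.Re z) <= 32 * (1 + normc z) * expR (complex.Re z).
  by apply: ler_wpM2r; [exact: ltW|lra].
by split; lra.
Qed.

Let d0 := Num.min (2^-1) (a / (8 * N)).

Let d0_gt0 : 0 < d0.
Proof. by rewrite lt_min invr_gt0 ltr0n divr_gt0// mulr_gt0. Qed.

Let c_range c : `|c - 1| <= d0 -> 2^-1 <= c <= 3 / 2.
Proof.
rewrite le_min => /andP[+ _]; rewrite ler_norml => /andP[h1 h2].
by apply/andP; split; lra.
Qed.

Let K0 := 3 + 64 * N / a.

(** An exponent budget with X = Re w + rho0 >= 0: the decay provides -aX/2, since c >= 1/2; the
    fourth power costs aX/8, which fixes [K0]; the perturbation in c costs aX/8, which fixes the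
    second term of [d0]. The rate a/4 remains, and the bounded terms fit in exp 3. *)
Let growth c w : strip rho0 w -> `|c - 1| <= d0 ->
  (1 + 2 * normc (g * w)) ^+ 4 * expR (`|c - 1| * normc (g * w)) *
    expR (- (c * complex.Re (g * w))) <=
  K0 ^+ 4 * expR 3 * expR (- (a / 4 * complex.Re w)).
Proof.
move=> sw hc; have /andP[c1 c2] := c_range hc.
have hN := Nrho0_le; have hR := ReIm_bound sw; have hNr := Nrho0.
have [r1 r2] := sw.
pose X := complex.Re w + rho0.
have X0 : 0 <= X by rewrite /X; lra.
have ar : a * rho0 <= 64^-1.
  by apply: le_trans hN; apply: ler_wpM2r => //; exact: ltW.
have NX : normc (g * w) <= N * X + 1.
  rewrite normcM; apply: (@le_trans _ _ (N * (X + rho0 + rho0))).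
    apply: ler_wpM2l; first exact: ltW.
    apply: (le_trans (normc_le_ReIm _)); apply: lerD => //.
    have rr := ltW rho0_gt0.
    by rewrite ler_norml /X; apply/andP; split; lra.
  by rewrite !mulrDr; lra.
have RX : a * X - 1 <= complex.Re (g * w).
  move: hR; rewrite ler_norml ReM -/a -hNr => /andP[h1 h2].
  by rewrite /X mulrDr; lra.
have aX0 : 0 <= a * X by apply: mulr_ge0 => //; exact: ltW.
have P1 : 1 + 2 * normc (g * w) <= K0 * expR (a * X / 32).
  have e1 := expR_ge1Dx (a * X / 32).
  apply: (@le_trans _ _ (K0 * (1 + a * X / 32))); last first.
    by apply: ler_wpM2l => //; rewrite /K0 addr_ge0// divr_ge0 ?mulr_ge0// ltW.
  have -> : K0 * (1 + a * X / 32) = 3 + 64 * N / a + 3 * (a * X / 32) + 2 * (N * X).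
    by rewrite /K0; field; rewrite lt0r_neq0.
  have : 0 <= 64 * N / a by rewrite divr_ge0 ?mulr_ge0// ltW.
  by move=> h; lra.
have P4 : (1 + 2 * normc (g * w)) ^+ 4 <= K0 ^+ 4 * expR (a * X / 8).
  have -> : a * X / 8 = 4%:R * (a * X / 32) by field.
  rewrite expRM_natl -exprMn lerXn2r// nnegrE.
    by rewrite addr_ge0 ?mulr_ge0 ?normc_ge0.
  by apply: le_trans P1; rewrite addr_ge0 ?mulr_ge0 ?normc_ge0.
have D1 : `|c - 1| * normc (g * w) <= a * X / 8 + 1.
  apply: (@le_trans _ _ (`|c - 1| * (N * X) + `|c - 1|)).
    have -> : `|c - 1| * (N * X) + `|c - 1| = `|c - 1| * (N * X + 1) by ring.
    exact: ler_wpM2l.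
  move: hc; rewrite le_min => /andP[hc1 hc2].
  have : `|c - 1| * (N * X) <= a / (8 * N) * (N * X).
    by apply: ler_wpM2r => //; apply: mulr_ge0 => //; exact: ltW.
  have -> : a / (8 * N) * (N * X) = a * X / 8 by field; rewrite lt0r_neq0.
  by move=> h; lra.
have C1 : a * X / 2 - 3 / 2 <= c * complex.Re (g * w).
  have c0 : 0 <= c by apply: le_trans c1.
  apply: (@le_trans _ _ (c * (a * X - 1))); last exact: ler_wpM2l.
  have : 2^-1 * (a * X) <= c * (a * X) by exact: ler_wpM2r.
  by move=> h; rewrite mulrBr; lra.
apply: (@le_trans _ _ (K0 ^+ 4 * expR (a * X / 8) * expR (a * X / 8 + 1)
    * expR (- (a * X / 2 - 3 / 2)))).
  apply: ler_pM; rewrite ?expR_ge0//.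
  - by rewrite mulr_ge0 ?expR_ge0// exprn_ge0// addr_ge0 ?mulr_ge0 ?normc_ge0.
  - apply: ler_pM; rewrite ?expR_ge0 ?ler_expR//.
    by rewrite exprn_ge0// addr_ge0 ?mulr_ge0 ?normc_ge0.
  - by rewrite ler_expR lerN2.
have K40 : 0 <= K0 ^+ 4.
  by rewrite exprn_ge0// /K0 addr_ge0// divr_ge0 ?mulr_ge0// ltW.
move: (K0 ^+ 4) K40 => K4 K40.
rewrite -!(mulrA K4) -!expRD; apply: ler_wpM2l => //.
rewrite ler_expR.
have -> : a / 4 * complex.Re w = a * X / 4 - a * rho0 / 4 by rewrite /X; field.
by have : 0 <= a * rho0; [by apply: mulr_ge0; exact: ltW|move=> h; lra].
Qed.

(** The growth e^{Re z} of the numerator cancels against the factors [exp_rem 1 z] of the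
    denominator; the factor at c z leaves e^{-c Re z}, to which [growth] applies. The second
    estimate has three such denominators, whence m^-3 and the fourth power of P; 128 is 64 from its
    numerator times c^-1 <= 2. *)
Let kernel_bounds c w : strip rho0 w -> `|c - 1| <= d0 ->
  normc (desing_kernel g c w) <=
    128 * m^-1 ^+ 3 * (K0 ^+ 4 * expR 3) * expR (- (a / 4 * complex.Re w)) /\
  normc (desing_kernel g c w - desing_kernel g 1 w) <=
    128 * m^-1 ^+ 3 * (K0 ^+ 4 * expR 3) * `|c - 1| *
    expR (- (a / 4 * complex.Re w)).
Proof.
move=> sw hc; have hr := c_range hc; have /andP[c1 c2] := hr.
have c0 : 0 < c by apply: lt_le_trans c1; rewrite invr_gt0.
have h12 : 2^-1 <= (1 : R) <= 3 / 2 by apply/andP; split; lra.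
have E1 := exp_rem1_neq0 sw h12; have E2 := exp_rem1_neq0 sw hr.
have L1 := exp_rem1_lb sw h12; have L2 := exp_rem1_lb sw hr.
have [U1 U2] := upper sw; have G := growth sw hc.
rewrite rmorph1 mul1r in E1 L1.
pose z := g * w; pose P := 1 + 2 * normc z.
pose x := expR (complex.Re z); pose y := expR (- complex.Re z).
pose yc := expR (- (c * complex.Re z)); pose D := expR (`|c - 1| * normc z).
rewrite -/z in E1 E2 L1 L2 U1 U2 G; rewrite -/x in L1 U1 U2.
rewrite -/P -/D -/yc in G.
have xy : x * y = 1 by rewrite -expRD addrN expR0.
have x0 : 0 < x by exact: expR_gt0.
have y0 : 0 < y by exact: expR_gt0.
have yc0 : 0 < yc by exact: expR_gt0.
have nz := normc_ge0 z.
have P1 : 1 <= P by rewrite lerDl mulr_ge0.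
have P0 : 0 < P by apply: lt_le_trans P1.
have zP : 1 + normc z <= P by rewrite /P; lra.
have D1 : 1 <= D by rewrite -[leLHS]expR0 ler_expR mulr_ge0.
have D0 : 0 < D by apply: lt_le_trans D1.
have mi0 : 0 < m^-1 by rewrite invr_gt0.
have mi1 : 1 <= m^-1.
  rewrite invf_ge1//; apply: (@le_trans _ _ (4^-1)); last by lra.
  by rewrite /m ge_min lexx.
have nd : normc (c - 1)%:C = `|c - 1| by exact: normc_real.
have d1 : `|c - 1| <= 1.
  by apply: (le_trans hc); rewrite /d0 ge_min; apply/orP; left; lra.
have inv (e t : R) : 0 < e -> 0 < t -> m * t <= e * P -> e^-1 <= m^-1 * t^-1 * P.
  move=> e0 t0 h; rewrite -invfM -[leLHS]mul1r ler_pdivrMr// mulrAC mulrC.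
  by rewrite mulrA mulrC mulrA ler_pdivlMr ?mulr_gt0// mul1r mulrC// mulrC.
have I1 : (normc (exp_rem 1 z))^-1 <= m^-1 * y * P.
  rewrite /y expRN -/x; apply: inv => //; first by rewrite normc_gt0.
  by apply: (le_trans L1); apply: ler_wpM2l => //; exact: normc_ge0.
have I2 : (normc (exp_rem 1 (c%:C * z)))^-1 <= m^-1 * yc * P.
  rewrite /yc expRN; apply: inv; rewrite ?normc_gt0 ?expR_gt0//.
  have -> : c * complex.Re z = complex.Re (c%:C * z) by rewrite ReM /= mul0r subr0.
  apply: (le_trans L2); apply: ler_wpM2l; first exact: normc_ge0.
  rewrite normcM normc_real gtr0_norm// /P lerD2l; apply: ler_wpM2r => //.
  by apply: (le_trans c2); lra.
have Ic : c^-1 <= 2 by rewrite -[2]invrK lef_pV2 ?posrE.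
have Rk k : normc (exp_rem k ((c - 1)%:C * z)) <= D.
  by rewrite (le_trans (normc_exp_rem _ _))// ler_expR normcM nd.
have nc : normc (cexp z) = x by exact: normc_cexp.
have U' : 32 * (1 + normc z) * x <= 32 * P * x.
  by apply: ler_wpM2r; [exact: ltW|lra].
have K00 : 0 <= K0 by rewrite /K0 addr_ge0// divr_ge0 ?mulr_ge0// ltW.
have mp0 : 0 < m^-1 * y * P by rewrite !mulr_gt0.
have mp1 : 0 < m^-1 * yc * P by rewrite !mulr_gt0.
have ci0 : 0 <= c^-1 by rewrite invr_ge0 ltW.
have ei0 (e : R[i]) : 0 <= (normc e)^-1 by rewrite invr_ge0 normc_ge0.
have mG : 0 <= 128 * m^-1 ^+ 3 by rewrite mulr_ge0// exprn_ge0// ltW.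
have T0 : 0 <= P ^+ 4 * D * yc by rewrite !mulr_ge0// ?exprn_ge0// ltW.
split.
  have num : normc (exp_psi z + (c - 1)%:C * (cexp z * exp_rem 2 ((c - 1)%:C * z)))
      <= 33 * P * x * D.
    rewrite (le_trans (normcD _ _))// normcM nd normcM nc.
    have t1 : 32 * P * x <= 32 * P * x * D.
      by rewrite ler_peMr// !mulr_ge0// ltW.
    have t2 : `|c - 1| * (x * normc (exp_rem 2 ((c - 1)%:C * z))) <= P * x * D.
      rewrite -mulrA; apply: ler_pM => //.
      - by rewrite mulr_ge0 ?normc_ge0// ltW.
      - exact: le_trans P1.
      - by apply: ler_pM => //; [exact: ltW|exact: normc_ge0].
    by lra.
  have -> : normc (desing_kernel g c w) =
      normc (exp_psi z + (c - 1)%:C * (cexp z * exp_rem 2 ((c - 1)%:C * z))) *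
      (c^-1 * (normc (exp_rem 1 z))^-1 * (normc (exp_rem 1 (c%:C * z)))^-1).
    rewrite /desing_kernel -/z normcM normcV normcN; congr (_ * _).
    by rewrite !normcM normc_real gtr0_norm// !invfM.
  apply: (@le_trans _ _ (33 * P * x * D * (2 * (m^-1 * y * P) * (m^-1 * yc * P)))).
    apply: ler_pM => //; first exact: normc_ge0.
      by rewrite !mulr_ge0.
    by apply: ler_pM => //; [exact: mulr_ge0|apply: ler_pM].
  have -> : 33 * P * x * D * (2 * (m^-1 * y * P) * (m^-1 * yc * P)) =
    (66 * m^-1 ^+ 2 * (P ^+ 3 * D * yc)) * (x * y) by ring.
  rewrite xy mulr1; apply: (@le_trans _ _ (128 * m^-1 ^+ 3 * (P ^+ 4 * D * yc))).
    apply: ler_pM.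
    - by rewrite mulr_ge0// exprn_ge0// ltW.
    - by rewrite !mulr_ge0// ?exprn_ge0// ltW.
    - apply: ler_pM => //; [by rewrite exprn_ge0// ltW|by lra|].
      by apply: ler_weXn2l.
    - apply: ler_wpM2r; first exact: ltW.
      apply: ler_wpM2r; first exact: ltW.
      by apply: ler_weXn2l.
  by rewrite -[leRHS]mulrA; apply: ler_wpM2l.
have num : normc (cexp z * (exp_rem 2 ((c - 1)%:C * z) * exp_rem 1 z -
    exp_psi z * exp_rem 1 ((c - 1)%:C * z))) <= 64 * P * x * x * D.
  rewrite normcM nc; have -> : 64 * P * x * x * D =
    x * (D * (32 * P * x) + (32 * P * x) * D) by ring.
  apply: ler_wpM2l; first exact: ltW.
  rewrite (le_trans (normcB _ _))// !normcM; apply: lerD.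
    by apply: ler_pM; rewrite ?normc_ge0//; exact: le_trans U'.
  by apply: ler_pM; rewrite ?normc_ge0//; exact: le_trans U'.
rewrite (desing_kernelB (lt0r_neq0 c0) E1 E2) -/z.
set n := cexp z * _.
have -> : normc (- (c - 1)%:C * n / (c%:C * exp_rem 1 z ^+ 2 * exp_rem 1 (c%:C * z))) =
   `|c - 1| * (normc n *
   (c^-1 * ((normc (exp_rem 1 z))^-1 * (normc (exp_rem 1 z))^-1)
     * (normc (exp_rem 1 (c%:C * z)))^-1)).
  rewrite normcM normcV [normc (- _ * _)]normcM normcN nd -mulrA; congr (_ * (_ * _)).
  by rewrite expr2 !normcM normc_real gtr0_norm// !invfM.
rewrite -[leRHS]mulrAC [leRHS]mulrC; apply: ler_wpM2l => //.
apply: (@le_trans _ _ (64 * P * x * x * D *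
   (2 * ((m^-1 * y * P) * (m^-1 * y * P)) * (m^-1 * yc * P)))).
  apply: ler_pM => //; first exact: normc_ge0.
    by rewrite !mulr_ge0.
  apply: ler_pM => //; first by rewrite !mulr_ge0.
  by apply: ler_pM => //; [exact: mulr_ge0|apply: ler_pM].
have -> : 64 * P * x * x * D *
   (2 * ((m^-1 * y * P) * (m^-1 * y * P)) * (m^-1 * yc * P)) =
  (128 * m^-1 ^+ 3 * (P ^+ 4 * D * yc)) * (x * y) ^+ 2 by ring.
by rewrite xy expr1n mulr1 -[leRHS]mulrA; apply: ler_wpM2l.
Qed.

(** The right-hand side is continuous at w and agrees with the raw formula on a punctured
    neighbourhood, so it is the punctured limit, at w = 0 too. *)
Lemma desing_factorE c w : strip rho0 w -> `|c - 1| <= d0 ->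
  desing_factor g c w = - (c - 1)%:C * desing_kernel g c w.
Proof.
move=> sw hc; have hr := c_range hc; have /andP[c1 c2] := hr.
have c0 : 0 < c by apply: lt_le_trans c1; rewrite invr_gt0.
have h12 : 2^-1 <= (1 : R) <= 3 / 2 by apply/andP; split; lra.
have E1 := exp_rem1_neq0 sw h12; have E2 := exp_rem1_neq0 sw hr.
rewrite rmorph1 mul1r in E1.
pose G v := - (c - 1)%:C * desing_kernel g c v.
have [d Kd] := is_derive_desing_kernel (lt0r_neq0 c0) E1 E2.
have cG : G v @[v --> w] --> G w.
  exact: (is_derive_cvg (is_deriveZ_complex _ Kd)).
have er j (k : R[i]) : exp_rem j (k * v) @[v --> w] --> exp_rem j (k * w).
  exact: (is_derive_cvg (is_derive_scale_complex (is_derive_exp_rem j _))).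
have er' j (k : R) : exp_rem j (k%:C * (g * v)) @[v --> w] --> exp_rem j (k%:C * (g * w)).
  by rewrite mulrA; under eq_fun do rewrite mulrA; exact: er.
have nz (f : R[i] -> R[i]) : f v @[v --> w] --> f w -> f w != 0 ->
    \forall v \near w, f v != 0.
  move=> /cvg_normcP/(_ (normc (f w))); rewrite normc_gt0 => h fw.
  by apply: filterS (h fw) => v; apply: contraTneq => ->; rewrite subr0 ltxx.
have N1 := nz _ (er 1%N g) E1; have N2 := nz _ (er' 1%N c) E2.
apply: cvg_lim => //.
have cG' : G v @[v --> w^'] --> G w by exact: cvg_within_filter.
apply: cvg_trans cG'; apply: near_eq_cvg; rewrite near_withinE.
have N3 : \forall v \near w, v != w -> v != 0.
  have [->|w0] := eqVneq w 0; first by apply: filterE.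
  by have := nz id (@cvg_id _ _) w0; apply: filterS.
near=> v => vw; apply/esym; apply: desing_kernel_spec => //.
- by apply: (near N3 v).
- by rewrite lt0r_neq0.
- by near: v.
- by near: v.
Unshelve. all: by end_near. Qed.

Lemma desing_factor_bounds : exists rho d C del : R,
  [/\ 0 < rho, 0 < d, 0 < del, 0 <= C &
   forall w, strip rho w -> exp_rem 1 (g * w) != 0 /\
   forall c, `|c - 1| <= d ->
   [/\ desing_factor g c w = - (c - 1)%:C * desing_kernel g c w,
       normc (desing_kernel g c w) <= C * expR (- (del * complex.Re w)) &
       normc (desing_kernel g c w - desing_kernel g 1 w) <=
         C * `|c - 1| * expR (- (del * complex.Re w))]].
Proof.
exists rho0, d0, (128 * m^-1 ^+ 3 * (K0 ^+ 4 * expR 3)), (a / 4); split=> //.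
- by rewrite divr_gt0.
- apply: mulr_ge0; first by apply: mulr_ge0 => //; apply: exprn_ge0; rewrite invr_ge0 ltW.
  apply: mulr_ge0; last exact: expR_ge0.
  by apply: exprn_ge0; rewrite /K0 addr_ge0// divr_ge0 ?mulr_ge0// ltW.
move=> w sw; split.
  have h12 : 2^-1 <= (1 : R) <= 3 / 2 by apply/andP; split; lra.
  by have := exp_rem1_neq0 sw h12; rewrite rmorph1 mul1r.
move=> c hc; have [b1 b2] := kernel_bounds sw hc.
by split=> //; exact: desing_factorE.
Qed.

End Estimates.
End DesingKernel.

(** * The Hankel contour *)

Section LebesgueIsometries.
Context {R : realType}.
Local Notation TR := (measurableTypeR R).

(** The image measure agrees with Lebesgue measure on half-open intervals, hence everywhere by
    uniqueness; the rest is the change of variables for an image measure. *)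
Let isometry_integral (phi : TR -> TR) (f : R -> R) :
  measurable_fun setT phi ->
  (forall a b : R, lebesgue_measure (phi @^-1` `]a, b]) =
     lebesgue_measure (`]a, b]%classic : set TR)) ->
  measurable_fun (setT : set TR) f ->
  (@lebesgue_measure R).-integrable setT (fun u => (f (phi u))%:E) ->
  (\int[mu]_u f u)%R = (\int[mu]_u f (phi u))%R.
Proof.
move=> mphi hphi mf fi; rewrite /Rintegral; congr fine.
transitivity (\int[pushforward (@lebesgue_measure R) phi]_y (f y)%:E)%E.
  apply: eq_measure_integral => A mA _.
  apply: (@lebesgue_measure_unique R (pushforward (@lebesgue_measure R) phi)) => //.
  by move=> X [[a b] _ <-] /=; rewrite /pushforward hphi.
rewrite integral_pushforward//.
exact: measurableT_comp.
Qed.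

Lemma Rintegral_translate (f : R -> R) (c : R) :
  measurable_fun (setT : set TR) f ->
  (@lebesgue_measure R).-integrable setT (fun u => (f (u + c))%:E) ->
  (\int[mu]_u f u)%R = (\int[mu]_u f (u + c)%R)%R.
Proof.
move=> mf; apply: (@isometry_integral (fun u => u + c)) => //.
  by apply: measurable_funD => //; exact: measurable_id.
move=> a b; rewrite (_ : _ @^-1` _ = `]a - c, b - c]%classic).
  rewrite !lebesgue_measure_itv/= !lte_fin ltrD2r; case: ifP => // _.
  by congr EFin; ring.
apply/seteqP; split=> u /=; rewrite !in_itv/=.
- by rewrite ltrBlDr lerBrDr.
- by rewrite ltrBlDr lerBrDr.
Qed.

Lemma Rintegral_reflect (f : R -> R) (c : R) :
  measurable_fun (setT : set TR) f ->
  (@lebesgue_measure R).-integrable setT (fun u => (f (c - u))%:E) ->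
  (\int[mu]_u f u)%R = (\int[mu]_u f (c - u)%R)%R.
Proof.
move=> mf; apply: (@isometry_integral (fun u => c - u)) => //.
  by apply: measurable_funB => //; exact: measurable_id.
move=> a b; rewrite (_ : _ @^-1` _ = `[c - b, c - a[%classic).
  rewrite !lebesgue_measure_itv/= !lte_fin ltrD2l ltrN2; case: ifP => // _.
  by congr EFin; ring.
apply/seteqP; split=> u /=; rewrite !in_itv/=.
- by move=> /andP[h1 h2]; apply/andP; split; lra.
- by move=> /andP[h1 h2]; apply/andP; split; lra.
Qed.

Lemma Cintegral_translate (f : R -> R[i]) (c : R) : @Cmeasurable R _ TR f ->
  Cintegrable (fun u => f (u + c)) ->
  Cintegral f = Cintegral (fun u => f (u + c)).
Proof.
move=> [f1 f2] [i1 i2]; rewrite /Cintegral.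
by rewrite (Rintegral_translate f1 i1) (Rintegral_translate f2 i2).
Qed.

Lemma Cintegral_reflect (f : R -> R[i]) (c : R) : @Cmeasurable R _ TR f ->
  Cintegrable (fun u => f (c - u)) ->
  Cintegral f = Cintegral (fun u => f (c - u)).
Proof.
move=> [f1 f2] [i1 i2]; rewrite /Cintegral.
by rewrite (Rintegral_reflect f1 i1) (Rintegral_reflect f2 i2).
Qed.

End LebesgueIsometries.

Section TwoSidedExponential.
Context {R : realType}.
Variable b : R.
Hypothesis b_gt0 : 0 < b.

Definition exp_abs (u : R) : R := expR (- (b * `|u|)).

Lemma exp_abs_ge0 u : 0 <= exp_abs u.
Proof. exact: expR_ge0. Qed.

(** The function is even, and on the half-line it is b^-1 times the density of the exponential
    law. *)
Lemma integrable_exp_abs :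
  (@lebesgue_measure R).-integrable setT (fun u => (exp_abs u)%:E).
Proof.
have cexp_abs : continuous exp_abs.
  move=> x; apply: continuous_comp; last exact: continuous_expR.
  by apply: continuousN; apply: cvgMr; exact: norm_continuous.
apply/integrableP; split.
  by apply: measurableT_comp => //; exact: continuous_measurable_fun.
under eq_integral do rewrite gee0_abs ?lee_fin ?exp_abs_ge0//.
rewrite ge0_symfun_integralT//; last 2 first.
- by move=> u; exact: exp_abs_ge0.
- by move=> u /=; rewrite /exp_abs normrN.
rewrite (_ : [set x | 0 <= x] = `[0, +oo[%classic); last first.
  by apply/seteqP; split=> x /=; rewrite in_itv/= andbT.
have iS : (@lebesgue_measure R).-integrable `[0, +oo[
    (fun u => (b^-1 * exponential_pdf b u)%:E).
  apply: (@integrableZl _ _ _ (@lebesgue_measure R) _ _ b^-1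
    (fun u => (exponential_pdf b u)%:E)) => //.
  by apply: integrableS (integrable_exponential_pdf b_gt0).
have -> : (\int[mu]_(u in `[0%R, +oo[) (exp_abs u)%:E =
    \int[mu]_(u in `[0%R, +oo[) (b^-1 * exponential_pdf b u)%:E)%E.
  apply: eq_integral => u u0; rewrite /exponential_pdf patchE u0.
  move: u0; rewrite inE/= in_itv/= andbT => u0.
  by rewrite mulrA mulVf ?lt0r_neq0// mul1r /exp_abs ger0_norm// mulNr.
by rewrite lte_mul_pinfty// integrable_lty.
Qed.

End TwoSidedExponential.

(** * Growth of weights along the Hankel contour *)

Section HankelPath.
Context {R : realType}.
Variable eps : R.
Hypothesis eps_gt0 : 0 < eps.
Local Notation TR := (measurableTypeR R).
Implicit Types u : R.

Let p2 : 0 < 2 * pi :> R.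
Proof. by rewrite mulr_gt0// pi_gt0. Qed.

Lemma hankel_modulus_ge u : eps <= hankel_modulus eps u.
Proof.
by rewrite /hankel_modulus -addrA lerDl addr_ge0// le_max lexx orbT.
Qed.

Lemma hankel_modulus_gt0 u : 0 < hankel_modulus eps u.
Proof. exact: lt_le_trans (hankel_modulus_ge u). Qed.

Lemma hankel_modulus_ge_norm u : `|u| - 2 * pi <= hankel_modulus eps u.
Proof.
rewrite /hankel_modulus; have e0 := eps_gt0; have p0 := p2.
have h1 : - u <= Num.max (- u) 0 by rewrite le_max lexx.
have h2 : u - 2 * pi <= Num.max (u - 2 * pi) 0 by rewrite le_max lexx.
have h3 : 0 <= Num.max (- u) 0 by rewrite le_max lexx orbT.
have h4 : 0 <= Num.max (u - 2 * pi) 0 by rewrite le_max lexx orbT.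
by have [u0|u0] := leP 0 u; rewrite ?(ger0_norm u0) ?(ltr0_norm u0); lra.
Qed.

Lemma hankel_log_top u : u < 0 -> hankel_log eps u = (ln (eps - u))%:C.
Proof.
move=> u0; rewrite /hankel_log /hankel_modulus /hankel_arg.
rewrite (max_r (ltW u0)) (min_l (ltW p2)) max_l ?oppr_ge0 ?ltW//.
rewrite (max_r (_ : u - 2 * pi <= 0)) ?addr0//.
by have := p2 => ?; lra.
Qed.

Lemma hankel_log_circle u : 0 <= u <= 2 * pi -> hankel_log eps u = ln eps +i* u.
Proof.
move=> /andP[u0 u1]; rewrite /hankel_log /hankel_modulus /hankel_arg.
rewrite (max_l u0) (min_l u1) (max_r (_ : - u <= 0)) ?oppr_le0//.
by rewrite (max_r (_ : u - 2 * pi <= 0)) ?subr_le0// !addr0.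
Qed.

Lemma hankel_log_bottom u : 2 * pi < u ->
  hankel_log eps u = ln (eps + (u - 2 * pi)) +i* (2 * pi).
Proof.
move=> u1; have u0 : 0 <= u by have := p2 => ?; lra.
rewrite /hankel_log /hankel_modulus /hankel_arg.
rewrite (max_l u0) (min_r (ltW u1)) (max_r (_ : - u <= 0)) ?oppr_le0//.
by rewrite (max_l (_ : 0 <= u - 2 * pi)) ?subr_ge0 ?addr0// ltW.
Qed.

Lemma hankel_point_top u : u < 0 -> hankel_point eps u = (eps - u)%:C.
Proof.
move=> u0; rewrite /hankel_point hankel_log_top// cexp_real lnK// posrE.
by have := eps_gt0 => ?; lra.
Qed.

Lemma hankel_point_bottom u : 2 * pi < u ->
  hankel_point eps u = (eps + (u - 2 * pi))%:C.
Proof.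
move=> u0; rewrite /hankel_point hankel_log_bottom// /cexp /= mulr_natl.
rewrite cos2pi sin2pi mulr0 mulr1 lnK// posrE.
by have := eps_gt0 => ?; lra.
Qed.

Lemma hankel_point_circle u : 0 <= u <= 2 * pi ->
  hankel_point eps u = (eps * cos u) +i* (eps * sin u).
Proof.
by move=> h; rewrite /hankel_point hankel_log_circle// /cexp /= lnK.
Qed.

Lemma strip_circle (u : R) : strip eps ((eps * cos u) +i* (eps * sin u)).
Proof.
split=> /=.
  by rewrite -mulrN1 ler_wpM2l ?cos_geN1// ltW.
rewrite normrM (gtr0_norm eps_gt0); apply: ler_piMr; first exact: ltW.
by rewrite ler_norml sin_geN1 sin_le1.
Qed.

Lemma strip_hankel_point u : strip eps (hankel_point eps u).
Proof.
have e0 := eps_gt0.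
have [u0|u0] := ltP u 0.
  by rewrite hankel_point_top//; split=> /=; [lra|rewrite normr0 ltW].
have [u1|u1] := leP u (2 * pi).
  rewrite hankel_point_circle ?u0//; exact: strip_circle.
by rewrite hankel_point_bottom//; split=> /=; [lra|rewrite normr0 ltW].
Qed.

(** The loss 2 eps is attained at the leftmost point -eps of the circle, where the modulus is
    eps. *)
Lemma Re_hankel_point_ge u :
  hankel_modulus eps u - 2 * eps <= complex.Re (hankel_point eps u).
Proof.
have e0 := eps_gt0; have p0 := p2.
have [u0|u0] := ltP u 0.
  rewrite hankel_point_top//= /hankel_modulus (max_l (_ : 0 <= - u)); last by lra.
  by rewrite (max_r (_ : u - 2 * pi <= 0)); lra.
have [u1|u1] := leP u (2 * pi).
  rewrite hankel_point_circle ?u0//= /hankel_modulus.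
  rewrite (max_r (_ : - u <= 0)); last by lra.
  rewrite (max_r (_ : u - 2 * pi <= 0)); last by lra.
  have : - eps <= eps * cos u by rewrite -mulrN1 ler_wpM2l ?cos_geN1// ltW.
  by move=> h; lra.
rewrite hankel_point_bottom//= /hankel_modulus (max_r (_ : - u <= 0)); last by lra.
by rewrite (max_l (_ : 0 <= u - 2 * pi)); lra.
Qed.

Lemma Cmeasurable_hankel_log : @Cmeasurable R _ TR (hankel_log eps).
Proof.
have mid : measurable_fun (setT : set TR) (@id R) by exact: measurable_id.
split => /=.
  apply: measurableT_comp => //; rewrite /hankel_modulus.
  apply: measurable_funD.
    apply: measurable_funD => //; apply: measurable_maxr => //.
  by apply: measurable_maxr => //; exact: measurable_funB.
rewrite /hankel_arg; apply: measurable_minr => //; exact: measurable_maxr.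
Qed.

Lemma Cmeasurable_hankel_point : @Cmeasurable R _ TR (hankel_point eps).
Proof. exact: Cmeasurable_cexp Cmeasurable_hankel_log. Qed.

Lemma Cmeasurable_hankel_speed : @Cmeasurable R _ TR (hankel_speed eps).
Proof.
have mid : measurable_fun (setT : set TR) (@id R) by exact: measurable_id.
rewrite /hankel_speed; apply: Cmeasurable_if.
- exact: measurable_fun_ltr.
- exact: Cmeasurable_cst.
apply: Cmeasurable_if.
- exact: measurable_fun_ler.
- apply: CmeasurableM; first exact: Cmeasurable_cst.
  exact: Cmeasurable_hankel_point.
- exact: Cmeasurable_cst.
Qed.

Lemma normc_hankel_speed u : normc (hankel_speed eps u) <= 1 + eps.
Proof.
have e0 := eps_gt0; rewrite /hankel_speed; case: ifPn => [_|].
  by rewrite normcN normc1 lerDl ltW.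
rewrite -leNgt => u0; case: ifPn => u1; last by rewrite normc1 lerDl ltW.
rewrite normcM normc_i mul1r /hankel_point normc_cexp hankel_log_circle ?u0//=.
by rewrite lnK// lerDr.
Qed.

(* Such weights grow at most polynomially in the modulus of the point. *)
Definition log_weight (w : R -> R[i]) :=
  @Cmeasurable R _ TR w /\ exists C a : R, [/\ 0 <= C, 0 <= a &
    forall u, normc (w u) <= C * expR (a * normc (hankel_log eps u))].

Lemma log_weightM w1 w2 : log_weight w1 -> log_weight w2 ->
  log_weight (fun u => w1 u * w2 u).
Proof.
move=> [m1 [C1 [a1 [C10 a10 h1]]]] [m2 [C2 [a2 [C20 a20 h2]]]].
split; first exact: CmeasurableM.
exists (C1 * C2), (a1 + a2); split; rewrite ?mulr_ge0 ?addr_ge0// => u.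
by rewrite normcM mulrDl expRD mulrACA ler_pM ?normc_ge0.
Qed.

Lemma log_weight_cst c : log_weight (fun=> c).
Proof.
split; first exact: Cmeasurable_cst.
exists (normc c), 0; split; rewrite ?normc_ge0// => u.
by rewrite mul0r expR0 mulr1.
Qed.

Lemma log_weight_speed : log_weight (hankel_speed eps).
Proof.
split; first exact: Cmeasurable_hankel_speed.
exists (1 + eps), 0; split=> // [|u]; first by rewrite addr_ge0// ltW.
by rewrite mul0r expR0 mulr1 normc_hankel_speed.
Qed.

Lemma log_weight_log : log_weight (hankel_log eps).
Proof.
split; first exact: Cmeasurable_hankel_log.
exists 1, 1; split=> // u; rewrite !mul1r.
by have := expR_ge1Dx (normc (hankel_log eps u)) => ?; lra.
Qed.

Lemma log_weight_exp_rem k c : log_weight (fun u => exp_rem k (c * hankel_log eps u)).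
Proof.
split.
  apply: Cmeasurable_exp_rem; apply: CmeasurableM; first exact: Cmeasurable_cst.
  exact: Cmeasurable_hankel_log.
exists 1, (normc c); split=> // [|u]; first exact: normc_ge0.
by rewrite mul1r -normcM normc_exp_rem.
Qed.

Lemma log_weight_cexp c : log_weight (fun u => cexp (c * hankel_log eps u)).
Proof.
have := log_weight_exp_rem 0 c; congr log_weight.
by apply/funext => u; rewrite exp_rem0.
Qed.

(** As |ln m| is at most t m plus a constant for every t > 0, t can be chosen so that the weight
    consumes at most half of the rate del. The other half, with the modulus at least |u| - 2 pi,
    gives decay in the parameter. *)
Lemma log_growth_bound (del : R) (f : R -> R) : 0 < del ->
  (exists C a : R, [/\ 0 <= C, 0 <= a &
    forall u, f u <= C * expR (a * normc (hankel_log eps u))]) ->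
  exists C, 0 <= C /\ forall u, f u * expR (- (del * complex.Re (hankel_point eps u))) <=
    C * exp_abs (del / 2) u.
Proof.
move=> del0 [C [a [C0 a0 hw]]].
have e0 := eps_gt0; have p0 := p2.
pose t := del / (2 * (a + 1)).
have a1 : 0 < a + 1 by rewrite ltr_wpDl.
have t0 : 0 < t by rewrite divr_gt0// mulr_gt0.
have hat : a * t <= del / 2.
  rewrite /t mulrA ler_pdivrMr ?mulr_gt0//.
  have -> : del / 2 * (2 * (a + 1)) = a * del + del by field.
  by rewrite lerDl ltW.
pose K := a * (`|ln t| + `|ln eps| + 2 * pi) + 2 * del * eps + del * pi.
exists (C * expR K); split; first by rewrite mulr_ge0 ?expR_ge0.
move=> u; set m := hankel_modulus eps u.
have m0 : 0 < m by exact: hankel_modulus_gt0.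
have lm : `|ln m| <= t * m + `|ln t| + `|ln eps|.
  have tm : 0 < t * m by rewrite mulr_gt0.
  have h1 : ln m + ln t < t * m by rewrite addrC -lnM ?posrE// ln_sublinear.
  have h2 : ln eps <= ln m by rewrite ler_ln ?posrE// hankel_modulus_ge.
  have h3 := ler_norm (- ln t); have h4 := ler_norm (- ln eps).
  rewrite !normrN in h3 h4.
  have h5 := normr_ge0 (ln t); have h6 := normr_ge0 (ln eps).
  by rewrite ler_norml; apply/andP; split; lra.
have lu : normc (hankel_log eps u) <= `|ln m| + 2 * pi.
  apply: (le_trans (normc_le_ReIm _)); rewrite /hankel_log /= lerD2l.
  rewrite ger0_norm /hankel_arg ?ge_min ?lexx ?orbT//.
  by rewrite le_min (ltW p0) andbT le_max lexx orbT.
have rp := Re_hankel_point_ge u; rewrite -/m in rp.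
have mu_ := hankel_modulus_ge_norm u; rewrite -/m in mu_.
rewrite /exp_abs -[leRHS]mulrA -expRD.
apply: (@le_trans _ _ (C * expR (a * normc (hankel_log eps u)) *
   expR (- (del * complex.Re (hankel_point eps u))))).
  by rewrite ler_wpM2r ?expR_ge0.
rewrite -mulrA -expRD ler_wpM2l// ler_expR.
have g1 : a * normc (hankel_log eps u) <=
    del / 2 * m + a * (`|ln t| + `|ln eps| + 2 * pi).
  apply: (@le_trans _ _ (a * (t * m + (`|ln t| + `|ln eps| + 2 * pi)))).
    by apply: ler_wpM2l => //; lra.
  by rewrite mulrDr lerD2r mulrA; apply: ler_wpM2r => //; exact: ltW.
have g2 : del * (m - 2 * eps) <= del * complex.Re (hankel_point eps u).
  by apply: ler_wpM2l => //; exact: ltW.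
have g3 : del / 2 * (`|u| - 2 * pi) <= del / 2 * m.
  by apply: ler_wpM2l => //; rewrite divr_ge0// ltW.
by rewrite /K; lra.
Qed.

Lemma log_weight_bound (del : R) w : 0 < del -> log_weight w -> exists C, 0 <= C /\
  forall u, normc (w u) * expR (- (del * complex.Re (hankel_point eps u))) <=
    C * exp_abs (del / 2) u.
Proof. by move=> del0 [_ /(log_growth_bound del0)]. Qed.

End HankelPath.

(** * A class of functions with continuous complex derivative *)

Section TwiceDifferentiable.
Context {R : realType}.
Implicit Types (f g : R[i] -> R[i]) (z w c : R[i]).

(** The change of radius needs the derivative to be continuous, for differentiating under the
    integral and for the fundamental theorem of calculus. Differentiability of the derivative at z
    gives this and is stable under sums, products and inverses. *)
Definition D2_at f z := exists df : R[i] -> R[i],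
  (\forall w \near z, is_derive (w : R[i]) 1 f (df w)) /\
  exists e : R[i], is_derive z 1 df e.

Lemma D2_derive f z : D2_at f z -> exists e : R[i], is_derive z 1 f e.
Proof. by move=> [df [h _]]; exists (df z); exact: nbhs_singleton h. Qed.

Lemma D2_cst c z : D2_at (fun=> c) z.
Proof.
exists (fun=> 0); split; first by apply: filterE => w; exact: is_derive_cst.
by exists 0; exact: is_derive_cst.
Qed.

Lemma D2N f z : D2_at f z -> D2_at (fun w => - f w) z.
Proof.
move=> [df [h [e he]]]; exists (fun w => - df w); split.
  by apply: filterS h => w; exact: is_deriveN_complex.
by exists (- e); exact: is_deriveN_complex.
Qed.

Lemma D2D f g z : D2_at f z -> D2_at g z -> D2_at (fun w => f w + g w) z.
Proof.
move=> [df [h [e he]]] [dg [k [e' he']]]; exists (fun w => df w + dg w); split.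
  by apply: filterS2 h k => w; exact: is_deriveD_complex.
by exists (e + e'); exact: is_deriveD_complex.
Qed.

Lemma D2M f g z : D2_at f z -> D2_at g z -> D2_at (fun w => f w * g w) z.
Proof.
move=> [df [h [e he]]] [dg [k [e' he']]].
exists (fun w => df w * g w + f w * dg w); split.
  by apply: filterS2 h k => w; exact: is_deriveM_complex.
have hz := nbhs_singleton h; have kz := nbhs_singleton k.
eexists; exact: (is_deriveD_complex (is_deriveM_complex he kz)
  (is_deriveM_complex hz he')).
Qed.

Lemma D2V f z : f z != 0 -> D2_at f z -> D2_at (fun w => (f w)^-1) z.
Proof.
move=> fz [df [h [e he]]]; exists (fun w => - df w / f w ^+ 2).
have hz := nbhs_singleton h.
have fn : \forall w \near z, f w != 0.
  by apply: derivable_near_neq0 => //; case: hz.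
split.
  near=> w; apply: is_deriveV_complex; first by near: w.
  by near: w.
have f2 : is_derive z 1 (fun w => f w ^+ 2) (df z * f z + f z * df z).
  by under eq_fun do rewrite expr2; exact: is_deriveM_complex.
have f20 : f z ^+ 2 != 0 by rewrite expf_neq0.
eexists; exact: (is_deriveM_complex (is_deriveN_complex he)
  (@is_deriveV_complex _ (fun w => f w ^+ 2) _ _ f20 f2)).
Unshelve. all: by end_near. Qed.

Lemma D2_exp_rem k c z : D2_at (fun w => exp_rem k (c * w)) z.
Proof.
have er j w := is_derive_scale_complex (is_derive_exp_rem j (c * w)).
exists (fun w => (exp_rem k (c * w) - k%:R * exp_rem k.+1 (c * w)) * c); split.
  by apply: filterE => w; exact: er.
eexists; exact: (is_deriveM_complex (is_deriveD_complex (er k z)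
  (is_deriveN_complex (is_deriveZ_complex _ (er k.+1 z)))) (is_derive_cst c z 1)).
Qed.

Lemma is_derive_translate_complex f z c d : is_derive (z + c) 1 f d ->
  is_derive z 1 (fun w => f (w + c)) d.
Proof.
move=> h; rewrite -[d]mulr1 -[X in d * X]addr0.
have hc := is_deriveD_complex (is_derive_id z 1) (is_derive_cst c z 1).
exact: (@is_derive_comp_complex _ (fun w => w + c) f z _ _ hc h).
Qed.

Lemma D2_translate f c z : D2_at f (z + c) -> D2_at (fun w => f (w + c)) z.
Proof.
move=> [df [h [e he]]]; exists (fun w => df (w + c)); split.
  move/near_normcP : h => [r r0 h]; apply/near_normcP; exists r => // w wz.
  apply: is_derive_translate_complex; apply: h.
  by rewrite opprD addrACA subrr addr0.
by exists e; exact: is_derive_translate_complex.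
Qed.

Lemma D2_prod (J : Type) (s : seq J) (P : pred J) (F : J -> R[i] -> R[i]) z :
  (forall j, P j -> D2_at (F j) z) -> D2_at (fun w => \prod_(j <- s | P j) F j w) z.
Proof.
move=> hF; elim: s => [|j s IH].
  by under eq_fun do rewrite big_nil; exact: D2_cst.
have [Pj|/negbTE Pj] := boolP (P j); under eq_fun do rewrite big_cons Pj; last by [].
by apply: D2M => //; exact: hF.
Qed.

Lemma D2_desing_kernel c z : exp_rem 1 (c * z) != 0 -> D2_at (desing_kernel c 1) z.
Proof.
move=> h; have -> : desing_kernel c 1 = (fun w =>
    - (exp_rem 1 (c * w) + - exp_rem 2 (c * w)) *
    (exp_rem 1 (c * w) * exp_rem 1 (c * w))^-1).
  apply/funext => w.
  by rewrite /desing_kernel subrr rmorph0 mul0r addr0 rmorph1 !mul1r.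
apply: D2M.
  by apply: D2N; apply: D2D; [|apply: D2N]; exact: D2_exp_rem.
apply: (@D2V (fun w => exp_rem 1 (c * w) * exp_rem 1 (c * w))).
  by rewrite mulf_neq0.
by apply: D2M; exact: D2_exp_rem.
Qed.

Lemma D2_near f z : D2_at f z -> (\forall w \near z, is_derive (w : R[i]) 1 f ('D_1 f w)) /\
  'D_1 f w @[w --> z] --> 'D_1 f z.
Proof.
move=> [df [h [e he]]].
have h' : \forall w \near z, df w = 'D_1 f w by apply: filterS h => w [].
split; first by apply: filterS2 h h' => w + <-.
rewrite -(nbhs_singleton h'); apply: cvg_trans (is_derive_cvg he).
exact: (@near_eq_cvg _ _ (nbhs z) _ df ('D_1 f) h').
Qed.

End TwiceDifferentiable.

Section CurveChainRule.
Context {R : realType}.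

Lemma is_derive_realP (f : R -> R) (t d : R) : is_derive t 1 f d <->
  (forall e : R, 0 < e -> exists2 rho : R, 0 < rho &
     forall h, `|h| < rho -> `|f (t + h) - f t - d * h| <= e * `|h|).
Proof.
have E h : h != 0 -> d - h^-1 *: ((f \o shift t) (h *: 1) - f t) =
    - (h^-1 * (f (t + h) - f t - d * h)).
  move=> h0; rewrite /= /GRing.scale /= mulr1 (addrC h t) [in RHS]mulrBr opprB.
  by congr (_ - _); rewrite mulrCA mulVf// mulr1.
split=> [[/cvg_ex[l fl] fd]|H].
  have ld : l = d by rewrite -fd; apply/esym; exact: cvg_lim.
  rewrite ld in fl; move/cvgrPdist_lt : fl => fl e /fl.
  rewrite near_withinE => /nbhs_ballP[rho /= rho0 H]; exists rho => // h hrho.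
  have [->|h0] := eqVneq h 0.
    by rewrite addr0 subrr mulr0 subr0 normr0 mulr0.
  have := H h; rewrite /ball /= sub0r normrN => /(_ hrho h0).
  rewrite E// normrN normrM normfV.
  by rewrite mulrC ltr_pdivrMr ?normr_gt0// => /ltW.
suff fl : h^-1 *: ((f \o shift t) (h *: 1) - f t) @[h --> 0^'] --> d.
  by apply: DeriveDef; [apply/cvg_ex; exists d|exact: cvg_lim].
apply/cvgrPdist_lt => e e0; rewrite near_withinE; apply/nbhs_ballP.
have [|rho rho0 {}H] := H (e / 2); first by rewrite divr_gt0.
exists rho => //= h; rewrite /ball /= sub0r normrN => hrho h0.
rewrite E// normrN normrM normfV mulrC ltr_pdivrMr ?normr_gt0//.
apply: le_lt_trans (H _ hrho) _; rewrite ltr_pM2r ?normr_gt0//.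
by rewrite gtr_pMr// invf_lt1// ltr1n.
Qed.

Lemma is_derive_curveP (f : R -> R[i]) (t : R) (d : R[i]) :
  is_derive_curve f t d <->
  (forall e : R, 0 < e -> exists2 rho : R, 0 < rho &
     forall h, `|h| < rho -> normc (f (t + h) - f t - d * h%:C) <= e * `|h|).
Proof.
have ER h : complex.Re (f (t + h) - f t - d * h%:C) =
    complex.Re (f (t + h)) - complex.Re (f t) - complex.Re d * h.
  by rewrite !(ReD, ReN, ReM) /= mulr0 subr0.
have EI h : complex.Im (f (t + h) - f t - d * h%:C) =
    complex.Im (f (t + h)) - complex.Im (f t) - complex.Im d * h.
  by rewrite !(ImD, ImN, ImM) /= mulr0 add0r.
split=> [[/is_derive_realP HR /is_derive_realP HI] e e0|H].
  have e20 : 0 < e / 2 by rewrite divr_gt0.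
  have [r1 r10 {}HR] := HR _ e20; have [r2 r20 {}HI] := HI _ e20.
  exists (Num.min r1 r2); first by rewrite lt_min r10.
  move=> h; rewrite lt_min => /andP[h1 h2].
  apply: (le_trans (normc_le_ReIm _)); rewrite (splitr e) mulrDl; apply: lerD.
  - by rewrite ER; exact: HR.
  - by rewrite EI; exact: HI.
split; apply/is_derive_realP => e /H[r r0 {}H]; exists r => // h /H.
- by rewrite -ER; apply: le_trans; exact: Re_le_normc.
- by rewrite -EI; apply: le_trans; exact: Im_le_normc.
Qed.

Lemma is_derive_curve_comp (f : R -> R[i]) (g : R[i] -> R[i]) (t : R) (a b : R[i]) :
  is_derive_curve f t a -> is_derive (f t) 1 g b ->
  is_derive_curve (fun u => g (f u)) t (b * a).
Proof.
move=> /is_derive_curveP Hf /is_derive_normcP Hg.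
apply/is_derive_curveP => e e0.
set A := normc a + 1; set B := normc b + 1.
have A0 : 0 < A by rewrite ltr_wpDl ?normc_ge0.
have B0 : 0 < B by rewrite ltr_wpDl ?normc_ge0.
have [|r1 r10 {}Hg] := Hg (e / 2 / A); first by rewrite !divr_gt0.
have [|r2 r20 {}Hf] := Hf (Num.min 1 (e / 2 / B)).
  by rewrite lt_min ltr01 !divr_gt0.
exists (Num.min r2 (r1 / A)); first by rewrite lt_min r20 divr_gt0.
move=> h; rewrite lt_min => /andP[h2 h1].
set k := f (t + h) - f t.
have k' : normc (k - a * h%:C) <= Num.min 1 (e / 2 / B) * `|h| by exact: Hf.
have kh : normc k <= A * `|h|.
  rewrite -(subrK (a * h%:C) k); apply: le_trans (normcD _ _) _.
  rewrite normcM normc_real /A mulrDl addrC lerD2l (le_trans k')//.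
  by rewrite ler_wpM2r// ge_min lexx.
have kr1 : normc k < r1 by rewrite (le_lt_trans kh)// mulrC -ltr_pdivlMr.
have -> : g (f (t + h)) - g (f t) - b * a * h%:C =
    (g (f t + k) - g (f t) - b * k) + b * (k - a * h%:C).
  by rewrite /k (addrC (f t)) subrK; ring.
apply: le_trans (normcD _ _) _; rewrite normcM (splitr e) mulrDl lerD//.
  apply: le_trans (Hg _ kr1) _.
  apply: (@le_trans _ _ (e / 2 / A * (A * `|h|))).
    by rewrite ler_wpM2l// !divr_ge0// ltW.
  by rewrite mulrA mulfVK// lt0r_neq0.
apply: (@le_trans _ _ (B * (e / 2 / B * `|h|))).
  rewrite ler_pM ?normc_ge0 ?lerDl// (le_trans k')//.
  by rewrite ler_wpM2r// ge_min lexx orbT.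
by rewrite mulrA mulrCA mulfV ?lt0r_neq0// mulr1.
Qed.

Lemma bounded_on_square (f : R[i] -> R[i]) (v : R) : 0 <= v ->
  (forall x y, `|x| <= v -> `|y| <= v -> f w @[w --> x +i* y] --> f (x +i* y)) ->
  exists M : R, forall x y, `|x| <= v -> `|y| <= v -> normc (f (x +i* y)) <= M.
Proof.
move=> v0 fc.
pose A : set (R * R) := `[- v, v]%classic `*` `[- v, v]%classic.
pose g (z : R * R) := normc (f (z.1 +i* z.2)).
have AP z : A z <-> `|z.1| <= v /\ `|z.2| <= v.
  rewrite /A /= !in_itv/= !ler_norml; exact: iff_refl.
have cA : compact A by apply: compact_setX; exact: segment_compact.
have A0 : A !=set0 by exists (0, 0); apply/AP; rewrite normr0.
have [|z _ hz] := @compact_EVT_max _ R g A A0 cA.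
  apply/subspace_continuousP => z /AP[z1 z2].
  apply: cvg_within_filter.
  have h1 : (w.1 +i* w.2) @[w --> z] --> z.1 +i* z.2.
    by apply: cvg_complex => /=; [exact: cvg_fst|exact: cvg_snd].
  have h2 : f (w.1 +i* w.2) @[w --> z] --> f (z.1 +i* z.2).
    exact: (@cvg_comp _ _ _ (fun w : R * R => w.1 +i* w.2) f _ _ _ h1 (fc _ _ z1 z2)).
  apply/cvgrPdist_lt => e e0; move/cvg_normcP : h2 => /(_ e e0).
  apply: filterS => w; apply: le_lt_trans; rewrite /g.
  have a := normcBl (f (z.1 +i* z.2)) (f (w.1 +i* w.2)).
  have b := normcBl (f (w.1 +i* w.2)) (f (z.1 +i* z.2)).
  rewrite normc_distC in b.
  by rewrite ler_norml; apply/andP; split; [rewrite lerNl opprB|].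
exists (g z) => x y hx hy; apply: (hz (x, y)); rewrite inE; exact/AP.
Qed.

End CurveChainRule.

(** * Independence of the radius and vanishing at positive integers *)

Section ContourShift.
Context {R : realType}.
Variables (q : R[i] -> R[i]) (rho : R) (s : R[i]).
Hypothesis rho_gt0 : 0 < rho.
Hypothesis qD2 : forall w, strip rho w -> D2_at q w.
Local Notation TR := (measurableTypeR R).
Implicit Types (t y u v : R) (L w : R[i]).

Let p2 : 0 < 2 * pi :> R.
Proof. by rewrite mulr_gt0// pi_gt0. Qed.

(* The integrand in the logarithmic coordinate. *)
Let Q L := q (cexp L) * cexp (s * L).
Let QD L := 'D_1 q (cexp L) * cexp L * cexp (s * L) +
  q (cexp L) * (cexp (s * L) * s).
Let Lg t y : R[i] := ln t +i* y.

Let is_derive_Q L : strip rho (cexp L) -> is_derive L 1 Q (QD L).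
Proof.
move=> sL; have [h _] := D2_near (qD2 sL).
apply: is_deriveM_complex.
  exact: is_derive_comp_complex (is_derive_cexp L) (nbhs_singleton h).
exact: is_derive_scale_complex (is_derive_cexp (s * L)).
Qed.

Let cexp_Lg t y : 0 < t -> cexp (Lg t y) = (t * cos y) +i* (t * sin y).
Proof. by move=> t0; rewrite /cexp /= lnK. Qed.

Let strip_le (a b : R) w : a <= b -> strip a w -> strip b w.
Proof.
move=> ab [h1 h2]; split; last exact: le_trans ab.
by apply: le_trans h1; rewrite lerN2.
Qed.

Let strip_Lg t y : 0 < t -> t <= rho -> strip rho (cexp (Lg t y)).
Proof.
by move=> t0 tr; rewrite cexp_Lg//; apply: strip_le tr _; exact: strip_circle.
Qed.

Let curve_t t y : 0 < t -> is_derive_curve (fun t => Lg t y) t (t^-1)%:C.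
Proof. by move=> t0; split => /=; [exact: is_derive1_ln|exact: is_derive_cst]. Qed.

Let curve_y t y : is_derive_curve (Lg t) y 'i%C.
Proof. by split => /=; [exact: is_derive_cst|exact: is_derive_id]. Qed.

Let Q_t t y : 0 < t -> t <= rho ->
  is_derive_curve (fun t => Q (Lg t y)) t (QD (Lg t y) * (t^-1)%:C).
Proof.
move=> t0 tr; apply: is_derive_curve_comp (curve_t y t0) _.
by apply: is_derive_Q; exact: strip_Lg.
Qed.

Let Q_y t y : 0 < t -> t <= rho ->
  is_derive_curve (fun y => Q (Lg t y)) y (QD (Lg t y) * 'i%C).
Proof.
move=> t0 tr; apply: is_derive_curve_comp (curve_y t y) _.
by apply: is_derive_Q; exact: strip_Lg.
Qed.

Let QD_bound u v : 0 < u -> v <= rho -> exists2 M, 0 <= M &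
  forall t y, u <= t <= v -> 0 <= y <= 2 * pi -> normc (QD (Lg t y)) <= M.
Proof.
move=> u0 vr.
have in_strip x y : `|x| <= rho -> `|y| <= rho -> strip rho (x +i* y).
  by move=> hx hy; split=> //=; move: hx; rewrite ler_norml => /andP[].
have [M1 h1] := @bounded_on_square _ q rho (ltW rho_gt0)
  (fun x y hx hy => let: ex_intro _ h := D2_derive (qD2 (in_strip x y hx hy)) in
     is_derive_cvg h).
have [M2 h2] := @bounded_on_square _ ('D_1 q) rho (ltW rho_gt0)
  (fun x y hx hy => (D2_near (qD2 (in_strip x y hx hy))).2).
have M10 : 0 <= M1.
  by apply: le_trans (h1 0 0 _ _); rewrite ?normc_ge0 ?normr0 ?ltW.
have M20 : 0 <= M2.
  by apply: le_trans (h2 0 0 _ _); rewrite ?normc_ge0 ?normr0 ?ltW.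
pose E := expR (normc s * (`|ln u| + `|ln v| + 2 * pi)).
exists (M2 * rho * E + M1 * (E * normc s)).
  by rewrite addr_ge0// !mulr_ge0 ?expR_ge0 ?normc_ge0// ltW.
move=> t y /andP[ut tv] /andP[y0 y1].
have t0 : 0 < t by exact: lt_le_trans ut.
have tr : t <= rho by exact: le_trans vr.
have hc : `|t * cos y| <= rho.
  rewrite normrM gtr0_norm// (le_trans _ tr)// ler_piMr ?(ltW t0)//.
  by rewrite ler_norml cos_geN1 cos_le1.
have hs : `|t * sin y| <= rho.
  rewrite normrM gtr0_norm// (le_trans _ tr)// ler_piMr ?(ltW t0)//.
  by rewrite ler_norml sin_geN1 sin_le1.
have hE : normc (cexp (s * Lg t y)) <= E.
  rewrite -exp_rem0 (le_trans (normc_exp_rem _ _))// ler_expR normcM.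
  apply: ler_wpM2l; first exact: normc_ge0.
  apply: (le_trans (normc_le_ReIm _)) => /=; apply: lerD; last by rewrite ger0_norm.
  have l1 : ln u <= ln t by rewrite ler_ln ?posrE.
  have l2 : ln t <= ln v by rewrite ler_ln ?posrE// (lt_le_trans t0).
  have a1 := ler_norm (ln v); have a2 := ler_norm (- ln u); rewrite normrN in a2.
  have a3 := normr_ge0 (ln u); have a4 := normr_ge0 (ln v).
  by rewrite ler_norml; apply/andP; split; lra.
have hL : normc (cexp (Lg t y)) <= rho.
  by rewrite normc_cexp /= lnK.
rewrite /QD (le_trans (normcD _ _))// lerD//.
  rewrite !normcM; apply: ler_pM => //; rewrite ?mulr_ge0 ?normc_ge0//.
  apply: ler_pM => //; rewrite ?normc_ge0//.
  by rewrite cexp_Lg//; exact: h2.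
rewrite !normcM; apply: ler_pM => //; rewrite ?mulr_ge0 ?normc_ge0//.
  by rewrite cexp_Lg//; exact: h1.
by apply: ler_wpM2r; rewrite ?normc_ge0.
Qed.

Let continuous_QD t y : 0 < t -> t <= rho -> QD (Lg t z) @[z --> y] --> QD (Lg t y).
Proof.
move=> t0 tr; have sL := strip_Lg y t0 tr.
have [_ h2] := D2_near (qD2 sL).
have [e he] := D2_derive (qD2 sL).
have h1 := is_derive_cvg he.
have cL : Lg t z @[z --> y] --> Lg t y.
  by apply: cvg_complex => /=; [exact: cvg_cst|exact: cvg_id].
have c1 : cexp (Lg t z) @[z --> y] --> cexp (Lg t y).
  exact: (@cvg_comp _ _ _ (Lg t) (@cexp R) _ _ _ cL (is_derive_cvg (is_derive_cexp _))).
have c2 : cexp (s * Lg t z) @[z --> y] --> cexp (s * Lg t y).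
  exact: (@cvg_comp _ _ _ (Lg t) (fun w => cexp (s * w)) _ _ _ cL
    (is_derive_cvg (is_derive_scale_complex (is_derive_cexp _)))).
have c3 : q (cexp (Lg t z)) @[z --> y] --> q (cexp (Lg t y)).
  exact: (@cvg_comp _ _ _ (fun z => cexp (Lg t z)) q _ _ _ c1 h1).
have c4 : 'D_1 q (cexp (Lg t z)) @[z --> y] --> 'D_1 q (cexp (Lg t y)).
  exact: (@cvg_comp _ _ _ (fun z => cexp (Lg t z)) ('D_1 q) _ _ _ c1 h2).
have c5 : 'D_1 q (cexp (Lg t z)) * cexp (Lg t z) @[z --> y] -->
    'D_1 q (cexp (Lg t y)) * cexp (Lg t y) by apply: cvgM c4 c1.
have c6 : 'D_1 q (cexp (Lg t z)) * cexp (Lg t z) * cexp (s * Lg t z) @[z --> y] -->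
    'D_1 q (cexp (Lg t y)) * cexp (Lg t y) * cexp (s * Lg t y) by apply: cvgM c5 c2.
have c7 : cexp (s * Lg t z) * s @[z --> y] --> cexp (s * Lg t y) * s.
  by apply: cvgM c2 _; exact: cvg_cst.
have c8 : q (cexp (Lg t z)) * (cexp (s * Lg t z) * s) @[z --> y] -->
   q (cexp (Lg t y)) * (cexp (s * Lg t y) * s) by apply: cvgM c3 c7.
by apply: cvgD c6 c8.
Qed.

(** Since [Q] carries t^s and dt / t is the differential of the logarithm, this is the integrand of
    the outgoing bottom side plus that of the incoming top side, at modulus t. *)
Let Delta t := (t^-1)%:C * (Q (Lg t (2 * pi)) - Q (Lg t 0)).

(** Calculus is done on real integrals; quantifying over the projection treats real and imaginary
    parts at once. *)
Let is_projection (prj : R[i] -> R) := prj = @complex.Re R \/ prj = @complex.Im R.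

Let circle_part prj t := (\int[mu]_(y in `[0, 2 * pi]) prj (Q (Lg t y) * 'i%C))%R.

Let prjP prj : is_projection prj ->
  [/\ forall z, `|prj z| <= normc z,
      forall f t d, is_derive_curve f t d -> is_derive t 1 (prj \o f) (prj d),
      forall (F : set_system R) (FF : Filter F) (f : R -> R[i]) (l : R[i]),
        f x @[x --> F] --> l -> prj (f x) @[x --> F] --> prj l &
      forall z w, prj (z - w) = prj z - prj w].
Proof.
move=> [->|->]; split.
- exact: Re_le_normc.
- by move=> f t d [].
- by move=> F FF f l; exact: cvg_Re.
- by move=> z w; rewrite ReD ReN.
- exact: Im_le_normc.
- by move=> f t d [].
- by move=> F FF f l; exact: cvg_Im.
- by move=> z w; rewrite ImD ImN.
Qed.

Let FTC (F f : R -> R) (a b : R) : a < b ->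
  (forall x, a <= x <= b -> is_derive x 1 F (f x)) ->
  (forall x, a <= x <= b -> {for x, continuous f}) ->
  (\int[mu]_(x in `[a, b]) f x)%R = F b - F a.
Proof.
move=> ab dF cf.
have cF x : a <= x <= b -> {for x, continuous F}.
  by move=> /dF[h _]; apply: differentiable_continuous; apply/derivable1_diffP.
rewrite /Rintegral (@continuous_FTC2 _ f F)//.
- apply: continuous_in_subspaceT => x; rewrite inE/= in_itv/=; exact: cf.
- split.
  + move=> x; rewrite in_itv/= => /andP[/ltW h1 /ltW h2].
    by have [] := dF x _; rewrite ?h1.
  + by apply: cvg_at_right_filter; apply: cF; rewrite lexx ltW.
  + by apply: cvg_at_left_filter; apply: cF; rewrite lexx ltW.
- move=> x; rewrite in_itv/= => /andP[/ltW h1 /ltW h2].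
  by rewrite derive1E; have [] := dF x _; rewrite ?h1.
Qed.

(** By holomorphy of [Q], the derivatives of Q (ln t + i y) in t and in y are [QD] times 1 / t and
    times i. After differentiating under the integral, the integrand is thus the y-derivative of Q /
    t, and it integrates to [Delta t]. This is Cauchy's theorem for an annulus cut along the
    half-line. *)
Let is_derive_circle_part prj t : is_projection prj -> 0 < t -> t < rho ->
  is_derive t 1 (circle_part prj) (prj (Delta t)).
Proof.
move=> hp t0 tr; have [p_le p_der p_cvg p_B] := prjP hp.
pose f t y := prj (Q (Lg t y) * 'i%C).
(* The interval [u, v] stays away from 0 and below rho, so [QD] is bounded there uniformly in y;
   this is the domination required. *)
pose u := t / 2; pose v := (t + rho) / 2.
have u0 : 0 < u by rewrite divr_gt0.
have ut : u < t by rewrite /u; lra.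
have tv : t < v by rewrite /v; lra.
have vr : v <= rho by rewrite /v; lra.
have It : (`]u, v[%classic : set R) t by rewrite /= in_itv/= ut tv.
have fd x y : 0 < x -> x <= rho ->
    is_derive x 1 (f ^~ y) (prj (QD (Lg x y) * (x^-1)%:C * 'i%C)).
  move=> x0 xr.
  have := is_derive_curveM (Q_t y x0 xr) (is_derive_curve_cst 'i%C x).
  by rewrite mulr0 addr0 => /p_der.
have fdy x y : 0 < x -> x <= rho -> {for y, continuous (f x)}.
  move=> x0 xr.
  have := is_derive_curveM (Q_y y x0 xr) (is_derive_curve_cst 'i%C y).
  by move=> /p_der[h _]; apply: differentiable_continuous; apply/derivable1_diffP.
have inI x : (`]u, v[%classic : set R) x -> u <= x <= v /\ 0 < x /\ x <= rho.
  rewrite /= in_itv/= => /andP[h1 h2]; split; first by rewrite !ltW.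
  by split; [exact: lt_trans h1|rewrite ltW// (lt_le_trans h2)].
have [M M0 hM] := QD_bound u0 vr.
have intf x : (`]u, v[%classic : set R) x ->
    (@lebesgue_measure R).-integrable `[0, 2 * pi] (EFin \o f x).
  move=> /inI[_ [x0 xr]]; apply: continuous_compact_integrable.
    exact: segment_compact.
  by apply: continuous_in_subspaceT => y _; exact: fdy.
have derf1 x y : (`]u, v[%classic : set R) x -> `[0, 2 * pi]%classic y ->
    derivable (f ^~ y) x 1.
  by move=> /inI[_ [x0 xr]] _; have [] := fd x y x0 xr.
have G_ub x y : (`]u, v[%classic : set R) x -> `[0, 2 * pi]%classic y ->
    `|partial1of2 f x y| <= M / u.
  move=> /inI[xuv [x0 xr]]; rewrite /= in_itv/= => hy.
  rewrite partial1of2E; have [_ ->] := fd x y x0 xr.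
  rewrite (le_trans (p_le _))// !normcM normc_i mulr1 normc_real.
  rewrite ler_pM ?normc_ge0//; first exact: hM.
  rewrite gtr0_norm ?invr_gt0// lef_pV2 ?posrE//.
  by case/andP: xuv.
have intG : (@lebesgue_measure R).-integrable `[0, 2 * pi]
    (EFin \o (fun _ : R => M / u)).
  apply: continuous_compact_integrable; first exact: segment_compact.
  by apply: continuous_subspaceT => y; exact: cvg_cst.
have mI : measurable (`[0, 2 * pi]%classic : set TR) by exact: measurable_itv.
have G0 (y : TR) : 0 <= (fun _ : R => M / u) y by rewrite divr_ge0// ltW.
have der : derivable (circle_part prj) t 1.
  exact: (@derivable_under_integral R _ TR (@lebesgue_measure R) f _ mI
    t u v It intf derf1 (fun=> M / u) G0 intG G_ub).
have val := @differentiation_under_integral R _ TR (@lebesgue_measure R) f _ mI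
    t u v It intf derf1 (fun=> M / u) G0 intG G_ub.
apply: DeriveDef => //; rewrite -derive1E.
transitivity (\int[mu]_(y in `[0, 2 * pi]) prj (QD (Lg t y) * (t^-1)%:C * 'i%C))%R.
  rewrite [LHS]val; apply: eq_Rintegral => y _.
  by rewrite partial1of2E; have [_ ->] := fd t y t0 (ltW tr).
have hd y : is_derive y 1 (fun y => prj (Q (Lg t y) * (t^-1)%:C))
    (prj (QD (Lg t y) * (t^-1)%:C * 'i%C)).
  have := is_derive_curveM (Q_y y t0 (ltW tr)) (is_derive_curve_cst (t^-1)%:C y).
  by rewrite mulr0 addr0 mulrAC => /p_der.
have hc y : {for y, continuous (fun y => prj (QD (Lg t y) * (t^-1)%:C * 'i%C))}.
  apply: p_cvg; have c1 := continuous_QD (y := y) t0 (ltW tr).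
  have c2 : QD (Lg t z) * (t^-1)%:C @[z --> y] --> QD (Lg t y) * (t^-1)%:C.
    by apply: cvgM c1 _; exact: cvg_cst.
  by apply: cvgM c2 _; exact: cvg_cst.
rewrite (FTC p2 (fun y _ => hd y) (fun y _ => hc y)).
by rewrite -p_B -mulrBl mulrC.
Qed.

Let continuous_Delta prj t : is_projection prj -> 0 < t -> t < rho ->
  {for t, continuous (prj \o Delta)}.
Proof.
move=> hp t0 tr; have [_ p_der _ _] := prjP hp.
have ti : is_derive_curve (fun t => (t^-1)%:C) t (- (t ^+ 2)^-1)%:C.
  split=> /=; last exact: is_derive_cst.
  have := @is_deriveV R id t 1 1 (lt0r_neq0 t0) (is_derive_id t 1).
  by rewrite /GRing.scale /= mulr1.
have hQ := is_derive_curveD (Q_t (2 * pi) t0 (ltW tr))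
  (is_derive_curveN (Q_t 0 t0 (ltW tr))).
have [h _] := p_der _ _ _ (is_derive_curveM ti hQ).
by apply: differentiable_continuous; apply/derivable1_diffP.
Qed.

Let circle_partB prj (a b : R) : is_projection prj -> 0 < a -> a < b -> b < rho ->
  (\int[mu]_(t in `[a, b]) prj (Delta t))%R = circle_part prj b - circle_part prj a.
Proof.
move=> hp a0 ab br; apply: FTC => // t /andP[h1 h2].
- by apply: is_derive_circle_part => //; [exact: lt_le_trans h1|exact: le_lt_trans br].
- by apply: continuous_Delta => //; [exact: lt_le_trans h1|exact: le_lt_trans br].
Qed.

Definition hankel_weight (e : R) u :=
  cexp ((s - 1) * hankel_log e u) * hankel_speed e u.

Let Phi e u := q (hankel_point e u) * hankel_weight e u.

Hypothesis mq : forall d (T : measurableType d) (g : T -> R[i]),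
  Cmeasurable g -> Cmeasurable (fun x => q (g x)).

Variables (M del : R).
Hypothesis del_gt0 : 0 < del.
Hypothesis qM : forall w, strip rho w -> normc (q w) <= M * expR (- (del * complex.Re w)).

Let M_ge0 : 0 <= M.
Proof.
have h : strip rho 0 by split=> /=; rewrite ?normr0 ?oppr_le0 ltW.
by have := le_trans (normc_ge0 _) (qM h); rewrite /= mulr0 oppr0 expR0 mulr1.
Qed.

Let mPhi e : 0 < e -> @Cmeasurable R _ TR (Phi e).
Proof.
move=> e0; apply: CmeasurableM; first by apply: mq; exact: Cmeasurable_hankel_point.
apply: CmeasurableM; last exact: Cmeasurable_hankel_speed.
exact: (log_weight_cexp e _).1.
Qed.

Let Phi_bound e : 0 < e -> e < rho -> exists C, 0 <= C /\
  forall u, normc (Phi e u) <= C * exp_abs (del / 2) u.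
Proof.
move=> e0 er.
have [C [C0 hC]] := log_weight_bound e0 del_gt0
  (log_weightM (log_weight_cexp e (s - 1)) (log_weight_speed e0)).
exists (M * C); split; first exact: mulr_ge0.
move=> u; have sp := strip_le (ltW er) (strip_hankel_point e0 u).
rewrite /Phi normcM; apply: (@le_trans _ _
  (M * (normc (hankel_weight e u) * expR (- (del * complex.Re (hankel_point e u)))))).
  rewrite [X in _ <= M * X]mulrC mulrA; apply: ler_wpM2r; first exact: normc_ge0.
  exact: qM.
by rewrite -mulrA; apply: ler_wpM2l => //; exact: hC.
Qed.

Let del2 : 0 < del / 2. Proof. by rewrite divr_gt0. Qed.

Let dom_int := @dom_Cintegrable R (exp_abs (del / 2))
  (integrable_exp_abs del2).

(* tail gathers both sides of the real axis, parametrized by the modulus t. *)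
Let tail e t : R[i] := if e < t then Delta t else 0.
Let circ e u : R[i] := if (0 <= u) && (u <= 2 * pi) then Phi e u else 0.

Let mif (c1 : TR -> bool) (f : TR -> R[i]) : measurable_fun setT c1 ->
  Cmeasurable f -> @Cmeasurable R _ TR (fun u => if c1 u then f u else 0).
Proof. by move=> h1 h2; apply: Cmeasurable_if => //; exact: Cmeasurable_cst. Qed.

Let mlt (a : R) : measurable_fun (setT : set TR) (fun u : TR => (u < a)%R).
Proof. exact: measurable_fun_ltr. Qed.

Let mgt (a : R) : measurable_fun (setT : set TR) (fun u : TR => (a < u)%R).
Proof. exact: measurable_fun_ltr. Qed.

Let mitv : measurable_fun (setT : set TR) (fun u : TR => (0 <= u) && (u <= 2 * pi)).
Proof. by apply: measurable_and; exact: measurable_fun_ler. Qed.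

(** Translating or reflecting the parameter costs only a constant factor in the majorant, so
    integrability survives the reparametrizations by the modulus. *)
Let exp_abs_shift (a u v : R) : `|u| <= `|v| + a ->
  exp_abs (del / 2) v <= expR (del / 2 * a) * exp_abs (del / 2) u.
Proof.
move=> h; rewrite /exp_abs -expRD ler_expR.
have := ler_wpM2l (ltW del2) h; rewrite mulrDr => h'; lra.
Qed.

(** The top side is reparametrized by t = e - u and the bottom side by t = e + u - 2 pi, so that
    both become integrals over t > e and can be added pointwise. *)
Let contour_split e : 0 < e -> e < rho ->
  [/\ Cintegrable (tail e), Cintegrable (circ e) &
   Cintegral (Phi e) = Cintegral (tail e) + Cintegral (circ e)].
Proof.
move=> e0 er; have [C [C0 hC]] := Phi_bound e0 er; have mP := mPhi e0.
pose top u : R[i] := if u < 0 then Phi e u else 0.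
pose bot u : R[i] := if 2 * pi < u then Phi e u else 0.
have cb (b : R -> bool) u : normc (if b u then Phi e u else 0) <= C * exp_abs (del / 2) u.
  by case: ifP => // _; rewrite normc0 mulr_ge0 ?exp_abs_ge0.
have mtop : @Cmeasurable R _ TR top by exact: mif.
have mbot : @Cmeasurable R _ TR bot by exact: mif.
have mcirc : @Cmeasurable R _ TR (circ e) by exact: mif.
have [itop _] := dom_int mtop (cb (fun u => u < 0)).
have [ibot _] := dom_int mbot (cb (fun u => 2 * pi < u)).
have [icirc _] := dom_int mcirc (cb (fun u => (0 <= u) && (u <= 2 * pi))).
pose top' t := top (e - t); pose bot' t := bot (t + (2 * pi - e)).
have mtop' : @Cmeasurable R _ TR top'.
  apply: (@Cmeasurable_comp R _ _ TR TR (fun t => e - t)) mtop.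
  by apply: measurable_funB => //; exact: measurable_id.
have mbot' : @Cmeasurable R _ TR bot'.
  apply: (@Cmeasurable_comp R _ _ TR TR (fun t => t + (2 * pi - e))) mbot.
  by apply: measurable_funD => //; exact: measurable_id.
have itop' : Cintegrable top'.
  refine (proj1 (dom_int (M := C * expR (del / 2 * e)) mtop' _)) => t.
  apply: (le_trans (cb (fun u => u < 0) _)); rewrite -[leRHS]mulrA; apply: (ler_wpM2l C0).
  apply: exp_abs_shift; rewrite -[X in `|X| <= _](subKr e).
  by rewrite (le_trans (ler_normB _ _))// (gtr0_norm e0) addrC.
have ibot' : Cintegrable bot'.
  refine (proj1 (dom_int (M := C * expR (del / 2 * `|2 * pi - e|)) mbot' _)) => t.
  apply: (le_trans (cb (fun u => 2 * pi < u) _)); rewrite -[leRHS]mulrA; apply: (ler_wpM2l C0).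
  apply: exp_abs_shift; rewrite -[X in `|X| <= _](addrK (2 * pi - e)).
  by rewrite (le_trans (ler_normB _ _)).
have tE : tail e = (fun t => top' t + bot' t).
  apply/funext => t; rewrite /tail /top' /bot' /top /bot subr_lt0.
  have -> : (2 * pi < t + (2 * pi - e)) = (e < t).
    by apply/idP/idP => h; lra.
  case: ifPn => et; last by rewrite addr0.
  have t0 : 0 < t by exact: lt_trans et.
  have u1 : e - t < 0 by rewrite subr_lt0.
  have u2 : 2 * pi < t + (2 * pi - e) by lra.
  rewrite /Phi /hankel_weight (hankel_point_top e0 u1) (hankel_log_top e u1).
  rewrite (hankel_point_bottom e0 u2) (hankel_log_bottom e u2).
  rewrite /hankel_speed u1 ltNge (ltW (lt_trans p2 u2)) /= leNgt u2 /=.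
  have -> : e - (e - t) = t by ring.
  have -> : e + (t + (2 * pi - e) - 2 * pi) = t by ring.
  (* Both sides run through the same real point t; only the logarithm, with argument 0 or 2 pi,
     tells them apart. *)
  have hexp y : cexp (Lg t y) = t%:C -> Q (Lg t y) =
      q t%:C * (cexp ((s - 1) * Lg t y) * t%:C).
    move=> h; rewrite /Q h; congr (_ * _).
    by rewrite mulrBl mul1r cexpD cexpN h mulfVK// -[0]/(0%:C)
      (inj_eq (@complexI R)) lt0r_neq0.
  have t_neq0 : t%:C != 0 :> R[i].
    by rewrite -[0]/(0%:C) (inj_eq (@complexI R)) lt0r_neq0.
  rewrite /Delta !hexp.
  - rewrite fmorphV /Lg complexr0; by field.
  - by rewrite cexp_Lg// cos0 sin0 mulr1 mulr0.
  - by rewrite cexp_Lg// mulr_natl cos2pi sin2pi mulr1 mulr0.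
have Ptb u : Phi e u = (top u + bot u) + circ e u.
  rewrite /top /bot /circ; have [u0|u0] := ltP u 0.
    rewrite ltNge (le_trans (ltW u0) (ltW p2)) /=.
    by rewrite !addr0.
  have [u1|u1] := leP u (2 * pi) => /=.
    by rewrite !add0r.
  by rewrite add0r addr0.
split=> //; first by rewrite tE; exact: CintegrableD.
rewrite -[LHS]/(Cintegral (fun u => Phi e u)).
under eq_fun do rewrite Ptb.
rewrite (CintegralD (CintegrableD itop ibot) icirc); congr (_ + _).
have -> : Cintegral (tail e) = Cintegral top' + Cintegral bot'.
  by rewrite tE; exact: (CintegralD itop' ibot').
have -> : Cintegral (fun u => top u + bot u) = Cintegral top + Cintegral bot.
  exact: (CintegralD itop ibot).
have -> : Cintegral top = Cintegral top' by exact: (@Cintegral_reflect R top e mtop itop').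
have -> : Cintegral bot = Cintegral bot'.
  exact: (@Cintegral_translate R bot (2 * pi - e) mbot ibot').
by [].
Qed.

Let Cintegral_circ e : 0 < e -> Cintegral (circ e) =
  circle_part (@complex.Re R) e +i* circle_part (@complex.Im R) e.
Proof.
move=> e0; rewrite /Cintegral /circle_part.
have E (prj : R[i] -> R) : prj 0 = 0 ->
    (\int[mu]_u prj (circ e u))%R =
    (\int[mu]_(y in `[0, 2 * pi]) prj (Q (Lg e y) * 'i%C))%R.
  move=> prj0; rewrite [RHS]Rintegral_mkcond; apply: eq_Rintegral => u _.
  rewrite patchE /circ mem_setE in_itv/=; case: ifP => // hu; congr prj.
  have /andP[u0 u1] := hu.
  rewrite /Phi /hankel_weight /hankel_speed ltNge u0 u1 /= /hankel_point.
  rewrite hankel_log_circle// -/(Lg e u) /Q mulrBl mul1r cexpD cexpN.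
  by have := cexp_neq0 (Lg e u); move: (cexp (Lg e u)) (cexp (s * _)) => a b a0; field.
by rewrite !E.
Qed.

(** The two tails differ by the integral of [Delta] over ]e1, e2], which is the change of the circle
    part between the two radii. *)
Let shift_lt e1 e2 : 0 < e1 -> e1 < e2 -> e2 < rho ->
  Cintegral (Phi e1) = Cintegral (Phi e2).
Proof.
move=> e10 e12 e2r; have e20 := lt_trans e10 e12.
have [i1 j1 ->] := contour_split e10 (lt_trans e12 e2r).
have [i2 j2 ->] := contour_split e20 e2r.
apply/eqP; rewrite -subr_eq0 opprD addrACA -mulN1r -CintegralZ//.
rewrite -CintegralD//; last exact: CintegrableZ.
rewrite !Cintegral_circ// addr_eq0 opprB; apply/eqP.
have E (prj : R[i] -> R) : is_projection prj -> prj 0 = 0 ->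
    (\int[mu]_u prj (tail e1 u + (-1) * tail e2 u))%R =
    circle_part prj e2 - circle_part prj e1.
  move=> hp prj0; rewrite -circle_partB//.
  rewrite -Rintegral_itv_obnd_cbnd.
    rewrite [RHS]Rintegral_mkcond; apply: eq_Rintegral => t _.
    rewrite patchE mem_setE in_itv/= mulN1r /tail.
    have [h1|h1] := ltP e1 t; have [h2|h2] := ltP e2 t => //=; rewrite ?subrr ?subr0//.
    by have := lt_le_trans (lt_trans e12 h2) h1; rewrite ltxx.
  apply: (@integrableS _ _ _ mu `[e1, e2]%classic).
  - exact: measurable_itv.
  - exact: measurable_itv.
  - by apply: subset_itvr; rewrite bnd_simp.
  apply: continuous_compact_integrable; first exact: segment_compact.
  apply: continuous_in_subspaceT => t; rewrite inE/= in_itv/= => /andP[h1 h2].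
  by apply: continuous_Delta => //; [exact: lt_le_trans h1|exact: le_lt_trans e2r].
by rewrite /Cintegral (E _ (or_introl erefl))// (E _ (or_intror erefl)).
Qed.

Lemma hankel_shift e1 e2 : 0 < e1 -> e1 < rho -> 0 < e2 -> e2 < rho ->
  Cintegral (fun u => q (hankel_point e1 u) * hankel_weight e1 u) =
  Cintegral (fun u => q (hankel_point e2 u) * hankel_weight e2 u).
Proof.
move=> e10 e1r e20 e2r; have [h|h|->//] := ltgtP e1 e2.
- exact: shift_lt.
- exact/esym/shift_lt.
Qed.

(** For integral s the function [Q] takes the same value at arguments 0 and 2 pi, so the tails
    cancel. The integral then equals the circle part of every radius e' < rho, and this is O(e')
    because t^n dt has modulus e'^(n+1) dy on the circle. *)
Lemma hankel_vanish n e : s = n.+1%:R -> 0 < e -> e < rho ->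
  Cintegral (fun u => q (hankel_point e u) * hankel_weight e u) = 0.
Proof.
move=> sn e0 er.
have tail0 e' : 0 < e' -> Cintegral (tail e') = 0.
  move=> e'0; have D0 t : 0 < t -> Delta t = 0.
    move=> t0; rewrite /Delta /Q sn !cexpM_nat !cexp_Lg// mulr_natl cos2pi sin2pi.
    by rewrite cos0 sin0 subrr mulr0.
  have -> : tail e' = (fun=> 0).
    by apply/funext => t; rewrite /tail; case: ifP => // /(lt_trans e'0)/D0.
  by rewrite /Cintegral /= !Rintegral_cst// !mul0r.
have vE e' : 0 < e' -> e' < rho -> Cintegral (Phi e) = Cintegral (circ e').
  move=> e'0 e'r; have -> : Cintegral (Phi e) = Cintegral (Phi e').
    exact: hankel_shift.
  by have [_ _ ->] := contour_split e'0 e'r; rewrite tail0// add0r.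
pose K := M * expR (del * rho) * rho ^+ n * expR (del / 2 * (2 * pi)).
have K0 : 0 <= K by rewrite !mulr_ge0 ?expR_ge0// exprn_ge0// ltW.
have hb e' : 0 < e' -> e' < rho -> forall u,
    normc (circ e' u) <= K * e' * exp_abs (del / 2) u.
  move=> e'0 e'r u; rewrite /circ; case: ifP => [hu|_]; last first.
    by rewrite normc0 mulr_ge0 ?exp_abs_ge0// mulr_ge0// ltW.
  have /andP[u0 u1] := hu.
  have hP : normc (hankel_point e' u) = e'.
    by rewrite /hankel_point normc_cexp hankel_log_circle//= lnK.
  have -> : Phi e' u = q (hankel_point e' u) * 'i%C * hankel_point e' u ^+ n.+1.
    rewrite /Phi /hankel_weight /hankel_speed ltNge u0 u1 /= sn.
    have -> : n.+1%:R - 1 = n%:R :> R[i] by rewrite -natr1 addrK.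
    rewrite cexpM_nat -/(hankel_point e' u) exprSr.
    by move: (hankel_point e' u) => b; ring.
  rewrite !normcM normc_i mulr1 normcX hP exprSr.
  have h1 : normc (q (hankel_point e' u)) <= M * expR (del * rho).
    have [sp1 sp2] := strip_le (ltW e'r) (strip_hankel_point e'0 u).
    apply: (le_trans (qM (conj sp1 sp2))); apply: ler_wpM2l => //.
    by rewrite ler_expR -mulrN ler_pM2l// lerNl.
  have h2 : e' ^+ n <= rho ^+ n by rewrite lerXn2r ?nnegrE ?ltW.
  have h3 : 1 <= expR (del / 2 * (2 * pi)) * exp_abs (del / 2) u.
    rewrite -expRD ger0_norm// -mulrBr.
    suff : expR 0 <= expR (del / 2 * (2 * pi - u)) by rewrite expR0.
    by rewrite ler_expR; apply: (mulr_ge0 (ltW del2)); rewrite subr_ge0.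
  have -> : K * e' * exp_abs (del / 2) u = (M * expR (del * rho)) * (rho ^+ n * e') *
      (expR (del / 2 * (2 * pi)) * exp_abs (del / 2) u).
    by rewrite /K; ring.
  rewrite -[X in X <= _]mulr1; apply: ler_pM => //.
    by rewrite !mulr_ge0 ?normc_ge0// ?exprn_ge0// ltW.
  apply: ler_pM => //; first exact: normc_ge0.
    by rewrite mulr_ge0 ?exprn_ge0// ltW.
  by rewrite ler_pM2r.
pose D := dom_integral (exp_abs (R := R) (del / 2)).
have hV e' : 0 < e' -> e' < rho -> normc (Cintegral (Phi e)) <= K * e' * (2 * D).
  move=> e'0 e'r; rewrite (vE _ e'0 e'r).
  by have [] := dom_int (mif mitv (mPhi e'0)) (hb _ e'0 e'r).
apply/eqP; rewrite -normc_eq0 eq_le normc_ge0 andbT; apply/ler_addgt0Pr => x x0.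
rewrite add0r; have [KD|KD] := leP (K * (2 * D)) 0.
  apply: (le_trans (hV e e0 er)); rewrite mulrAC.
  by apply: le_trans (ltW x0); rewrite pmulr_lle0.
have [e' /andP[e'0 e'm]] : exists e', 0 < e' < Num.min rho (x / (K * (2 * D))).
  exists (Num.min rho (x / (K * (2 * D))) / 2).
  set m := Num.min _ _; have m0 : 0 < m by rewrite lt_min rho_gt0 divr_gt0.
  by rewrite divr_gt0//= ltr_pdivrMr// ltr_pMr// ltr1n.
have /andP[e'r e'x] : (e' < rho) && (e' < x / (K * (2 * D))) by rewrite -lt_min.
apply: (le_trans (hV e' e'0 e'r)); rewrite mulrAC mulrC.
by rewrite -ler_pdivlMr// ltW.
Qed.

End ContourShift.

(** * Tensor products of contour integrals *)

Section HeadTail.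
Context {T : Type}.

Definition fcons r (z : T) (t : 'I_r -> T) : 'I_r.+1 -> T :=
  fun k => if unlift ord0 k is Some j then t j else z.

Lemma fcons0 r (z : T) (t : 'I_r -> T) : fcons z t ord0 = z.
Proof. by rewrite /fcons unlift_none. Qed.

Lemma fcons_lift r (z : T) (t : 'I_r -> T) j : fcons z t (lift ord0 j) = t j.
Proof. by rewrite /fcons liftK. Qed.

Lemma fconsE r (t : 'I_r.+1 -> T) : t = fcons (t ord0) (fun j => t (lift ord0 j)).
Proof.
by apply/funext => k; rewrite /fcons; case: unliftP => [j|] ->.
Qed.

Definition set_coord r (t : 'I_r -> T) k z : 'I_r -> T := fun j => if j == k then z else t j.

Lemma set_coord_fcons0 r (z w : T) (t : 'I_r -> T) : set_coord (fcons w t) ord0 z = fcons z t.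
Proof.
by apply/funext => k; rewrite /set_coord /fcons; case: unliftP => [j|] ->.
Qed.

Lemma set_coord_fcons_lift r (z w : T) (t : 'I_r -> T) k :
  set_coord (fcons w t) (lift ord0 k) z = fcons w (set_coord t k z).
Proof.
apply/funext => i; rewrite /set_coord /fcons; case: unliftP => [j|] ->.
  by rewrite (inj_eq lift_inj).
by [].
Qed.

End HeadTail.

Section HankelTensor.
Context {R : realType}.
Variables (rho del : R).
Hypothesis del_gt0 : 0 < del.
Local Notation TR := (measurableTypeR R).
Local Notation dom := (exp_abs (R := R) (del / 2)).
Local Notation decay z := (expR (- (del * complex.Re z))).

(** The one-variable test functions, obtained by freezing all variables but one. Measurability is
    expressed through composition because [Cmeasurable] speaks of maps into [R[i]]. *)
Definition decaying1 (q : R[i] -> R[i]) :=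
  [/\ forall d (T : measurableType d) (g : T -> R[i]),
        Cmeasurable g -> Cmeasurable (fun x => q (g x)),
      forall w, strip rho w -> D2_at q w &
      exists M, forall w, strip rho w -> normc (q w) <= M * decay w].

Definition decay_bound r (F : ('I_r -> R[i]) -> R[i]) (M : R) :=
  [/\ 0 <= M,
      forall d (T : measurableType d) (g : 'I_r -> T -> R[i]),
        (forall k, Cmeasurable (g k)) -> Cmeasurable (fun x => F (g^~ x)) &
      forall t, (forall j, strip rho (t j)) ->
        normc (F t) <= M * \prod_j decay (t j)].

(** Regularity is asked in each coordinate separately, as contours are exchanged one variable at a
    time. *)
Definition decaying r (F : ('I_r -> R[i]) -> R[i]) (M : R) :=
  decay_bound F M /\ forall t k, (forall j, strip rho (t j)) ->
    D2_at (fun z => F (set_coord t k z)) (t k).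

Lemma decaying_head r (F : ('I_r.+1 -> R[i]) -> R[i]) M t c :
  decaying F M -> (forall j, strip rho (t j)) ->
  decaying1 (fun z => F (fcons z t) * c).
Proof.
move=> [[M0 mF bF] dF] st.
have st' z : strip rho z -> forall j, strip rho (fcons z t j).
  by move=> sz j; rewrite /fcons; case: unliftP.
split.
- move=> d T g mg; apply: CmeasurableM; last exact: Cmeasurable_cst.
  apply: (mF _ _ (fun k x => fcons (g x) t k)) => k.
  by rewrite /fcons; case: unliftP => [j|] _ //; exact: Cmeasurable_cst.
- move=> w sw; apply: D2M; last exact: D2_cst.
  have := dF (fcons w t) ord0 (st' w sw); rewrite fcons0.
  by congr D2_at; apply/funext => z; rewrite set_coord_fcons0.
- exists (M * (\prod_j decay (t j)) * normc c) => w sw.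
  rewrite normcM mulrAC; apply: ler_wpM2r; first exact: normc_ge0.
  have := bF _ (st' w sw); rewrite big_ord_recl fcons0.
  rewrite (eq_bigr (fun j => decay (t j))) => [|j _]; last by rewrite fcons_lift.
  by rewrite mulrCA mulrC.
Qed.

Lemma decaying_tail r (F : ('I_r.+1 -> R[i]) -> R[i]) M z c :
  decaying F M -> strip rho z ->
  decaying (fun t => c * F (fcons z t)) (normc c * (M * decay z)).
Proof.
move=> [[M0 mF bF] dF] sz.
have st' t : (forall j, strip rho (t j)) -> forall j, strip rho (@fcons _ r z t j).
  by move=> st j; rewrite /fcons; case: unliftP.
split.
  split.
  - by rewrite !mulr_ge0 ?normc_ge0 ?expR_ge0.
  - move=> d T g mg; apply: CmeasurableM; first exact: Cmeasurable_cst.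
  apply: (mF _ _ (fun k x => fcons z (g^~ x) k)) => k.
  by rewrite /fcons; case: unliftP => [j|] _ //; exact: Cmeasurable_cst.
  - move=> t st; rewrite normcM -mulrA; apply: ler_wpM2l; first exact: normc_ge0.
  have := bF _ (st' _ st); rewrite big_ord_recl fcons0 mulrA.
  by rewrite (eq_bigr (fun j => decay (t j))) => [//|j _]; rewrite fcons_lift.
move=> t k st; apply: D2M; first exact: D2_cst.
  have := dF (fcons z t) (lift ord0 k) (st' _ st); rewrite fcons_lift.
  by congr D2_at; apply/funext => w; rewrite set_coord_fcons_lift.
Qed.

Definition contour (p w : R -> R[i]) (C : R) :=
  [/\ @Cmeasurable R _ TR p, @Cmeasurable R _ TR w, forall u, strip rho (p u),
      0 <= C & forall u, normc (w u) * decay (p u) <= C * dom u].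

Definition tensor_integrand r (F : ('I_r -> R[i]) -> R[i]) (p : 'I_r -> R -> R[i])
    (w : r.-tuple R -> R[i]) (v : r.-tuple R) : R[i] :=
  F (fun k => p k (tnth v k)) * w v.

Definition tensor_weight r (w : 'I_r -> R -> R[i]) (v : r.-tuple R) : R[i] :=
  \prod_k w k (tnth v k).

Lemma Cmeasurable_tnth r (f : R -> R[i]) (k : 'I_r) : @Cmeasurable R _ TR f ->
  @Cmeasurable R _ (r.-tuple TR) (fun v => f (tnth v k)).
Proof.
by move=> mf; apply: (Cmeasurable_comp (h := fun v : r.-tuple TR => tnth v k)) mf;
  exact: measurable_tnth.
Qed.

(** The weight is any function below K T, not only a product: the error terms in the expansion of a
    product of weights are not products themselves. *)
Lemma tensor_dominated r F M (p : 'I_r -> R -> R[i]) (T : r.-tuple R -> R)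
    (C : R) (w : r.-tuple R -> R[i]) K :
  decay_bound F M -> (forall k, @Cmeasurable R _ TR (p k)) ->
  (forall k u, strip rho (p k u)) ->
  @Cmeasurable R _ (r.-tuple TR) w ->
  (forall v, T v * \prod_k decay (p k (tnth v k)) <= C * tuple_dom dom v) ->
  0 <= K -> (forall v, normc (w v) <= K * T v) ->
  dominated dom (tensor_integrand F p w) (M * (K * C)).
Proof.
move=> [M0 mF bF] mp sp mw hT K0 hw; split.
  apply: CmeasurableM mw.
  by apply: (mF _ _ (fun k (v : r.-tuple TR) => p k (tnth v k))) => k;
    exact: Cmeasurable_tnth.
move=> v; rewrite normcM.
have h1 := bF (fun k => p k (tnth v k)) (fun k => sp k (tnth v k)).
have P0 : 0 <= \prod_k decay (p k (tnth v k)) by apply: prodr_ge0 => ? _; exact: expR_ge0.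
apply: (le_trans (ler_pM (normc_ge0 _) (normc_ge0 _) h1 (hw v))).
move: (hT v); move: (\prod_k _) (tuple_dom _ v) => P D h2.
have -> : M * P * (K * T v) = M * K * (T v * P) by ring.
have -> : M * (K * C) * D = M * K * (C * D) by ring.
by apply: ler_wpM2l; first exact: mulr_ge0.
Qed.

Lemma tensor_weight_bound r (p w : 'I_r -> R -> R[i]) (C : 'I_r -> R) v :
  (forall k, contour (p k) (w k) (C k)) ->
  normc (tensor_weight w v) * \prod_k decay (p k (tnth v k)) <=
  (\prod_k C k) * tuple_dom dom v.
Proof.
move=> h; rewrite /tensor_weight normc_prod -!big_split /=.
apply: ler_prod => k _; have [_ _ _ _ hb] := h k.
by rewrite mulr_ge0 ?normc_ge0 ?expR_ge0//= hb.
Qed.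

Lemma Cmeasurable_tensor_weight r (w : 'I_r -> R -> R[i]) :
  (forall k, @Cmeasurable R _ TR (w k)) ->
  @Cmeasurable R _ (r.-tuple TR) (tensor_weight w).
Proof. by move=> h; apply: Cmeasurable_prod => k _; exact: Cmeasurable_tnth. Qed.

Lemma contour_dominated r F M (p w : 'I_r -> R -> R[i]) C : decay_bound F M ->
  (forall k, contour (p k) (w k) (C k)) ->
  dominated dom (tensor_integrand F p (tensor_weight w)) (M * (\prod_k C k)).
Proof.
move=> dF h; rewrite -[X in M * X]mul1r.
apply: (tensor_dominated (T := fun v => normc (tensor_weight w v))) => //.
- by move=> k; have [] := h k.
- by move=> k; have [] := h k.
- by apply: Cmeasurable_tensor_weight => k; have [] := h k.
- by move=> v; exact: tensor_weight_bound.
- by move=> v; rewrite mul1r.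
Qed.

Definition tensor_integral r (F : ('I_r -> R[i]) -> R[i]) (p w : 'I_r -> R -> R[i]) :=
  Cintegral_tuple (tensor_integrand F p (tensor_weight w)).

(** Two pairs of a path and a weight that define the same functional on the test functions; this
    covers the change of radius as well as the change of weight at a positive integer. *)
Definition contour_equiv (p w p' w' : R -> R[i]) := forall q, decaying1 q ->
  Cintegral (fun u => q (p u) * w u) = Cintegral (fun u => q (p' u) * w' u).

Let idom : (@lebesgue_measure R).-integrable setT (fun u => (dom u)%:E).
Proof. by apply: integrable_exp_abs; rewrite divr_gt0. Qed.

Lemma tensor_integrand_cons r F (p w : 'I_r.+1 -> R -> R[i]) u (v : r.-tuple R) :
  tensor_integrand F p (tensor_weight w) [tuple of u :: v] =
  w ord0 u * F (fcons (p ord0 u) (fun k => p (lift ord0 k) (tnth v k))) *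
  tensor_weight (fun k => w (lift ord0 k)) v.
Proof.
rewrite /tensor_integrand /tensor_weight big_ord_recl /= tnth0 mulrCA mulrA.
congr (_ * F _ * _).
  by rewrite [LHS]fconsE tnth0; congr fcons; apply/funext => k; rewrite tnthS.
by apply: eq_bigr => k _; rewrite tnthS.
Qed.

(** The hybrid [P], [W] keeps the old head and takes the new tail. The tail is exchanged by
    induction for each fixed head; then the head is moved innermost by Fubini and exchanged for each
    fixed tail. *)
Lemma tensor_integral_equiv r F M (p w p' w' : 'I_r -> R -> R[i]) C C' :
  decaying F M ->
  (forall k, contour (p k) (w k) (C k)) ->
  (forall k, contour (p' k) (w' k) (C' k)) ->
  (forall k, contour_equiv (p k) (w k) (p' k) (w' k)) ->
  tensor_integral F p w = tensor_integral F p' w'.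
Proof.
elim: r => [|r IH] in F M p w p' w' C C' *.
  move=> _ _ _ _; rewrite /tensor_integral /= /tensor_integrand /tensor_weight !big_ord0.
  by congr (F _ * _); apply/funext => -[].
move=> dF hw hw' e.
pose P : 'I_r.+1 -> R -> R[i] := fcons (p ord0) (fun k => p' (lift ord0 k)).
pose W : 'I_r.+1 -> R -> R[i] := fcons (w ord0) (fun k => w' (lift ord0 k)).
have hW k : contour (P k) (W k) (fcons (C ord0) (fun k => C' (lift ord0 k)) k).
  by rewrite /P /W /fcons; case: unliftP.
have dW := contour_dominated dF.1 hW; have dw' := contour_dominated dF.1 hw'.
transitivity (tensor_integral F P W).
  rewrite /tensor_integral /=; congr Cintegral; apply/funext => u.
  under [in LHS]eq_fun do rewrite tensor_integrand_cons.
  under [in RHS]eq_fun do rewrite tensor_integrand_cons.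
  have [_ _ sp _ _] := hw ord0.
  have := IH _ _ (fun k => p (lift ord0 k)) (fun k => w (lift ord0 k))
    (fun k => p' (lift ord0 k)) (fun k => w' (lift ord0 k)) _ _
    (decaying_tail (w ord0 u) dF (sp u)) (fun k => hw _) (fun k => hw' _) (fun k => e _).
  rewrite /tensor_integral /tensor_integrand => ->.
  congr Cintegral_tuple; apply/funext => v; rewrite /P /W !fcons0.
  congr (_ * F (fcons _ _) * _); first by apply/funext => k; rewrite fcons_lift.
  by rewrite /tensor_weight; apply: eq_bigr => k _; rewrite fcons_lift.
rewrite /tensor_integral [LHS](Cintegral_tuple_swap idom dW).
rewrite [RHS](Cintegral_tuple_swap idom dw'); congr Cintegral_tuple.
apply/funext => v.
under [in LHS]eq_fun do rewrite tensor_integrand_cons.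
under [in RHS]eq_fun do rewrite tensor_integrand_cons.
have sp' k u : strip rho (p' k u) by have [] := hw' k.
have := e ord0 _ (decaying_head (tensor_weight (fun k => w' (lift ord0 k)) v) dF
  (fun k => sp' (lift ord0 k) (tnth v k))).
have -> : tensor_weight (fun k => W (lift ord0 k)) v =
    tensor_weight (fun k => w' (lift ord0 k)) v.
  by rewrite /tensor_weight; apply: eq_bigr => k _; rewrite /W fcons_lift.
have -> : (fun k => P (lift ord0 k) (tnth v k)) = fun k => p' (lift ord0 k) (tnth v k).
  by apply/funext => k; rewrite /P fcons_lift.
move: (tensor_weight _ v) => c; rewrite /P /W !fcons0 => E.
transitivity (Cintegral (fun u => F (fcons (p ord0 u)
    (fun k => p' (lift ord0 k) (tnth v k))) * c * w ord0 u)).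
  by congr Cintegral; apply/funext => u; rewrite -mulrA mulrC.
rewrite E; congr Cintegral; apply/funext => u.
by rewrite -[RHS]mulrA [RHS]mulrC.
Qed.

End HankelTensor.

(** * Analytic dependence on the exponents *)

Section DifferentiabilityCriteria.
Context {K : numFieldType} {V W : normedModType K}.

Lemma differentiable_approx (f : V -> W) (df : {linear V -> W}) x :
  continuous df ->
  (forall e : K, 0 < e -> \forall h \near (0 : V),
    `|f (h + x) - (f x + df h)| <= e * `|h|) ->
  differentiable f x.
Proof.
move=> cdf hf; have e : f \o shift x = cst (f x) + df +o_ (0 : V) id.
  by apply/eqaddoP => e e0; exact: hf.
by apply/diff_locallyP; rewrite (diff_unique cdf e).
Qed.

Lemma differentiable_near (f g : V -> W) x : differentiable g x ->
  (\forall y \near x, f y = g y) -> differentiable f x.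
Proof.
move=> dg fg; have [cg eg] := (diff_locallyP _ _).1 dg.
apply: (differentiable_approx cg) => e e0.
have /eqaddoP/(_ e e0) := eg; apply: filter_app.
have : \forall h \near (0 : V), f (h + x) = g (h + x).
  by move: fg; rewrite (near_shift 0 x); apply: filterS => h /=; rewrite subr0.
apply: filterS => h /= ->; by rewrite (nbhs_singleton fg).
Qed.

End DifferentiabilityCriteria.

Lemma differentiable_prod {K : numFieldType} {V : normedModType K} (J : Type)
    (s : seq J) (f : J -> V -> K) x :
  (forall j, differentiable (f j) x) ->
  differentiable (fun y => \prod_(j <- s) f j y) x.
Proof.
move=> df; elim: s => [|j s IH].
  have -> : (fun y => \prod_(j <- [::]) f j y) = cst (1 : K).
    by apply/funext => y; rewrite big_nil.
  exact: differentiable_cst.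
have -> : (fun y => \prod_(i <- j :: s) f i y) =
    (f j * (fun y => \prod_(i <- s) f i y) : V -> K).
  by apply/funext => y; rewrite big_cons.
exact: differentiableM.
Qed.

(** * Differentiability from quadratic remainders *)

Section QuadraticRemainder.
Context {R : realType}.

(** A real-valued norm that matches linear forms sum_j h_j b_j; the norm of a row vector over [R[i]]
    itself has values in [R[i]]. *)
Definition l1norm r (h : 'rV[R[i]]_r) : R := \sum_j normc (h 0 j).

Lemma l1norm_ge0 r (h : 'rV[R[i]]_r) : 0 <= l1norm h.
Proof. by apply: sumr_ge0 => j _; exact: normc_ge0. Qed.

Lemma normc_le_l1norm r (h : 'rV[R[i]]_r) j : normc (h 0 j) <= l1norm h.
Proof.
by rewrite /l1norm (bigD1 j)//= lerDl sumr_ge0// => ? _; exact: normc_ge0.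
Qed.

Lemma normc_coord_le r (h : 'rV[R[i]]_r) j : (normc (h 0 j))%:C <= `|h|.
Proof.
rewrite -[leRHS]/(mx_norm h) mx_normE.
have -> : (normc (h 0 j))%:C = `|h 0 j| by [].
rewrite -[leLHS]nngE num_le; exact: (le_bigmax _ _ (0, j)).
Qed.

Lemma l1norm_le r (h : 'rV[R[i]]_r) : (l1norm h)%:C <= r%:R * `|h|.
Proof.
rewrite /l1norm rmorph_sum /=.
apply: (@le_trans _ _ (\sum_(j < r) `|h|)).
  by apply: ler_sum => j _; exact: normc_coord_le.
by rewrite sumr_const card_ord mulr_natl.
Qed.

Lemma near_l1norm r (d : R) : 0 < d -> \forall h \near (0 : 'rV[R[i]]_r), l1norm h < d.
Proof.
move=> d0; apply/nbhs_normP; exists ((d / r.+1%:R)%:C).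
  by rewrite /= ltcR divr_gt0.
move=> h /=; rewrite sub0r normrN => hd.
rewrite -ltcR (le_lt_trans (l1norm_le h))//.
apply: (@le_lt_trans _ _ (r.+1%:R * `|h|)).
  by rewrite ler_wpM2r// ler_nat.
by rewrite mulrC -ltr_pdivlMr// -[r.+1%:R in ltRHS](rmorph_nat (@real_complex R)) -fmorphV -rmorphM.
Qed.

(** The bound at h = 0 gives f x = 0, and the differential is the zero map. *)
Lemma differentiable_quadratic r (f : 'rV[R[i]]_r -> R[i]) x (K : R) :
  (\forall h \near (0 : 'rV[R[i]]_r), normc (f (h + x)) <= K * l1norm h ^+ 2) ->
  differentiable f x.
Proof.
move=> hf; have f0 : f x = 0.
  have := nbhs_singleton hf; rewrite add0r.
  have -> : l1norm (0 : 'rV[R[i]]_r) = 0.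
    by rewrite /l1norm big1// => j _; rewrite mxE normc0.
  rewrite expr0n mulr0 => h; apply/eqP.
  by rewrite -normc_eq0 eq_le h normc_ge0.
pose z : {linear 'rV[R[i]]_r -> R[i]} := \0.
apply: (@differentiable_approx _ _ _ f z); first exact: cst_continuous.
move=> e e0.
have : exists2 a : R, 0 < a & e = a%:C.
  by case: e e0 => a b; rewrite ltcE/= => /andP[/eqP -> a0]; exists a.
move=> [a a0 ->].
have Kr : 0 < `|K| * r%:R + 1 by rewrite ltr_wpDl// mulr_ge0.
near=> h.
have h1 : normc (f (h + x)) <= K * l1norm h ^+ 2 by near: h.
have h2 : l1norm h < a / (`|K| * r%:R + 1) by near: h; apply: near_l1norm; rewrite divr_gt0.
rewrite f0 add0r subr0.
have N0 := l1norm_ge0 h.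
have h3 : normc (f (h + x)) <= `|K| * l1norm h * l1norm h.
  apply: (le_trans h1); rewrite -mulrA expr2 ler_wpM2r ?mulr_ge0//.
  exact: ler_norm.
apply: (@le_trans _ _ ((`|K| * l1norm h)%:C * (r%:R * `|h|))).
  apply: (@le_trans _ _ ((`|K| * l1norm h)%:C * (l1norm h)%:C)).
    by rewrite -rmorphM /= lecR.
  by apply: ler_wpM2l; [rewrite lecR mulr_ge0|exact: l1norm_le].
rewrite mulrA; apply: ler_wpM2r => //.
rewrite -(rmorph_nat (@real_complex R)) -rmorphM lecR.
rewrite mulrAC; apply: le_trans (_ : (`|K| * r%:R + 1) * l1norm h <= _).
  by apply: ler_wpM2r => //; rewrite lerDl.
by rewrite mulrC -ler_pdivlMr// ltW.
Unshelve. all: by end_near. Qed.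

End QuadraticRemainder.

Section BoundedWeights.
Context {R : realType} {d : measure_display} {V : measurableType d}.
Implicit Types (w : V -> R[i]) (T : V -> R).

Definition bounded_weight T w (K : R) :=
  [/\ 0 <= K, Cmeasurable w & forall v, normc (w v) <= K * T v].

Lemma bounded_weightD T w w' K K' : bounded_weight T w K ->
  bounded_weight T w' K' -> bounded_weight T (fun v => w v + w' v) (K + K').
Proof.
move=> [K0 mw bw] [K'0 mw' bw']; split; [exact: addr_ge0|exact: CmeasurableD|].
by move=> v; rewrite mulrDl (le_trans (normcD _ _))// lerD.
Qed.

Lemma bounded_weightZ T w K c : bounded_weight T w K ->
  bounded_weight T (fun v => c * w v) (normc c * K).
Proof.
move=> [K0 mw bw]; split; first by rewrite mulr_ge0 ?normc_ge0.
  by apply: CmeasurableM => //; exact: Cmeasurable_cst.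
by move=> v; rewrite normcM -mulrA ler_wpM2l ?normc_ge0.
Qed.

Lemma bounded_weightM T T' w w' K K' : bounded_weight T w K ->
  bounded_weight T' w' K' ->
  bounded_weight (fun v => T v * T' v) (fun v => w v * w' v) (K * K').
Proof.
move=> [K0 mw bw] [K'0 mw' bw']; split; [exact: mulr_ge0|exact: CmeasurableM|].
by move=> v; rewrite normcM mulrACA ler_pM ?normc_ge0.
Qed.

Lemma bounded_weight_le T w K K' : (forall v, 0 <= T v) -> K <= K' ->
  bounded_weight T w K -> bounded_weight T w K'.
Proof.
move=> T0 KK [K0 mw bw]; split=> //; first exact: le_trans KK.
by move=> v; apply: (le_trans (bw v)); rewrite ler_wpM2r.
Qed.

Definition linear_part r (b : 'I_r -> V -> R[i]) (h : 'rV[R[i]]_r) v : R[i] :=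
  \sum_j h 0 j * b j v.

Lemma bounded_linear_part T r (b : 'I_r -> V -> R[i]) K h : (forall v, 0 <= T v) ->
  0 <= K -> (forall j, bounded_weight T (b j) K) ->
  bounded_weight T (linear_part b h) (l1norm h * K).
Proof.
move=> T0 K0 hb; split; first by rewrite mulr_ge0 ?l1norm_ge0.
  apply: Cmeasurable_sum => j _; apply: CmeasurableM; first exact: Cmeasurable_cst.
  by have [] := hb j.
move=> v; rewrite (le_trans (normc_sum _ _ _))// /l1norm !mulr_suml.
apply: ler_sum => j _; rewrite normcM -mulrA ler_wpM2l ?normc_ge0//.
by have [_ _] := hb j.
Qed.

(** The several-variable counterpart of [jet], pointwise in v: an affine expansion in the
    displacement h of the exponents, with all terms below the fixed majorant T, so that it can be
    integrated term by term. *)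
Definition weight_jet r T (w : 'rV[R[i]]_r -> V -> R[i]) := exists a b K,
  [/\ 0 <= K, bounded_weight T a K, forall j : 'I_r, bounded_weight T (b j) K &
  forall h, Cmeasurable (w h) /\ (l1norm h <= 1 ->
    bounded_weight T (fun v => w h v - (a v + linear_part b h v)) (K * l1norm h ^+ 2))].

Lemma weight_jet1 r : @weight_jet r (fun=> 1) (fun _ _ => 1).
Proof.
exists (fun=> 1), (fun _ _ => 0), 1; split=> // [|j|h].
- by split; [exact: ler01|exact: Cmeasurable_cst|move=> v; rewrite normc1 mulr1].
- by split; [exact: ler01|exact: Cmeasurable_cst|move=> v; rewrite normc0 mulr1].
split; first exact: Cmeasurable_cst.
move=> _.
have -> : (fun v => 1 - (1 + linear_part (fun _ _ => 0) h v)) = fun=> 0 : R[i].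
  apply/funext => v; rewrite /linear_part big1 ?addr0 ?subrr// => j _.
  by rewrite mulr0.
split; [by rewrite mul1r sqr_ge0|exact: Cmeasurable_cst|].
by move=> v; rewrite normc0 mulr1 mul1r sqr_ge0.
Qed.

Lemma weight_jetM r T T' (w w' : 'rV[R[i]]_r -> V -> R[i]) :
  (forall v, 0 <= T v) -> (forall v, 0 <= T' v) -> weight_jet T w -> weight_jet T' w' ->
  weight_jet (fun v => T v * T' v) (fun h v => w h v * w' h v).
Proof.
move=> T0 T'0 [a [b [K [K0 ha hb hw]]]] [a' [b' [K' [K'0 ha' hb' hw']]]].
have TT v : 0 <= T v * T' v by rewrite mulr_ge0.
have KK : 0 <= K * K' by rewrite mulr_ge0.
exists (fun v => a v * a' v), (fun j v => b j v * a' v + a v * b' j v), (6 * (K * K')).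
split.
- by rewrite mulr_ge0.
- by apply: (bounded_weight_le TT _ (bounded_weightM ha ha')); rewrite ler_peMl// ler1n.
- move=> j; apply: (bounded_weight_le TT _ (bounded_weightD
    (bounded_weightM (hb j) ha') (bounded_weightM ha (hb' j)))).
  lra.
move=> h; have [mw rw] := hw h; have [mw' rw'] := hw' h.
split; first exact: CmeasurableM.
move=> h1; have {rw}rw := rw h1; have {rw'}rw' := rw' h1.
have hl := bounded_linear_part h T0 K0 hb.
have hl' := bounded_linear_part h T'0 K'0 hb'.
have N0 := l1norm_ge0 h.
set N := l1norm h in h1 N0 rw rw' hl hl' *.
set l := linear_part b h in hl rw *; set l' := linear_part b' h in hl' rw' *.
set rho := (fun v => w h v - (a v + l v)) in rw.
set rho' := (fun v => w' h v - (a' v + l' v)) in rw'.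
(* The part of second order is the product of the linear parts plus the terms containing a
   remainder. With N = [l1norm h] <= 1 these add up to N^2 (3 + N^2 + 2 N) <= 6 N^2. *)
have e : (fun v => w h v * w' h v - (a v * a' v +
    linear_part (fun j v => b j v * a' v + a v * b' j v) h v)) =
  (fun v => (l v * l' v + (rho v + (a v + l v)) * rho' v) + rho v * (a' v + l' v)).
  apply/funext => v.
  have -> : linear_part (fun j v => b j v * a' v + a v * b' j v) h v =
      l v * a' v + a v * l' v.
    rewrite /l /l' /linear_part mulr_suml mulr_sumr -big_split /=.
    by apply: eq_bigr => j _; ring.
  by rewrite /rho /rho'; ring.
rewrite e; have N2 : N ^+ 2 <= N by rewrite expr2 ler_piMr.
apply: (bounded_weight_le TT _ (bounded_weightD (bounded_weightD
  (bounded_weightM hl hl')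
  (bounded_weightM (bounded_weightD rw (bounded_weightD ha hl)) rw'))
  (bounded_weightM rw (bounded_weightD ha' hl')))).
have N21 : N ^+ 2 <= 1 by exact: le_trans h1.
have -> : N * K * (N * K') + (K * N ^+ 2 + (K + N * K)) * (K' * N ^+ 2) +
  K * N ^+ 2 * (K' + N * K') = (K * K') * (N ^+ 2 * (3 + N ^+ 2 + 2 * N)) by ring.
have -> : 6 * (K * K') * N ^+ 2 = (K * K') * (N ^+ 2 * 6) by ring.
apply: ler_wpM2l => //; apply: ler_wpM2l; first exact: sqr_ge0.
lra.
Qed.

Lemma weight_jet_prod r (J : Type) (s : seq J) (T : J -> V -> R)
    (w : J -> 'rV[R[i]]_r -> V -> R[i]) :
  (forall j v, 0 <= T j v) -> (forall j, weight_jet (T j) (w j)) ->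
  weight_jet (fun v => \prod_(j <- s) T j v) (fun h v => \prod_(j <- s) w j h v).
Proof.
move=> T0 hw; elim: s => [|j s IH].
  have := @weight_jet1 r; congr weight_jet; first by apply/funext => v; rewrite big_nil.
  by apply/funext => h; apply/funext => v; rewrite big_nil.
have P0 v : 0 <= \prod_(i <- s) T i v by apply: prodr_ge0 => i _; exact: T0.
have := weight_jetM (T0 j) P0 (hw j) IH.
congr weight_jet; first by apply/funext => v; rewrite big_cons.
by apply/funext => h; apply/funext => v; rewrite big_cons.
Qed.

End BoundedWeights.

Section DifferentiableTensorIntegral.
Context {R : realType}.
Variables (rho del : R).
Hypothesis del_gt0 : 0 < del.
Local Notation TR := (measurableTypeR R).
Local Notation dom := (exp_abs (R := R) (del / 2)).
Local Notation decay z := (expR (- (del * complex.Re z))).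
Variables (r : nat) (F : ('I_r -> R[i]) -> R[i]) (M : R) (p : 'I_r -> R -> R[i]).
Hypothesis dF : decay_bound rho del F M.
Hypothesis mp : forall k, @Cmeasurable R _ TR (p k).
Hypothesis sp : forall k u, strip rho (p k u).
Variables (T : r.-tuple TR -> R) (C : R).
Hypothesis T_ge0 : forall v, 0 <= T v.
Hypothesis hT : forall v, T v * \prod_k decay (p k (tnth v k)) <= C * tuple_dom dom v.

Let Lam (w : r.-tuple TR -> R[i]) := Cintegral_tuple (tensor_integrand F p w).

Let idom : (@lebesgue_measure R).-integrable setT (fun u => (dom u)%:E).
Proof. by apply: integrable_exp_abs; rewrite divr_gt0. Qed.

Let bw_dom w K : bounded_weight T w K ->
  dominated dom (tensor_integrand F p w) (M * (K * C)).
Proof. by move=> [K0 mw bw]; exact: (tensor_dominated dF mp sp mw hT K0 bw). Qed.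

Let LamD w w' K K' : bounded_weight T w K -> bounded_weight T w' K' ->
  Lam (fun v => w v + w' v) = Lam w + Lam w'.
Proof.
move=> h h'; rewrite /Lam -(Cintegral_tupleD idom (bw_dom h) (bw_dom h')).
by congr Cintegral_tuple; apply/funext => v; rewrite /tensor_integrand mulrDr.
Qed.

Let LamZ w K c : bounded_weight T w K -> Lam (fun v => c * w v) = c * Lam w.
Proof.
move=> h; rewrite /Lam -(Cintegral_tupleZ idom c (bw_dom h)).
by congr Cintegral_tuple; apply/funext => v; rewrite /tensor_integrand mulrCA.
Qed.

Let Lam_linear_part b K h : 0 <= K -> (forall j : 'I_r, bounded_weight T (b j) K) ->
  Lam (linear_part b h) = \sum_j h 0 j * Lam (b j).
Proof.
move=> K0 hb; rewrite /linear_part.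
suff [_ ->] : (exists K', bounded_weight T (fun v => \sum_(j <- index_enum 'I_r) h 0 j * b j v) K') /\
    Lam (fun v => \sum_(j <- index_enum 'I_r) h 0 j * b j v) =
    \sum_(j <- index_enum 'I_r) h 0 j * Lam (b j) by [].
elim: (index_enum _) => [|j s [[K' IH] IHe]].
  have e : (fun v => \sum_(j <- [::]) h 0 j * b j v) =
      (fun v => 0 * (0 : R[i])) :> (r.-tuple TR -> R[i]).
    by apply/funext => v; rewrite big_nil mulr0.
  have h0 : bounded_weight T (fun=> 0 : R[i]) 0.
    by split; [exact: lexx|exact: Cmeasurable_cst|move=> v; rewrite normc0 mul0r].
  rewrite e; split; first by exists (normc 0 * 0); exact: bounded_weightZ.
  by rewrite (LamZ 0 h0) mul0r big_nil.
have e : (fun v => \sum_(i <- j :: s) h 0 i * b i v) =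
    (fun v => h 0 j * b j v + \sum_(i <- s) h 0 i * b i v).
  by apply/funext => v; rewrite big_cons.
have hj := bounded_weightZ (h 0 j) (hb j).
rewrite e (LamD hj IH) (LamZ _ (hb j)) IHe big_cons; split=> //.
by exists (normc (h 0 j) * K + K'); exact: bounded_weightD.
Qed.

(** Integrating the expansion termwise gives an affine function of s, and the integral of the
    remainder is quadratic in s - x. *)
Lemma differentiable_tensor_integral (w : 'rV[R[i]]_r -> r.-tuple TR -> R[i]) x :
  weight_jet T w ->
  differentiable (fun s => Cintegral_tuple (tensor_integrand F p (w (s - x)))) x.
Proof.
move=> [a [b [K [K0 ha hb hw]]]].
pose g := fun s : 'rV[R[i]]_r => Lam a + \sum_j (s - x) 0 j * Lam (b j).
pose f := fun s => Lam (w (s - x)).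
have dg : differentiable g x.
  apply: differentiableD; first exact: differentiable_cst.
  have -> : (fun s : 'rV[R[i]]_r => \sum_j (s - x) 0 j * Lam (b j)) =
      \sum_j (fun s : 'rV[R[i]]_r => (s - x) 0 j * Lam (b j)).
    by apply/funext => s; rewrite fct_sumE.
  apply: differentiable_sum => j; apply: differentiableM; last exact: differentiable_cst.
  have -> : (fun s : 'rV[R[i]]_r => (s - x) 0 j) =
      (fun s : 'rV[R[i]]_r => s 0 j : R[i]) + cst (- x 0 j).
    by apply/funext => s; rewrite !mxE.
  by apply: differentiableD; [exact: differentiable_coord|exact: differentiable_cst].
have drho : differentiable (fun s => f s - g s) x.
  apply: (@differentiable_quadratic _ _ _ _ (M * (K * C) * (2 * dom_integral dom) ^+ r)).
  near=> h.
  have h1 : l1norm h <= 1 by apply: ltW; near: h; exact: near_l1norm.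
  have [_ /(_ h1) hr] := hw h.
  have hl := bounded_linear_part h T_ge0 K0 hb.
  have hal := bounded_weightD ha hl.
  have E : f (h + x) - g (h + x) = Lam (fun v => w h v - (a v + linear_part b h v)).
    rewrite /f /g addrK -(Lam_linear_part h K0 hb) -(LamD ha hl).
    apply/eqP; rewrite subr_eq; apply/eqP; rewrite -(LamD hr hal).
    by congr Lam; apply/funext => v; rewrite subrK.
  rewrite E; apply: (le_trans (normc_Cintegral_tuple idom (bw_dom hr))).
  move: (l1norm h) (_ ^+ r) => N D.
  by rewrite (_ : M * (K * N ^+ 2 * C) * D = M * (K * C) * D * N ^+ 2)//; ring.
have -> : (fun s => Cintegral_tuple (tensor_integrand F p (w (s - x)))) =
    (fun s => f s - g s) + g.
  by apply/funext => s; rewrite -[RHS]/(f s - g s + g s) subrK.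
exact: differentiableD.
Unshelve. all: by end_near. Qed.

End DifferentiableTensorIntegral.

Section NotPositiveInteger.
Context {R : realType}.
Implicit Types (s x : R[i]).

Definition not_pos_int s := forall n : nat, s <> n.+1%:R.

(** Two positive integers within 1/2 of x are at distance less than 1 and so coincide; hence at most
    one other than x has to be excluded by shrinking the disc. *)
Lemma near_not_pos_int x : \forall s \near (x : R[i]), s != x -> not_pos_int s.
Proof.
have dist (n m : nat) : normc (n.+1%:R - m.+1%:R : R[i]) < 1 -> n = m.
  move=> h; have := le_lt_trans (Re_le_normc _) h.
  rewrite ReD ReN -!(rmorph_nat (@real_complex R)) /= ltr_norml => /andP[h1 h2].
  have : n.+1%:R < m.+2%:R :> R by rewrite -[m.+2]addn1 natrD; lra.
  have : m.+1%:R < n.+2%:R :> R by rewrite -[n.+2]addn1 natrD; lra.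
  by rewrite !ltr_nat !ltnS => mn nm; apply/eqP; rewrite eqn_leq nm mn.
have [[n [nx hn]]|none] := pselect (exists n : nat,
    n.+1%:R <> x /\ normc (n.+1%:R - x) < 2^-1); last first.
  apply/near_normcP; exists 2^-1; first by rewrite invr_gt0.
  move=> s sx /eqP snx n sn; apply: none; exists n; split.
    by move=> e; apply: snx; rewrite sn.
  by rewrite -sn.
apply/near_normcP; exists (normc (n.+1%:R - x)).
  by rewrite normc_gt0 subr_eq0; exact/eqP.
move=> s sx _ m sm; suff nm : n = m by move: sx; rewrite sm nm ltxx.
apply: dist; rewrite (_ : _ - _ = (n.+1%:R - x) - (m.+1%:R - x)); last by ring.
rewrite (le_lt_trans (normcB _ _))// -sm.
have := lt_trans sx hn; lra.
Qed.

End NotPositiveInteger.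

(** * Local expansions of the Hankel weight in the exponent *)

Section Germs.
Context {R : realType}.
Variables (rho del e : R).
Hypotheses (e_gt0 : 0 < e) (e_rho : e < rho) (del_gt0 : 0 < del).
Local Notation TR := (measurableTypeR R).
Local Notation dom := (exp_abs (R := R) (del / 2)).
Local Notation decay z := (expR (- (del * complex.Re z))).
Implicit Types (s x : R[i]).

Lemma strip_hankel u : strip rho (hankel_point e u).
Proof.
have [h1 h2] := strip_hankel_point e_gt0 u; split; last exact: le_trans (ltW e_rho).
by apply: le_trans h1; rewrite lerN2 ltW.
Qed.

Lemma log_weight_contour w : log_weight e w ->
  exists C, contour rho del (hankel_point e) w C.
Proof.
move=> hw; have [C [C0 hC]] := log_weight_bound e_gt0 del_gt0 hw.
exists C; split=> //; [exact: Cmeasurable_hankel_point|exact: hw.1|].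
exact: strip_hankel.
Qed.

Definition germ_base x m u : R[i] :=
  cexp ((x - 1) * hankel_log e u) * hankel_log e u ^+ m * hankel_speed e u.

(** Up to the speed of the path, m = 0 gives t^{s-1}, and m = 1 gives (t^{s-1} - t^{x-1}) / (s - x),
    extended to s = x by t^{x-1} log t. The use of [exp_rem] treats both cases alike. *)
Definition germ_kernel x m s u : R[i] :=
  germ_base x m u * exp_rem m ((s - x) * hankel_log e u).

Lemma log_weightX w m : log_weight e w -> log_weight e (fun u => w u ^+ m).
Proof.
move=> hw; elim: m => [|m IH]; first exact: log_weight_cst.
have := log_weightM hw IH; congr log_weight.
by apply/funext => u; rewrite exprS.
Qed.

Lemma log_weight_germ_base x m : log_weight e (germ_base x m).
Proof.
apply: log_weightM (log_weight_speed e_gt0).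
exact: log_weightM (log_weight_cexp _ _) (log_weightX _ (log_weight_log e)).
Qed.

Lemma log_weight_germ x m s : log_weight e (germ_kernel x m s).
Proof. exact: log_weightM (log_weight_germ_base x m) (log_weight_exp_rem _ _ _). Qed.

Lemma log_weight_hankel s : log_weight e (hankel_weight s e).
Proof. exact: log_weightM (log_weight_cexp _ _) (log_weight_speed e_gt0). Qed.

Lemma contour_Cintegrable q w C : decaying1 rho del q ->
  contour rho del (hankel_point e) w C ->
  Cintegrable (fun u => q (hankel_point e u) * w u).
Proof.
move=> [mq _ [M bq]] [mp mw sp C0 hw].
have idom : (@lebesgue_measure R).-integrable setT (fun u => (dom u)%:E).
  by apply: integrable_exp_abs; rewrite divr_gt0.
apply: (proj1 (dom_Cintegrable idom (M := `|M| * C) _ _)).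
  by apply: CmeasurableM => //; exact: mq.
move=> u; rewrite normcM.
apply: (@le_trans _ _ (`|M| * (normc (w u) * decay (hankel_point e u)))).
  rewrite [X in _ <= _ * X]mulrC mulrA; apply: ler_wpM2r; first exact: normc_ge0.
  apply: (le_trans (bq _ (sp u))); apply: ler_wpM2r; first exact: expR_ge0.
  exact: ler_norm.
by rewrite -mulrA; apply: ler_wpM2l; [exact: normr_ge0|exact: hw].
Qed.

(* At a positive integer x the weight of t^{x-1} is in the kernel of the
   integral, so it may be subtracted: the pole of the factor is cancelled by
   the zero of t^{s-1} - t^{x-1} at s = x. *)
Lemma hankel_germ x : exists (A : R[i] -> R[i]) (m : nat), derivable A x 1 /\
  \forall s \near (x : R[i]), (s != x \/ not_pos_int x) ->
    not_pos_int s /\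
    contour_equiv rho del
      (hankel_point e) (fun u => A s * germ_kernel x m s u)
      (hankel_point e) (fun u => hankel_factor s * hankel_weight s e u).
Proof.
have near_x := near_not_pos_int x.
have [nx|] := pselect (not_pos_int x).
  (* Away from the positive integers the factor is holomorphic at x, so the weight t^{s-1} is
     kept. *)
  exists (@hankel_factor R), 0%N; split; first exact: derivable_hankel_factor.
  move: near_x; apply: filterS => s hs _; split.
    by have [->|/hs] := eqVneq s x.
  move=> q dq; congr Cintegral; apply/funext => u; congr (_ * (_ * _)).
  rewrite /germ_kernel /germ_base /hankel_weight expr0 mulr1 exp_rem0 mulrAC -cexpD.
  by congr (cexp _ * _); ring.
move=> /existsNP[n /contrapT xn]; have [A [dA hA]] := hankel_factor_pole (R := R) n.
rewrite -xn in dA hA; exists A, 1%N; split=> //.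
near=> s => -[sx|]; last by move=> /(_ n).
have ns : not_pos_int s by have : s != x by []; near: s; exact: near_x.
split=> // q dq.
have As : (s - x) * hankel_factor s = A s.
  by have : s != x by []; near: s; exact: hA.
have [C hC] := log_weight_contour
  (log_weightM (log_weight_cst e (hankel_factor s)) (log_weight_hankel s)).
have [Cx hCx] := log_weight_contour (log_weight_hankel x).
have i1 := contour_Cintegrable dq hC; have i2 := contour_Cintegrable dq hCx.
have -> : (fun u => q (hankel_point e u) * (A s * germ_kernel x 1 s u)) =
    (fun u => q (hankel_point e u) * (hankel_factor s * hankel_weight s e u) +
      - hankel_factor s * (q (hankel_point e u) * hankel_weight x e u)).
  apply/funext => u; rewrite -As /germ_kernel /germ_base expr1 /hankel_weight.
  have h := exp_rem1E ((s - x) * hankel_log e u).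
  have -> : cexp ((s - 1) * hankel_log e u) =
      cexp ((x - 1) * hankel_log e u) * cexp ((s - x) * hankel_log e u).
    by rewrite -cexpD; congr cexp; ring.
  have -> : cexp ((s - x) * hankel_log e u) =
      1 + (s - x) * hankel_log e u * exp_rem 1 ((s - x) * hankel_log e u).
    by rewrite h [RHS]addrC subrK.
  by ring.
rewrite (CintegralD i1 (CintegrableZ _ i2)) (CintegralZ _ i2).
have [mq qD2 [M bq]] := dq.
by rewrite (hankel_vanish (lt_trans e_gt0 e_rho) qD2 mq del_gt0 bq xn e_gt0 e_rho) mulr0 addr0.
Unshelve. all: by end_near. Qed.

Lemma hankel_weight_shift e' s : 0 < e' -> e' < rho ->
  contour_equiv rho del (hankel_point e) (hankel_weight s e)
    (hankel_point e') (hankel_weight s e').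
Proof.
move=> e'0 e'r q [mq qD2 [M bq]].
exact: (hankel_shift s (lt_trans e_gt0 e_rho) qD2 mq del_gt0 bq).
Qed.

(** With L the logarithm, |L| <= e^{|L|}; three factors e^{|L|} cover the worst term of the
    expansion, namely L^2 times an [exp_rem] at h L with |h| <= 1. *)
Definition germ_dom x m u : R :=
  normc (germ_base x m u) * expR (3 * normc (hankel_log e u)).

Lemma germ_dom_bound x m : exists C, 0 <= C /\
  forall u, germ_dom x m u * decay (hankel_point e u) <= C * dom u.
Proof.
apply: log_growth_bound => //; have [_ [C [a [C0 a0 h]]]] := log_weight_germ_base x m.
exists C, (a + 3); split=> // [|u]; first by rewrite addr_ge0.
by rewrite mulrDl expRD mulrA ler_wpM2r ?expR_ge0.
Qed.

(** Applying the recurrence of [exp_rem] twice at h L gives 1/m! + h L / (m+1)! + h^2 L^2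
    [exp_rem m.+2]. Only the k-th coordinate of h enters, so the other linear coefficients are 0. *)
Lemma jet_germ_kernel r (k : 'I_r) x m :
  weight_jet (V := (r.-tuple TR)) (fun v => germ_dom x m (tnth v k))
    (fun (h : 'rV[R[i]]_r) v => germ_kernel x m (h 0 k + x) (tnth v k)).
Proof.
pose L u := hankel_log e u; pose bs := germ_base x m.
have mb : @Cmeasurable R _ TR bs by exact: (log_weight_germ_base x m).1.
have mL : @Cmeasurable R _ TR L by exact: Cmeasurable_hankel_log.
pose a (v : r.-tuple TR) : R[i] := bs (tnth v k) * (m`!%:R^-1).
pose b (j : 'I_r) (v : r.-tuple TR) : R[i] :=
  if j == k then bs (tnth v k) * L (tnth v k) * (m.+1`!%:R^-1) else 0.
have D0 v : 0 <= germ_dom x m (tnth v k) by rewrite mulr_ge0 ?normc_ge0 ?expR_ge0.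
have fact_le n : normc (n`!%:R^-1 : R[i]) <= 1.
  by rewrite normcV normc_nat invf_le1 ?ltr0n ?fact_gt0// ler1n fact_gt0.
have L1 u : normc (L u) <= expR (normc (L u)).
  by have := expR_ge1Dx (normc (L u)); have := normc_ge0 (L u); lra.
have E1 u : 1 <= expR (normc (L u)).
  by have := expR_ge1Dx (normc (L u)); have := normc_ge0 (L u); lra.
have dE u : germ_dom x m u = normc (bs u) *
    (expR (normc (L u)) * expR (normc (L u)) * expR (normc (L u))).
  rewrite /germ_dom -!expRD -/(bs u) -/(L u); congr (_ * expR _); ring.
have e0 u : 0 <= expR (normc (L u)) := expR_ge0 _.
exists a, b, 1; split=> //.
- split=> //.
    by apply: CmeasurableM; [exact: Cmeasurable_tnth|exact: Cmeasurable_cst].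
  move=> v; rewrite mul1r dE normcM; apply: ler_wpM2l; first exact: normc_ge0.
  apply: (le_trans (fact_le _)); move: (expR _) (E1 (tnth v k)) => z z1.
  by rewrite !mulr_ege1.
- move=> j; rewrite /b; case: (j == k); last first.
    by split; [exact: ler01|exact: Cmeasurable_cst|move=> v; rewrite normc0 mul1r].
  split=> //.
    apply: CmeasurableM; last exact: Cmeasurable_cst.
    by apply: CmeasurableM; exact: Cmeasurable_tnth.
  move=> v; rewrite mul1r dE normcM (normcM (bs _)) -[leLHS]mulrA; apply: ler_wpM2l; first exact: normc_ge0.
  apply: (@le_trans _ _ (expR (normc (L (tnth v k))) * 1)).
    by apply: ler_pM; rewrite ?normc_ge0.
  rewrite -mulrA; apply: ler_wpM2l => //; move: (expR _) (E1 (tnth v k)) => z z1.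
  by rewrite mulr_ege1.
move=> h; have mw : @Cmeasurable R _ (r.-tuple TR)
    (fun v => germ_kernel x m (h 0 k + x) (tnth v k)).
  by apply: Cmeasurable_tnth; exact: (log_weight_germ x m _).1.
split=> // h1.
have rE : (fun v => germ_kernel x m (h 0 k + x) (tnth v k) - (a v + linear_part b h v)) =
    (fun v => bs (tnth v k) * (h 0 k ^+ 2 * L (tnth v k) ^+ 2 *
      exp_rem m.+2 (h 0 k * L (tnth v k)))).
  apply/funext => v; rewrite /linear_part (bigD1 k)//= big1 => [|j jk]; last first.
    by rewrite /b (negbTE jk) mulr0.
  rewrite addr0 /a /b eqxx /germ_kernel addrK -/(L _) -/(bs _).
  rewrite (exp_rem_rec m) (exp_rem_rec m.+1).
  move: (bs _) (L _) (exp_rem _ _) (_^-1) (_^-1) => B l E f1 f2; ring.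
rewrite rE; have hk := le_trans (normc_le_l1norm h k) h1.
split; first by rewrite mul1r sqr_ge0.
  apply: CmeasurableM; first exact: Cmeasurable_tnth.
  apply: CmeasurableM; last first.
    apply: Cmeasurable_exp_rem; apply: CmeasurableM; first exact: Cmeasurable_cst.
    exact: Cmeasurable_tnth.
  apply: CmeasurableM; first exact: Cmeasurable_cst.
  by apply: CmeasurableX; exact: Cmeasurable_tnth.
move=> v; rewrite mul1r dE normcM [leRHS]mulrCA; apply: ler_wpM2l.
  exact: normc_ge0.
rewrite normcM normcM normcX normcX -mulrA.
have hN : normc (h 0 k) ^+ 2 <= l1norm h ^+ 2.
  by rewrite lerXn2r ?nnegrE ?normc_ge0 ?l1norm_ge0 ?normc_le_l1norm.
have hE : normc (exp_rem m.+2 (h 0 k * L (tnth v k))) <= expR (normc (L (tnth v k))).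
  apply: (le_trans (normc_exp_rem _ _)); rewrite ler_expR normcM.
  by rewrite ler_piMl ?normc_ge0.
have hL : normc (L (tnth v k)) ^+ 2 <= expR (normc (L (tnth v k))) ^+ 2.
  by rewrite lerXn2r ?nnegrE ?normc_ge0.
rewrite -expr2; apply: ler_pM => //; rewrite ?mulr_ge0 ?sqr_ge0 ?normc_ge0//.
by apply: ler_pM => //; rewrite ?sqr_ge0 ?normc_ge0.
Qed.

End Germs.

(** * Gluing the local expansions into an entire function *)

Section EntireContinuation.
Context {R : realType}.
Variables (rho del : R) (r : nat) (F : ('I_r -> R[i]) -> R[i]) (M : R).
Hypotheses (del_gt0 : 0 < del) (dF : decaying rho del F M).
Local Notation TR := (measurableTypeR R).
Local Notation dom := (exp_abs (R := R) (del / 2)).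
Implicit Types (s x : 'rV[R[i]]_r) (e : R).

Let integral e (w : 'I_r -> R -> R[i]) :=
  tensor_integral F (fun=> hankel_point e) w.

Let contours e (w : 'I_r -> R -> R[i]) : 0 < e -> e < rho ->
  (forall k, log_weight e (w k)) ->
  exists C, forall k, contour rho del (hankel_point e) (w k) (C k).
Proof.
move=> e0 er hw; have [C hC] := @choice _ _
  (fun k C => contour rho del (hankel_point e) (w k) C)
  (fun k => log_weight_contour e0 er del_gt0 (hw k)).
by exists C.
Qed.

Lemma tensor_integral_log_equiv e e' w w' : 0 < e -> e < rho -> 0 < e' -> e' < rho ->
  (forall k, log_weight e (w k)) -> (forall k, log_weight e' (w' k)) ->
  (forall k, contour_equiv rho del (hankel_point e) (w k) (hankel_point e') (w' k)) ->
  integral e w = integral e' w'.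
Proof.
move=> e0 er e'0 e'r hw hw' h.
have [C hC] := contours e0 er hw; have [C' hC'] := contours e'0 e'r hw'.
exact: (tensor_integral_equiv del_gt0 dF hC hC' h).
Qed.

Lemma tensor_integralZ e (a : 'I_r -> R[i]) w : 0 < e -> e < rho ->
  (forall k, log_weight e (w k)) ->
  integral e (fun k u => a k * w k u) = (\prod_k a k) * integral e w.
Proof.
move=> e0 er hw; have [C hC] := contours e0 er hw.
have idom : (@lebesgue_measure R).-integrable setT (fun u => (dom u)%:E).
  by apply: integrable_exp_abs; rewrite divr_gt0.
rewrite /integral /tensor_integral.
rewrite -(Cintegral_tupleZ idom _ (contour_dominated dF.1 hC)).
congr Cintegral_tuple; apply/funext => v; rewrite /tensor_integrand /tensor_weight.
by rewrite big_split /= mulrCA.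
Qed.

(** The value at s uses in each coordinate the germ centred at s_k itself, which makes sense at
    positive integers. Near x it may be replaced by the germ centred at x_k: the two are identical
    if s_k = x_k, and otherwise both are equivalent to the Hankel weight. With the centre fixed, the
    dependence on s is the product of the A_k(s_k) times an integral differentiable at x. *)
Lemma entire_continuation e : 0 < e -> e < rho ->
  exists Z : 'rV[R[i]]_r -> R[i], entire Z /\
  forall e' s, 0 < e' -> e' < rho -> (forall k, not_pos_int (s 0 k)) ->
  Z s = (\prod_k hankel_factor (s 0 k)) *
    integral e' (fun k => hankel_weight (s 0 k) e').
Proof.
move=> e0 er.
have [Am hAm] := @choice _ _ (fun (z : R[i]) (Am : (R[i] -> R[i]) * nat) => derivable Am.1 z 1 /\
  \forall y \near (z : R[i]), (y != z \/ not_pos_int z) ->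
    not_pos_int y /\
    contour_equiv rho del
      (hankel_point e) (fun u => Am.1 y * germ_kernel e z Am.2 y u)
      (hankel_point e) (fun u => hankel_factor y * hankel_weight y e u))
  (fun z => let: ex_intro A (ex_intro m h) := hankel_germ e0 er del_gt0 z in
     ex_intro _ (A, m) h).
pose W z y u := (Am z).1 y * germ_kernel e z (Am z).2 y u.
have lW z y : log_weight e (W z y).
  exact: log_weightM (log_weight_cst _ _) (log_weight_germ e0 _ _ _).
have lH z e' : 0 < e' -> log_weight e' (fun u => hankel_factor z * hankel_weight z e' u).
  by move=> e'0; exact: log_weightM (log_weight_cst _ _) (log_weight_hankel e'0 _).
have W_factor z : not_pos_int z -> contour_equiv rho del (hankel_point e) (W z z)
    (hankel_point e) (fun u => hankel_factor z * hankel_weight z e u).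
  move=> ns; have [_ h] := hAm z.
  by have [] := nbhs_singleton h (or_intror ns).
exists (fun s => integral e (fun k => W (s 0 k) (s 0 k))); split; last first.
  move=> e' s e'0 e'r ns.
  rewrite -tensor_integralZ//; last by move=> k; exact: log_weight_hankel.
  apply: tensor_integral_log_equiv => // k; first exact: lH.
  move=> q dq; rewrite (W_factor _ (ns k) q dq).
  have := hankel_weight_shift e0 er del_gt0 (s 0 k) e'0 e'r.
  (* The shift concerns the bare weight, so the constant factor is moved into the test function. *)
  move=> /(_ (fun z => q z * hankel_factor (s 0 k))) h.
  transitivity (Cintegral (fun u => q (hankel_point e u) * hankel_factor (s 0 k) * hankel_weight (s 0 k) e u)).
    by congr Cintegral; apply/funext => u; rewrite mulrA.
  rewrite h; first by congr Cintegral; apply/funext => u; rewrite mulrA.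
  have [mq dq2 [N bq]] := dq; split.
  - by move=> d T g mg; apply: CmeasurableM; [exact: mq|exact: Cmeasurable_cst].
  - by move=> w sw; apply: D2M; [exact: dq2|exact: D2_cst].
  - exists (N * normc (hankel_factor (s 0 k))) => w sw.
    by rewrite normcM mulrAC; apply: ler_wpM2r; [exact: normc_ge0|exact: bq].
move=> x.
pose A k := (Am (x 0 k)).1; pose m k := (Am (x 0 k)).2.
pose T (v : r.-tuple TR) : R := \prod_k germ_dom e (x 0 k) (m k) (tnth v k).
pose w (h : 'rV[R[i]]_r) (v : r.-tuple TR) : R[i] :=
  \prod_k germ_kernel e (x 0 k) (m k) (h 0 k + x 0 k) (tnth v k).
have jw : weight_jet T w.
  apply: (@weight_jet_prod R _ (r.-tuple TR) r _ (index_enum 'I_r)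
    (fun k v => germ_dom e (x 0 k) (m k) (tnth v k))
    (fun k h v => germ_kernel e (x 0 k) (m k) (h 0 k + x 0 k) (tnth v k))).
    by move=> k v; rewrite mulr_ge0 ?normc_ge0 ?expR_ge0.
  by move=> k; exact: jet_germ_kernel.
have [C hC] := @choice _ _ (fun k C => 0 <= C /\ forall u,
  germ_dom e (x 0 k) (m k) u * expR (- (del * complex.Re (hankel_point e u))) <= C * dom u)
  (fun k => germ_dom_bound e0 del_gt0 (x 0 k) (m k)).
have dG : differentiable (fun s => Cintegral_tuple
    (tensor_integrand F (fun=> hankel_point e) (w (s - x)))) x.
  apply: (differentiable_tensor_integral del_gt0 dF.1 _ _ (T := T) (C := \prod_k C k)) => //.
  - by move=> k; exact: Cmeasurable_hankel_point.
  - by move=> k u; exact: strip_hankel.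
  - by move=> v; apply: prodr_ge0 => k _; rewrite mulr_ge0 ?normc_ge0 ?expR_ge0.
  - move=> v; rewrite /T -!big_split /=; apply: ler_prod => k _.
    by rewrite (hC k).2 !mulr_ge0 ?normc_ge0 ?expR_ge0.
have dA : differentiable (fun s : 'rV[R[i]]_r => \prod_k A k (s 0 k)) x.
  apply: differentiable_prod => k.
  have h1 := @differentiable_coord R[i] 1 r x 0 k.
  have h2 : differentiable (A k) (x 0 k) by apply/derivable1_diffP; exact: (hAm (x 0 k)).1.
  exact: (differentiable_comp h1 h2).
apply: (differentiable_near (differentiableM dA dG)).
pose P (k : 'I_r) (s : 'rV[R[i]]_r) := s 0 k != x 0 k ->
  not_pos_int (s 0 k) /\
  contour_equiv rho del (hankel_point e) (W (x 0 k) (s 0 k))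
    (hankel_point e) (fun u => hankel_factor (s 0 k) * hankel_weight (s 0 k) e u).
have nearA : nbhs x (fun s : 'rV[R[i]]_r => forall k, P k s).
  apply: (@filter_forall _ _ P (nbhs x)) => k; have [_ h] := hAm (x 0 k).
  have h' := @coord_continuous R[i] 1 r 0 k x _ h.
  by refine (@filterS _ (nbhs x) _ _ _ _ h') => s hs sx; exact: hs (or_introl sx).
move: nearA; apply: filterS => s hs.
transitivity (integral e (fun k => W (x 0 k) (s 0 k))).
  apply: (tensor_integral_log_equiv e0 er e0 er) => [k|k|k q dq]; [exact: lW|exact: lW|].
  have [->|/hs[ns h]] := eqVneq (s 0 k) (x 0 k); first by reflexivity.
  by rewrite (W_factor _ ns q dq) (h q dq).
rewrite tensor_integralZ//; last by move=> k; exact: log_weight_germ.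
congr (_ * _); congr Cintegral_tuple; apply/funext => v; congr (_ * _).
by rewrite /tensor_weight /w; apply: eq_bigr => k _; rewrite !mxE subrK.
Qed.

End EntireContinuation.

(** The inverse of 1 plus the sum of the inverses is a lower bound; the 1 keeps it positive for an
    empty family. *)
Lemma exists_pos_lower_bound {R : realType} (r : nat) (f : 'I_r -> R) :
  (forall j, 0 < f j) -> exists2 m, 0 < m & forall j, m <= f j.
Proof.
move=> f0; exists (1 + \sum_j (f j)^-1)^-1 => [|j].
  by rewrite invr_gt0 ltr_pwDl// sumr_ge0// => j _; rewrite invr_ge0 ltW.
have S0 i : 0 <= (f i)^-1 by rewrite invr_ge0 ltW.
rewrite -[leRHS]invrK lef_pV2 ?posrE ?invr_gt0//; last first.
  by rewrite ltr_pwDl// sumr_ge0.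
by rewrite (bigD1 j)//= addrCA lerDl addr_ge0// sumr_ge0.
Qed.

(** A telescoping sum: the factors are exchanged one at a time, and each exchange costs d times the
    product of the majorants. *)
Lemma normc_prodB {R : realType} (J : Type) (s : seq J) (a b : J -> R[i])
    (E : J -> R) (d : R) :
  0 <= d -> (forall j, normc (a j) <= E j) -> (forall j, normc (b j) <= E j) ->
  (forall j, normc (a j - b j) <= d * E j) ->
  normc (\prod_(j <- s) a j - \prod_(j <- s) b j) <= (size s)%:R * d * \prod_(j <- s) E j.
Proof.
move=> d0 ha hb hab.
have E0 j : 0 <= E j by apply: le_trans (ha j); exact: normc_ge0.
elim: s => [|j s IH]; first by rewrite !big_nil subrr normc0 mul0r mul0r.
rewrite !big_cons /=; set A := \prod_(_ <- s) a _ in IH *.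
set B := \prod_(_ <- s) b _ in IH *; set P := \prod_(_ <- s) E _ in IH *.
have P0 : 0 <= P by apply: prodr_ge0.
have hB : normc B <= P.
  by rewrite /B normc_prod; apply: ler_prod => i _; rewrite normc_ge0 hb.
have -> : a j * A - b j * B = a j * (A - B) + (a j - b j) * B by ring.
apply: (le_trans (normcD _ _)); rewrite !normcM.
have h1 : normc (a j) * normc (A - B) <= E j * ((size s)%:R * d * P).
  by apply: ler_pM; rewrite ?normc_ge0.
have h2 : normc (a j - b j) * normc B <= d * E j * P.
  by apply: ler_pM; rewrite ?normc_ge0.
have -> : (size s).+1%:R * d * (E j * P) = E j * ((size s)%:R * d * P) + d * E j * P.
  by rewrite -natr1; ring.
exact: lerD.
Qed.

(** * The limit c -> 1 *)

Section DesingularizedKernel.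
Context {R : realType}.
Variables (r : nat) (gamma : 'I_r -> R[i]).
Hypothesis gamma_gt0 : forall j, 0 < complex.Re (gamma j).
Local Notation decay del z := (expR (- (del * complex.Re z))).

Lemma uniform_factor_bounds : exists rho d C del : R,
  [/\ 0 < rho, 0 < d, 0 < del, 0 <= C & forall j w, strip rho w ->
    exp_rem 1 (gamma j * w) != 0 /\ forall c, `|c - 1| <= d ->
    [/\ desing_factor (gamma j) c w = - (c - 1)%:C * desing_kernel (gamma j) c w,
        normc (desing_kernel (gamma j) c w) <= C * decay del w &
        normc (desing_kernel (gamma j) c w - desing_kernel (gamma j) 1 w) <=
          `|c - 1| * (C * decay del w)]].
Proof.
have [f hf] := @choice _ _ (fun j (t : R * R * (R * R)) =>
  let: (rho, d, (C, del)) := t in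
  [/\ 0 < rho, 0 < d, 0 < del, 0 <= C & forall w, strip rho w ->
    exp_rem 1 (gamma j * w) != 0 /\ forall c, `|c - 1| <= d ->
    [/\ desing_factor (gamma j) c w = - (c - 1)%:C * desing_kernel (gamma j) c w,
        normc (desing_kernel (gamma j) c w) <= C * decay del w &
        normc (desing_kernel (gamma j) c w - desing_kernel (gamma j) 1 w) <=
          C * `|c - 1| * decay del w]])
  (fun j => let: ex_intro rho (ex_intro d (ex_intro C (ex_intro del h))) :=
     desing_factor_bounds (gamma_gt0 j) in ex_intro _ (rho, d, (C, del)) h).
pose rho_ j := (f j).1.1; pose d_ j := (f j).1.2.
pose C_ j := (f j).2.1; pose del_ j := (f j).2.2.
have {}hf j : [/\ 0 < rho_ j, 0 < d_ j, 0 < del_ j, 0 <= C_ j &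
  forall w, strip (rho_ j) w ->
    exp_rem 1 (gamma j * w) != 0 /\ forall c, `|c - 1| <= d_ j ->
    [/\ desing_factor (gamma j) c w = - (c - 1)%:C * desing_kernel (gamma j) c w,
        normc (desing_kernel (gamma j) c w) <= C_ j * decay (del_ j) w &
        normc (desing_kernel (gamma j) c w - desing_kernel (gamma j) 1 w) <=
          C_ j * `|c - 1| * decay (del_ j) w]].
  by have := hf j; rewrite /rho_ /d_ /C_ /del_; case: (f j) => [[? ?] [? ?]].
have [rho rho0 hrho] : exists2 m, 0 < m & forall j, m <= rho_ j.
  by apply: exists_pos_lower_bound => j; have [] := hf j.
have [d d0 hd] : exists2 m, 0 < m & forall j, m <= d_ j.
  by apply: exists_pos_lower_bound => j; have [] := hf j.
have [del del0 hdel] : exists2 m, 0 < m & forall j, m <= del_ j.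
  by apply: exists_pos_lower_bound => j; have [] := hf j.
have CE0 j : 0 <= C_ j * expR (del_ j * rho).
  by rewrite mulr_ge0 ?expR_ge0//; have [] := hf j.
exists rho, d, (\sum_j C_ j * expR (del_ j * rho)), del; split=> //.
  by apply: sumr_ge0.
move=> j w [w1 w2]; have [_ _ delj C0 hj] := hf j.
have hw : strip (rho_ j) w.
  by split; [apply: le_trans w1; rewrite lerN2|exact: le_trans (hrho j)].
have [h1 h2] := hj w hw; split=> // c hc.
have [e1 e2 e3] := h2 c (le_trans hc (hd j)).
(* Lowering the rate from del_j to del is harmless for Re w >= 0; for Re w between -rho and 0 it
   costs at most exp(del_j rho). *)
have key : C_ j * decay (del_ j) w <=
    (\sum_j C_ j * expR (del_ j * rho)) * decay del w.
  apply: (@le_trans _ _ (C_ j * expR (del_ j * rho) * decay del w)).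
    rewrite -mulrA -expRD; apply: ler_wpM2l => //; rewrite ler_expR.
    have g1 : 0 <= (del_ j - del) * (complex.Re w + rho).
      by apply: mulr_ge0; [rewrite subr_ge0|lra].
    have g2 : 0 <= del * rho by rewrite mulr_ge0 ?ltW.
    lra.
  apply: ler_wpM2r; first exact: expR_ge0.
  by rewrite (bigD1 j)//= lerDl sumr_ge0.
split=> //; first exact: le_trans key.
apply: (le_trans e3); rewrite mulrAC mulrC.
by apply: ler_wpM2l; [exact: normr_ge0|exact: key].
Qed.

Definition desing_product (c : R) (t : 'I_r -> R[i]) : R[i] :=
  \prod_j desing_kernel (gamma j) c (tail_sum t j).

Lemma strip_tail_sum (rho : R) (t : 'I_r -> R[i]) j : 0 <= rho ->
  (forall k, strip (rho / r%:R) (t k)) -> strip rho (tail_sum t j).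
Proof.
move=> rho0 ht; have r0 : (0 < r)%N := leq_ltn_trans (leq0n j) (ltn_ord j).
have m0 : 0 <= rho / r%:R by rewrite divr_ge0.
have rE : \sum_(k < r) (rho / r%:R) = rho.
  by rewrite sumr_const card_ord -[_ *+ r]mulr_natr divfK// pnatr_eq0 -lt0n.
have sub (f : 'I_r -> R) : (forall k, f k <= rho / r%:R) ->
    \sum_(k < r | (j <= k)%N) f k <= rho.
  move=> hf; rewrite -rE [leRHS](bigID (fun k : 'I_r => (j <= k)%N)) /=.
  by rewrite ler_wpDr ?sumr_ge0// ler_sum.
rewrite /tail_sum; split.
  rewrite Re_sum lerNl -sumrN; apply: sub => k.
  by have [h _] := ht k; rewrite lerNl.
rewrite Im_sum (le_trans (ler_norm_sum _ _ _))//; apply: sub => k.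
by have [] := ht k.
Qed.

(** The tail sum of index 0 is the full sum, and its factor is already the product of the decays in
    all variables. Each remaining factor is at most exp(del rho), as the real part of a tail sum is
    at least -rho. *)
Lemma decay_tail_sum (rho del : R) (t : 'I_r -> R[i]) : 0 < rho -> 0 < del ->
  (forall k, strip (rho / r%:R) (t k)) ->
  \prod_j decay del (tail_sum t j) <= expR (del * rho) ^+ r * \prod_k decay del (t k).
Proof.
move=> rho0 del0 ht; have := fun j => strip_tail_sum j (ltW rho0) ht.
case: r gamma gamma_gt0 t {ht} => [|r'] _ _ t st; first by rewrite !big_ord0 expr0 mul1r.
rewrite big_ord_recl [leRHS]mulrC.
have -> : \prod_k decay del (t k) = decay del (tail_sum t ord0).
  rewrite /tail_sum (eq_bigl xpredT)//= Re_sum mulr_sumr -sumrN.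
  by rewrite expR_sum.
apply: ler_wpM2l; first exact: expR_ge0.
have e1 : 1 <= expR (del * rho).
  by rewrite -expR0 ler_expR mulr_ge0// ltW.
apply: (@le_trans _ _ (expR (del * rho) ^+ r')).
  rewrite -[r' in leRHS]card_ord -prodr_const; apply: ler_prod => k _.
  rewrite expR_ge0 /= ler_expR -mulrN; apply: ler_wpM2l; first exact: ltW.
  by have [h _] := st (lift ord0 k); rewrite lerNl.
by rewrite exprS ler_peMl// exprn_ge0// expR_ge0.
Qed.

Lemma Cmeasurable_desing_kernel (g : R[i]) (c : R) d (T : measurableType d) (f : T -> R[i]) :
  Cmeasurable f -> Cmeasurable (fun x => desing_kernel g c (f x)).
Proof.
move=> mf; have mc (z : R[i]) : @Cmeasurable R _ T (fun=> z) by exact: Cmeasurable_cst.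
have mg : Cmeasurable (fun x => g * f x) by exact: CmeasurableM.
have mcg z : Cmeasurable (fun x => z * (g * f x)) by exact: CmeasurableM.
rewrite /desing_kernel /exp_psi; apply: CmeasurableM.
  apply: CmeasurableN; apply: CmeasurableD.
    by apply: CmeasurableD; [|apply: CmeasurableN]; exact: Cmeasurable_exp_rem.
  apply: CmeasurableM => //; apply: CmeasurableM; first exact: Cmeasurable_cexp.
  exact: Cmeasurable_exp_rem.
apply: CmeasurableV; apply: CmeasurableM; last exact: Cmeasurable_exp_rem.
by apply: CmeasurableM => //; exact: Cmeasurable_exp_rem.
Qed.

Lemma Cmeasurable_desing_product c d (T : measurableType d) (g : 'I_r -> T -> R[i]) :
  (forall k, Cmeasurable (g k)) -> Cmeasurable (fun x => desing_product c (g^~ x)).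
Proof.
move=> mg; apply: Cmeasurable_prod => j _; apply: Cmeasurable_desing_kernel.
by apply: Cmeasurable_sum => k _.
Qed.

Lemma desing_product_bounds : (0 < r)%N -> exists rho del d M : R,
  [/\ [/\ 0 < rho, 0 < del & 0 < d], decaying rho del (desing_product 1) M,
    forall c, `|c - 1| <= d -> decay_bound rho del (desing_product c) M /\
      decay_bound rho del (fun t => desing_product c t - desing_product 1 t)
        (`|c - 1| * (r%:R * M)) &
    forall (t : 'I_r -> R[i]) j, (forall k, strip rho (t k)) ->
      exists K, forall c, `|c - 1| <= d ->
        desing_factor (gamma j) c (tail_sum t j) =
          - (c - 1)%:C * desing_kernel (gamma j) c (tail_sum t j) /\
        normc (desing_kernel (gamma j) c (tail_sum t j) -
          desing_kernel (gamma j) 1 (tail_sum t j)) <= `|c - 1| * K].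
Proof.
move=> r0; have [rho [d [C [del [rho0 d0 del0 C0 h]]]]] := uniform_factor_bounds.
pose M := C ^+ r * expR (del * rho) ^+ r.
have M0 : 0 <= M by rewrite mulr_ge0 ?exprn_ge0// expR_ge0.
exists (rho / r%:R), del, d, M.
have st (t : 'I_r -> R[i]) j : (forall k, strip (rho / r%:R) (t k)) -> strip rho (tail_sum t j).
  by move=> ht; exact: (strip_tail_sum j (ltW rho0) ht).
have PE (t : 'I_r -> R[i]) : (forall k, strip (rho / r%:R) (t k)) ->
    \prod_j (C * decay del (tail_sum t j)) <= M * \prod_k decay del (t k).
  move=> ht; rewrite big_split /= prodr_const card_ord -mulrA.
  by apply: ler_wpM2l; [exact: exprn_ge0|exact: decay_tail_sum].
have db c : `|c - 1| <= d -> decay_bound (rho / r%:R) del (desing_product c) M.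
  move=> hc; split=> // [d' T g|t ht]; first exact: Cmeasurable_desing_product.
  apply: le_trans (PE t ht); rewrite /desing_product normc_prod.
  apply: ler_prod => j _; rewrite normc_ge0 /=.
  by have [_ /(_ c hc)[]] := h j _ (st t j ht).
have h11 : `|1 - 1| <= d by rewrite subrr normr0 ltW.
split.
- by split=> //; rewrite divr_gt0// ltr0n.
- split; first exact: db.
  move=> t k ht; apply: D2_prod => j _.
  (* The j-th tail sum contains t_k only for j <= k, and then it is t_k plus a constant; otherwise
     the factor is constant in t_k. *)
  have [jk|jk] := boolP (j <= k)%N; last first.
    have -> : (fun z => desing_kernel (gamma j) 1 (tail_sum (set_coord t k z) j)) =
        (fun=> desing_kernel (gamma j) 1 (tail_sum t j)).
      apply/funext => z; congr desing_kernel; apply: eq_bigr => i ji.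
      by rewrite /set_coord; case: eqVneq ji => // ->; rewrite (negbTE jk).
    exact: D2_cst.
  pose c := \sum_(i < r | (j <= i)%N && (i != k)) t i.
  have tE z : tail_sum (set_coord t k z) j = z + c.
    rewrite /tail_sum (bigD1 k)//= /set_coord eqxx; congr (_ + _).
    by apply: eq_bigr => i /andP[_ /negbTE ->].
  have -> : (fun z => desing_kernel (gamma j) 1 (tail_sum (set_coord t k z) j)) =
      (fun z => desing_kernel (gamma j) 1 (z + c)).
    by apply/funext => z; rewrite tE.
  apply: D2_translate; apply: D2_desing_kernel.
  have -> : t k + c = tail_sum t j by rewrite /tail_sum (bigD1 k).
  by have [] := h j _ (st t j ht).
- move=> c hc; split; first exact: db.
  split; first by apply: mulr_ge0 => //; exact: mulr_ge0.
    move=> d' T g mg; apply: CmeasurableD; first exact: Cmeasurable_desing_product.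
    by apply: CmeasurableN; exact: Cmeasurable_desing_product.
  move=> t ht.
  have := @normc_prodB R _ (index_enum 'I_r)
    (fun j => desing_kernel (gamma j) c (tail_sum t j))
    (fun j => desing_kernel (gamma j) 1 (tail_sum t j))
    (fun j => C * decay del (tail_sum t j)) `|c - 1| (normr_ge0 _).
  have sz : size (index_enum 'I_r) = r by rewrite [index_enum _]unlock -enumT size_enum_ord.
  rewrite sz => hB; apply: (le_trans (hB _ _ _)).
  - by move=> j; have [_ /(_ c hc)[]] := h j _ (st t j ht).
  - by move=> j; have [_ /(_ 1 h11)[]] := h j _ (st t j ht).
  - by move=> j; have [_ /(_ c hc)[]] := h j _ (st t j ht).
  have -> : `|c - 1| * (r%:R * M) * \prod_k decay del (t k) =
     r%:R * `|c - 1| * (M * \prod_k decay del (t k)) by ring.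
  by apply: ler_wpM2l; [rewrite mulr_ge0|exact: PE].
- move=> t j ht; exists (C * decay del (tail_sum t j)) => c hc.
  by have [_ /(_ c hc)[e1 _ e3]] := h j _ (st t j ht).
Qed.

End DesingularizedKernel.

Lemma cvg_lipschitz1 {R : realType} (f : R -> R[i]) (l : R[i]) (d K : R) : 0 < d ->
  (forall c, c != 1 -> `|c - 1| <= d -> normc (f c - l) <= `|c - 1| * K) ->
  f c @[c --> (1 : R)^'] --> l.
Proof.
move=> d0 h; apply: (@cvg_normc_le _ _ _ _ _ _ (fun c => `|c - 1| * K)).
  near=> c; rewrite normc_distC; apply: h.
    by near: c; exact: nbhs_dnbhs_neq.
  near: c; apply: nbhs_dnbhs; apply/nbhs_normP; exists d => // c /=.
  by rewrite distrC => /ltW.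
have h1 : `|c - 1| @[c --> (1 : R)] --> `|1 - 1 : R|.
  by apply: cvg_norm; apply: cvgB; [exact: cvg_id|exact: cvg_cst].
have h2 : (fun=> K) c @[c --> (1 : R)] --> K by exact: cvg_cst.
have h3 : `|c - 1| * K @[c --> (1 : R)] --> `|1 - 1 : R| * K by apply: cvgM h1 h2.
by apply: cvg_within_filter; move: h3; rewrite subrr normr0 mul0r.
Unshelve. all: by end_near. Qed.

Theorem theorem1p19 (R : realType) (r : nat) (gamma : 'I_r -> R[i]) :
  (0 < r)%N -> (forall j : 'I_r, 0 < complex.Re (gamma j)) ->
  let H (c : R) (t : 'I_r -> R[i]) :=
    (-1) ^+ r / (c%:C - 1) ^+ r * desing_gen gamma c t in
  let h (j : 'I_r) (c : R) (t : 'I_r -> R[i]) :=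
    (-1) / (c%:C - 1) * desing_factor (gamma j) c (tail_sum t j) in
  let limH t := lim (H c t @[c --> (1 : R)^']) in
  let prodlimh t := \prod_(j < r) lim (h j c t @[c --> (1 : R)^']) in
  exists Z : 'rV[R[i]]_r -> R[i],
    entire Z /\
    \forall eps \near (0 : R)^'+, forall s : 'rV[R[i]]_r,
      (forall (k : 'I_r) (n : nat), s 0 k <> n.+1%:R) ->
      (* the limits exist and the integrals converge absolutely *)
      [/\ \forall c \near (1 : R)^',
            hankel_integrable eps s (desing_gen gamma c),
          cvg (desing_zeta_approx eps gamma s c @[c --> (1 : R)^']),
          forall v : r.-tuple R,
            cvg (H c (hankel_path eps v) @[c --> (1 : R)^']) /\
            forall j, cvg (h j c (hankel_path eps v) @[c --> (1 : R)^']),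
          hankel_integrable eps s limH &
          hankel_integrable eps s prodlimh] /\
      [/\ desing_zeta eps gamma s =
            (\prod_(k < r) hankel_factor (s 0 k)) * hankel_integral eps s limH,
          (\prod_(k < r) hankel_factor (s 0 k)) * hankel_integral eps s limH =
            (\prod_(k < r) hankel_factor (s 0 k)) *
            hankel_integral eps s prodlimh &
          Z s = desing_zeta eps gamma s].
Proof.
move=> r0 gamma0 H h limH prodlimh.
have [rho [del [d [M [[rho0 del0 d0] dF bounds factors]]]]] := desing_product_bounds gamma0 r0.
(* The continuation is built at one fixed radius. [ZE] compares it with every radius below rho, so
   that [Z] can be chosen before eps. *)
have half0 : 0 < rho / 2 by rewrite divr_gt0.
have half1 : rho / 2 < rho by rewrite ltr_pdivrMr// ltr_pMr// ltr1n.
have [Z [entireZ ZE]] := entire_continuation del0 dF half0 half1.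
exists Z; split=> //; near=> eps.
have e0 : 0 < eps by near: eps; exact: nbhs_right_gt.
have er : eps < rho by near: eps; exact: nbhs_right_lt.
move=> s ns.
pose w (k : 'I_r) := hankel_weight (s 0 k) eps.
have lw k : log_weight eps (w k) by exact: log_weight_hankel.
have [C hC] := @choice _ _ (fun k C => contour rho del (hankel_point eps) (w k) C)
  (fun k => log_weight_contour e0 er del0 (lw k)).
have idom : (@lebesgue_measure R).-integrable setT (fun u => (exp_abs (del / 2) u)%:E).
  by apply: integrable_exp_abs; rewrite divr_gt0.
have sp (v : r.-tuple R) k : strip rho (hankel_path eps v k) by exact: strip_hankel.
have dom F' M' : decay_bound rho del F' M' ->
    dominated (exp_abs (del / 2)) (hankel_integrand eps s F') (M' * \prod_k C k).
  by move=> hF; exact: (contour_dominated hF hC).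
have c1_neq0 (c : R) : c != 1 -> c%:C - 1 != 0 :> R[i].
  by move=> c1; rewrite -[1]/((1 : R)%:C) -rmorphB -[0]/((0 : R)%:C)
    (inj_eq (@complexI R)) subr_eq0.
(* For c other than 1 the normalization -1 / (c - 1) exactly cancels the factor -(c - 1) of
   [desing_factor]; the limit c -> 1 thus becomes continuity of the kernel in c. *)
have hE (c : R) v j : c != 1 -> `|c - 1| <= d -> h j c (hankel_path eps v) =
    desing_kernel (gamma j) c (tail_sum (hankel_path eps v) j).
  move=> c1 hc; have [K /(_ c hc)[e _]] := factors _ j (sp v).
  by rewrite /h e rmorphB /=; have := c1_neq0 c c1; move=> ?; field.
have HE (c : R) v : c != 1 -> `|c - 1| <= d -> H c (hankel_path eps v) =
    desing_product gamma c (hankel_path eps v).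
  move=> c1 hc; rewrite /H /desing_gen /desing_product -expr_div_n.
  rewrite -[r in _ ^+ r]card_ord -prodr_const -big_split /=.
  by apply: eq_bigr => j _; exact: hE.
have near_d : \forall c \near (1 : R)^', `|c - 1| <= d.
  apply: nbhs_dnbhs; apply/nbhs_normP; exists d => // c /=.
  by rewrite distrC => /ltW.
have cvg_h v j : h j c (hankel_path eps v) @[c --> (1 : R)^'] -->
    desing_kernel (gamma j) 1 (tail_sum (hankel_path eps v) j).
  have [K hK] := factors _ j (sp v).
  apply: (cvg_lipschitz1 d0 (K := K)) => c c1 hc; rewrite hE//.
  by have [] := hK c hc.
have cvg_H v : H c (hankel_path eps v) @[c --> (1 : R)^'] -->
    desing_product gamma 1 (hankel_path eps v).
  apply: (cvg_lipschitz1 d0 (K := r%:R * M *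
    \prod_k expR (- (del * complex.Re (hankel_path eps v k))))) => c c1 hc.
  rewrite HE// mulrA; have [_ [_ _ hB]] := bounds c hc.
  by apply: (hB _ (sp v)).
have lim_unique (f : R -> R[i]) l : f c @[c --> (1 : R)^'] --> l ->
    lim (f c @[c --> (1 : R)^']) = l.
  by move=> fl; apply: (cvg_lim _ fl); exact: norm_hausdorff.
have limHE v : limH (hankel_path eps v) = desing_product gamma 1 (hankel_path eps v).
  exact: (lim_unique _ _ (cvg_H v)).
have prodE v : prodlimh (hankel_path eps v) = desing_product gamma 1 (hankel_path eps v).
  by apply: eq_bigr => j _; exact: (lim_unique _ _ (cvg_h v j)).
(* The limits are known at contour points only, where the tail sums lie in the strip; the integrand
   takes no other values. *)
have limH_int : hankel_integrand eps s limH = hankel_integrand eps s (desing_product gamma 1).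
  by apply/funext => v; rewrite /hankel_integrand limHE.
have prod_int : hankel_integrand eps s prodlimh =
    hankel_integrand eps s (desing_product gamma 1).
  by apply/funext => v; rewrite /hankel_integrand prodE.
have genE (c : R) : `|c - 1| <= d -> hankel_integrand eps s (desing_gen gamma c) =
    (fun v => (- (c - 1)%:C) ^+ r * hankel_integrand eps s (desing_product gamma c) v).
  move=> hc; apply/funext => v; rewrite /hankel_integrand mulrA; congr (_ * _).
  rewrite /desing_gen /desing_product -[r in _ ^+ r]card_ord -prodr_const -big_split /=.
  by apply: eq_bigr => j _; have [K /(_ c hc)[]] := factors _ j (sp v).
pose I c := hankel_integral eps s (desing_product gamma c).
have approxE (c : R) : c != 1 -> `|c - 1| <= d -> desing_zeta_approx eps gamma s c =
    (\prod_(k < r) hankel_factor (s 0 k)) * I c.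
  move=> c1 hc; rewrite /desing_zeta_approx /hankel_integral genE//.
  rewrite (Cintegral_tupleZ idom _ (dom _ _ (bounds c hc).1)).
  rewrite mulrA; congr (_ * _); rewrite mulrAC -[RHS]mul1r; congr (_ * _).
  rewrite -expr_div_n -exprMn rmorphB /=.
  have -> : -1 / (c%:C - 1) * - (c%:C - 1) = 1 :> R[i].
    by have := c1_neq0 c c1; move=> ?; field.
  by rewrite expr1n.
have h11 : `|1 - 1| <= d by rewrite subrr normr0 ltW.
have cvg_approx : desing_zeta_approx eps gamma s c @[c --> (1 : R)^'] -->
    (\prod_(k < r) hankel_factor (s 0 k)) * I 1.
  apply: (cvg_lipschitz1 d0 (K := normc (\prod_(k < r) hankel_factor (s 0 k)) *
    (r%:R * M * (\prod_k C k) * (2 * dom_integral (exp_abs (del / 2))) ^+ r))).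
  move=> c c1 hc; rewrite approxE// -mulrBr normcM [leRHS]mulrCA.
  apply: ler_wpM2l; first exact: normc_ge0.
  have [b1 b2] := bounds c hc.
  rewrite /I /hankel_integral.
  rewrite -(Cintegral_tupleB idom (dom _ _ b1) (dom _ _ (bounds 1 h11).1)).
  have -> : (fun v => hankel_integrand eps s (desing_product gamma c) v -
      hankel_integrand eps s (desing_product gamma 1) v) =
      hankel_integrand eps s (fun t => desing_product gamma c t - desing_product gamma 1 t).
    by apply/funext => v; rewrite /hankel_integrand mulrBl.
  apply: (le_trans (normc_Cintegral_tuple idom (dom _ _ b2))).
  by rewrite !mulrA.
have zetaE : desing_zeta eps gamma s = (\prod_(k < r) hankel_factor (s 0 k)) * I 1.
  exact: (lim_unique _ _ cvg_approx).
have int1 : hankel_integrable eps s (desing_product gamma 1).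
  exact: (dominated_integrable idom (dom _ _ dF.1)).
split; split.
- move: near_d; apply: filterS => c hc; rewrite /hankel_integrable genE//.
  exact: (dominated_integrable idom (dominatedZ _ (dom _ _ (bounds c hc).1))).
- exact: (cvgP _ cvg_approx).
- by move=> v; split=> [|j]; [exact: (cvgP _ (cvg_H v))|exact: (cvgP _ (cvg_h v j))].
- by rewrite /hankel_integrable limH_int.
- by rewrite /hankel_integrable prod_int.
- by rewrite zetaE /I /hankel_integral limH_int.
- by rewrite /hankel_integral limH_int prod_int.
- by rewrite zetaE (ZE eps s e0 er ns).
Unshelve. all: by end_near. Qed.
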